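(* Let $k$ be an algebraically closed field of characteristic $0$, let $n\ge 2$ be an integer, let $\alpha,\beta\in k$ with $\beta\neq 0$, and let $A=A(\alpha,\beta)$ be the graded down-up algebra with $\deg x=1$, $\deg y=n$. Let $\nabla A$ be its Beilinson algebra, and put $$\delta_n:=\begin{pmatrix}1&0\end{pmatrix}\begin{pmatrix}\alpha&1\\ \beta&0\end{pmatrix}^n\begin{pmatrix}1\\0\end{pmatrix}\in k.$$ Then: (i) $\dim_k \mathrm{HH}^0(\nabla A)=1$. (ii) $\dim_k \mathrm{HH}^1(\nabla A)$ equals - $4$ if $n$ is odd and $\alpha=0$ (in this case $\delta_n=0$); - $3$ if $n$ is odd, $\alpha\ne 0$ and $\delta_n=0$, or if $n$ is even and $\delta_n=0$; - $2$ if $\alpha^2+4\beta=0$ (in this case $\delta_n\neq 0$); - $1$ if $\delta_n\ne 0$ and $\alpha^2+4\beta\neq 0$. (iii) $\dim_k \mathrm{HH}^2(\nabla A)$ equals - $8$ if $n=2$ and $\delta_2=0$; - $7$ if $n=2$ and $\alpha^2+4\beta=0$ (in this case $\delta_2\ne0$); - $6$ if $n=2$, $\delta_2\neq0$ and $\alpha^2+4\beta\ne0$; - $n+5$ if $n$ is odd and $\alpha=0$ (in this case $\delta_n=0$); - $n+4$ if $n$ is odd, $\alpha\neq0$ and $\delta_n=0$, or if $n\geq4$ is even and $\delta_n=0$; - $n+3$ if $n\ge3$ and $\alpha^2+4\beta=0$ (in this case $\delta_n\neq0$); - $n+2$ if $n\ge3$, $\delta_n\ne0$ and $\alpha^2+4\beta\neq0$.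 (iv) $\dim_k\mathrm{HH}^i(\nabla A)=0$ for all $i\ge3$.
   Context: The graded down-up algebra with parameters $\alpha,\beta\in k$ is $A(\alpha,\beta)=k\langle x,y\rangle/(x^2y-\beta yx^2-\alpha xyx,\ xy^2-\beta y^2x-\alpha yxy)$, graded by giving $x,y$ positive integer degrees; write $A=\bigoplus_{i\ge0}A_i$. Beilinson algebra: let $\ell=2(\deg x+\deg y)$ (so $\ell=2n+2$ here). Then $\nabla A$ is the $k$-algebra of upper triangular $\ell\times\ell$ arrays $(a_{ij})_{0\le i,j\le \ell-1}$ with $a_{ij}\in A_{j-i}$ for $i\le j$ and $a_{ij}=0$ for $i>j$, with entrywise addition and multiplication $(a_{ij})(b_{ij})=\left(\sum_{k=0}^{\ell-1}a_{kj}b_{ik}\right)$. Hochschild cohomology: for a finite dimensional $k$-algebra $\Lambda$ with enveloping algebra $\Lambda^{\mathrm e}=\Lambda^{\mathrm{op}}\otimes_k\Lambda$, $\mathrm{HH}^i(\Lambda):=\mathrm{Ext}^i_{\Lambda^{\mathrm e}}(\Lambda,\Lambda)$, where $\Lambda$ is regarded as a right $\Lambda^{\mathrm e}$-module (i.e. a $\Lambda$-bimodule). *)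

(* Defs.v *)
From HB Require Import structures.
From mathcomp Require Import all_boot all_algebra.
From mathcomp Require Import finmap boolp functions.
From mathcomp Require Import monalg.

Set Implicit Arguments.
Unset Strict Implicit.
Unset Printing Implicit Defensive.

Import GRing.Theory.

Local Open Scope ring_scope.
Local Open Scope quotient_scope.

(* A right module over the enveloping algebra L^op (x)_k L is the same thing  *)
(* as an L-bimodule on which k acts centrally:                                *)
(* m . (a (x) b) = ract (lact a m) b.                                         *)
Record bimodule (k : fieldType) (L : algType k) := Bimodule {
  bim_sort :> lmodType k;
  lact : L -> bim_sort -> bim_sort;
  ract : bim_sort -> L -> bim_sort;
  lact_linearl : forall m, linear (lact^~ m);
  lact_linearr : forall a, linear (lact a);
  ract_linearl : forall a, linear (ract^~ a);
  ract_linearr : forall m, linear (ract m);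
  lact1 : forall m, lact 1 m = m;
  ract1 : forall m, ract m 1 = m;
  lactM : forall a b m, lact (a * b) m = lact a (lact b m);
  ractM : forall a b m, ract m (a * b) = ract (ract m a) b;
  lract : forall a m b, ract (lact a m) b = lact a (ract m b)
}.

Section Ext.
Variables (k : fieldType) (L : algType k).
Implicit Types M N P : bimodule L.

Definition bim_hom M N (f : M -> N) : Prop :=
  [/\ linear f,
      forall a m, f (lact a m) = lact a (f m) &
      forall m a, f (ract m a) = ract (f m) a].

Definition projective P : Prop :=
  forall M N (g : M -> N) (f : P -> N),
    bim_hom g -> (forall y, exists x, g x = y) -> bim_hom f ->
    exists2 h : P -> M, bim_hom h & forall p, g (h p) = f p.

Record proj_resolution M := ProjResolution {
  pr_obj : nat -> bimodule L;
  pr_diff : forall i, pr_obj i.+1 -> pr_obj i;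
  pr_aug : pr_obj 0%N -> M;
  pr_projective : forall i, projective (pr_obj i);
  pr_diff_hom : forall i, bim_hom (@pr_diff i);
  pr_aug_hom : bim_hom pr_aug;
  pr_aug_surj : forall m, exists x, pr_aug x = m;
  pr_exact0 : forall x, pr_aug x = 0 <-> exists y, pr_diff y = x;
  pr_exactS : forall i (x : pr_obj i.+1),
    pr_diff x = 0 <-> exists y : pr_obj i.+2, pr_diff y = x
}.

(* For subspaces B <= Z of V: the quotient Z / B has dimension d, i.e. it has *)
(* a basis formed by the classes of d elements e_0, ..., e_(d-1) of Z.        *)
Definition subquot_dim (V : lmodType k) (Z B : V -> Prop) (d : nat) : Prop :=
  exists e : 'I_d -> V,
    [/\ forall j, Z (e j),
        forall z, Z z -> exists c : 'I_d -> k, B (z - \sum_j c j *: e j) &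
        forall c : 'I_d -> k, B (\sum_j c j *: e j) -> forall j, c j = 0].

Definition ext_cocycle M N (R : proj_resolution M) (i : nat)
    (f : pr_obj R i -> N) : Prop :=
  bim_hom f /\ forall x : pr_obj R i.+1, f (pr_diff x) = 0.

Definition ext_coboundary M N (R : proj_resolution M) (i : nat) :
    (pr_obj R i -> N) -> Prop :=
  match i with
  | 0%N => fun f => forall x, f x = 0
  | j.+1 => fun f =>
      exists2 g : pr_obj R j -> N, bim_hom g & forall x, f x = g (pr_diff x)
  end.

(* dim_k Ext^i(M, N) = d in the category of L-bimodules. Any projective       *)
(* resolution of M may be used to compute Ext, and there is at least one.     *)
Definition ext_dim M N (i d : nat) : Prop :=
  inhabited (proj_resolution M) /\
  forall R : proj_resolution M,
    subquot_dim (@ext_cocycle M N R i) (@ext_coboundary M N R i) d.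

End Ext.

Section RegularBimodule.
Variables (k : fieldType) (L : algType k).

Fact reg_linearl (a : L) : linear (fun b : L => b * a).
Proof. by move=> c u v; rewrite mulrDl scalerAl. Qed.

Fact reg_linearr (a : L) : linear (fun b : L => a * b).
Proof. by move=> c u v; rewrite mulrDr scalerAr. Qed.

Definition regular_bimodule : bimodule L :=
  @Bimodule k L L *%R *%R reg_linearl reg_linearr reg_linearl reg_linearr
    (@mul1r L) (@mulr1 L) (fun a b m => esym (mulrA a b m))
    (fun a b m => mulrA m a b) (fun a m b => esym (mulrA a m b)).

Definition HH_dim (i d : nat) : Prop :=
  ext_dim regular_bimodule regular_bimodule i d.

End RegularBimodule.

Section AlgQuotient.
Variables (k : fieldType) (F : algType k) (r : F -> Prop).

(* The two-sided ideal of F generated by r. *)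
Inductive gen_ideal : F -> Prop :=
  | gen_idealR f : r f -> gen_ideal f
  | gen_ideal0 : gen_ideal 0
  | gen_idealD f g : gen_ideal f -> gen_ideal g -> gen_ideal (f + g)
  | gen_idealMl f g : gen_ideal g -> gen_ideal (f * g)
  | gen_idealMr f g : gen_ideal f -> gen_ideal (f * g).

Definition ideal_pred : pred F := fun f => `[< gen_ideal f >].

Fact ideal_zmod_closed : zmod_closed ideal_pred.
Proof.
split=> [|f g /asboolP If /asboolP Ig]; apply/asboolP; first exact: gen_ideal0.
by apply: gen_idealD => //; rewrite -mulN1r; apply: gen_idealMl.
Qed.
HB.instance Definition _ := GRing.isZmodClosed.Build F ideal_pred
  ideal_zmod_closed.

Definition ideal_zmod : zmodClosed F := GRing.ZmodClosed.clone F ideal_pred _.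

(* MathComp rings are nontrivial, so the ideal has to be proper. *)
Variable proper : ~ gen_ideal 1.

Definition alg_quot of ~ gen_ideal 1 : Type := Quotient.quot ideal_zmod.
Local Notation Q := (alg_quot proper).

HB.instance Definition _ := GRing.Zmodule.on Q.
HB.instance Definition _ := EqQuotient.on Q.

Local Notation pr := (\pi_Q).

Lemma quot_piP f g : pr f = pr g <-> gen_ideal (f - g).
Proof.
split=> [/eqP|Ifg].
  by rewrite -[_ == _]Quotient.idealrBE => /asboolP.
by apply/eqP; rewrite -[_ == _]Quotient.idealrBE; apply/asboolP.
Qed.

Lemma quot_piD : {morph pr : f g / f + g}.
Proof. by move=> f g; rewrite [LHS]Quotient.pi_add. Qed.

Lemma quot_pi0 : pr 0 = 0.
Proof. exact: pi_zeror. Qed.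

Definition quot_one : Q := pr 1.

(* The operations are made opaque so that unification does not unfold repr.   *)
Fact quot_mul_sealed :
  {m : Q -> Q -> Q | forall a b, m a b = pr (repr a * repr b)}.
Proof. by exists (fun a b => pr (repr a * repr b)). Qed.
Fact quot_scale_sealed :
  {s : k -> Q -> Q | forall c a, s c a = pr (c *: repr a)}.
Proof. by exists (fun c a => pr (c *: repr a)). Qed.

Definition quot_mul := sval quot_mul_sealed.
Definition quot_scale := sval quot_scale_sealed.

Lemma quot_mul_pi f g : quot_mul (pr f) (pr g) = pr (f * g).
Proof.
rewrite [LHS](svalP quot_mul_sealed); apply/quot_piP.
have /quot_piP If := reprK (pr f); have /quot_piP Ig := reprK (pr g).
set f' := repr (pr f) in If *; set g' := repr (pr g) in Ig *.
have -> : f' * g' - f * g = (f' - f) * g' + f * (g' - g).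
  by rewrite mulrBl mulrBr addrA subrK.
by apply: gen_idealD; [apply: gen_idealMr | apply: gen_idealMl].
Qed.

Lemma quot_scale_pi c f : quot_scale c (pr f) = pr (c *: f).
Proof.
rewrite [LHS](svalP quot_scale_sealed); apply/quot_piP.
have /quot_piP If := reprK (pr f).
by rewrite -scalerBr -mulr_algl; apply: gen_idealMl.
Qed.

Fact quot_mulA : associative quot_mul.
Proof.
elim/quotW=> f; elim/quotW=> g; elim/quotW=> h.
rewrite (quot_mul_pi g h) (quot_mul_pi f (g * h)) (quot_mul_pi f g).
by rewrite (quot_mul_pi (f * g) h) mulrA.
Qed.
Fact quot_mul1 : left_id quot_one quot_mul.
Proof. by elim/quotW=> f; rewrite (quot_mul_pi 1 f) mul1r. Qed.
Fact quot_mulr1 : right_id quot_one quot_mul.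
Proof. by elim/quotW=> f; rewrite (quot_mul_pi f 1) mulr1. Qed.
Fact quot_mulDl : left_distributive quot_mul +%R.
Proof.
elim/quotW=> f; elim/quotW=> g; elim/quotW=> h.
by rewrite -quot_piD !quot_mul_pi -quot_piD mulrDl.
Qed.
Fact quot_mulDr : right_distributive quot_mul +%R.
Proof.
elim/quotW=> f; elim/quotW=> g; elim/quotW=> h.
by rewrite -quot_piD !quot_mul_pi -quot_piD mulrDr.
Qed.
Fact quot_one_neq0 : quot_one != 0.
Proof.
by apply/negP => /eqP; rewrite -quot_pi0 => /quot_piP; rewrite subr0.
Qed.
HB.instance Definition _ := GRing.Zmodule_isNzRing.Build Q
  quot_mulA quot_mul1 quot_mulr1 quot_mulDl quot_mulDr quot_one_neq0.

Fact quot_scaleA c d a : quot_scale c (quot_scale d a) = quot_scale (c * d) a.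
Proof.
by elim/quotW: a => f; rewrite (quot_scale_pi d) !quot_scale_pi scalerA.
Qed.
Fact quot_scale1 : left_id 1 quot_scale.
Proof. by elim/quotW=> f; rewrite quot_scale_pi scale1r. Qed.
Fact quot_scaleDr : right_distributive quot_scale +%R.
Proof.
move=> c; elim/quotW=> f; elim/quotW=> g.
by rewrite -quot_piD !quot_scale_pi -quot_piD scalerDr.
Qed.
Fact quot_scaleDl a : {morph quot_scale^~ a : c d / c + d}.
Proof.
by elim/quotW: a => f c d; rewrite !quot_scale_pi -quot_piD scalerDl.
Qed.
HB.instance Definition _ := GRing.Zmodule_isLmodule.Build k Q
  quot_scaleA quot_scale1 quot_scaleDr quot_scaleDl.

Lemma quot_pi1 : pr 1 = 1.
Proof. by []. Qed.

Lemma quot_piM f g : pr (f * g) = pr f * pr g.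
Proof. exact: esym (quot_mul_pi f g). Qed.

Lemma quot_piZ c f : pr (c *: f) = c *: pr f.
Proof. exact: esym (quot_scale_pi c f). Qed.

Fact quot_scaleAl (c : k) (a b : Q) : c *: (a * b) = c *: a * b.
Proof.
elim/quotW: a => f; elim/quotW: b => g.
by rewrite -quot_piM -!quot_piZ -quot_piM scalerAl.
Qed.
HB.instance Definition _ := GRing.Lmodule_isLalgebra.Build k Q quot_scaleAl.

Fact quot_scaleAr (c : k) (a b : Q) : c *: (a * b) = a * (c *: b).
Proof.
elim/quotW: a => f; elim/quotW: b => g.
by rewrite -quot_piM -!quot_piZ -quot_piM scalerAr.
Qed.
HB.instance Definition _ := GRing.Lalgebra_isAlgebra.Build k Q quot_scaleAr.

End AlgQuotient.

(* A copy of the algebra F whose product and scaling are opaque, which keeps  *)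
(* unification from unfolding those of a concrete F.                          *)
Definition sealed_alg (k : fieldType) (F : algType k) : Type := F.

Section SealedAlgebra.
Variables (k : fieldType) (F : algType k).
Local Notation LF := (sealed_alg F).

HB.instance Definition _ := GRing.Zmodule.on LF.

Fact sa_mul_sealed :
  {m : LF -> LF -> LF | forall f g, m f g = (f : F) * (g : F)}.
Proof. by exists ( *%R : F -> F -> F). Qed.
Fact sa_scale_sealed :
  {s : k -> LF -> LF | forall c f, s c f = c *: (f : F)}.
Proof. by exists ( *:%R : k -> F -> F). Qed.

Definition sa_mul := sval sa_mul_sealed.
Definition sa_scale := sval sa_scale_sealed.

Let sa_mulE_ f g : sa_mul f g = (f : F) * (g : F).
Proof. exact: (svalP sa_mul_sealed). Qed.
Let sa_scaleE_ c f : sa_scale c f = c *: (f : F).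
Proof. exact: (svalP sa_scale_sealed). Qed.

Fact sa_mulA : associative sa_mul.
Proof. by move=> f g h; rewrite !sa_mulE_; apply: (@mulrA F). Qed.
Fact sa_mul1 : left_id (1 : F) sa_mul.
Proof. by move=> f; rewrite sa_mulE_; apply: (@mul1r F). Qed.
Fact sa_mulr1 : right_id (1 : F) sa_mul.
Proof. by move=> f; rewrite sa_mulE_; apply: (@mulr1 F). Qed.
Fact sa_mulDl : left_distributive sa_mul +%R.
Proof. by move=> f g h; rewrite !sa_mulE_; apply: (@mulrDl F). Qed.
Fact sa_mulDr : right_distributive sa_mul +%R.
Proof. by move=> f g h; rewrite !sa_mulE_; apply: (@mulrDr F). Qed.
HB.instance Definition _ := GRing.Zmodule_isNzRing.Build LF
  sa_mulA sa_mul1 sa_mulr1 sa_mulDl sa_mulDr (oner_neq0 F).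

Fact sa_scaleA c d f : sa_scale c (sa_scale d f) = sa_scale (c * d) f.
Proof. by rewrite !sa_scaleE_; apply: (@scalerA k F). Qed.
Fact sa_scale1 : left_id 1 sa_scale.
Proof. by move=> f; rewrite sa_scaleE_; apply: (@scale1r k F). Qed.
Fact sa_scaleDr : right_distributive sa_scale +%R.
Proof. by move=> c f g; rewrite !sa_scaleE_; apply: (@scalerDr k F). Qed.
Fact sa_scaleDl f : {morph sa_scale^~ f : c d / c + d}.
Proof. by move=> c d; rewrite !sa_scaleE_; apply: (@scalerDl k F). Qed.
HB.instance Definition _ := GRing.Zmodule_isLmodule.Build k LF
  sa_scaleA sa_scale1 sa_scaleDr sa_scaleDl.

Lemma sa_mulE (f g : LF) : f * g = (f : F) * (g : F) :> F.
Proof. exact: sa_mulE_. Qed.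

Lemma sa_scaleE c (f : LF) : c *: f = c *: (f : F) :> F.
Proof. exact: sa_scaleE_. Qed.

Fact sa_scaleAl (c : k) (f g : LF) : c *: (f * g) = c *: f * g.
Proof. by rewrite !(sa_mulE, sa_scaleE); apply: (@scalerAl k F). Qed.
HB.instance Definition _ := GRing.Lmodule_isLalgebra.Build k LF sa_scaleAl.

Fact sa_scaleAr (c : k) (f g : LF) : c *: (f * g) = f * (c *: g).
Proof. by rewrite !(sa_mulE, sa_scaleE); apply: (@scalerAr k F). Qed.
HB.instance Definition _ := GRing.Lalgebra_isAlgebra.Build k LF sa_scaleAr.

End SealedAlgebra.

Definition free_malg (k : fieldType) : Type := {malg k[{fmonom bool}]}.

Section FreeAlgebra.
Variable k : fieldType.

HB.instance Definition _ := GRing.Lalgebra.on (free_malg k).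

Fact free_scaleAr (c : k) (f g : free_malg k) : c *: (f * g) = f * (c *: g).
Proof.
have Cc h : h * c%:MP = c *: h :> {malg k[{fmonom bool}]}.
  rewrite malgM_def malgZ_def fgmulgU; apply/eq_bigr => m _.
  by rewrite mulm1 mulrC.
by rewrite -[LHS]Cc -[LHS]mulrA -[c *: g]Cc.
Qed.
HB.instance Definition _ :=
  GRing.Lalgebra_isAlgebra.Build k (free_malg k) free_scaleAr.

(* The free algebra k<x,y>; the letters x and y are coded by false and true.  *)
Definition free_xy : Type := sealed_alg (free_malg k).
HB.instance Definition _ := GRing.Algebra.on free_xy.

Definition free_x : free_xy := << fmu false >>.
Definition free_y : free_xy := << fmu true >>.

End FreeAlgebra.

Section DownUp.
Variables (k : fieldType) (alpha beta : k).
Local Notation x := (free_x k).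
Local Notation y := (free_y k).

Inductive du_rel : free_xy k -> Prop :=
  | du_rel1 :
      du_rel (x ^+ 2 * y - beta *: (y * x ^+ 2) - alpha *: (x * y * x))
  | du_rel2 :
      du_rel (x * y ^+ 2 - beta *: (y ^+ 2 * x) - alpha *: (y * x * y)).

Fact du_rel_eval (L : lalgType k) (u v : L) (ev : L -> k) :
  (forall f g, ev (f * g) = ev f * ev g) ->
  (forall f g, ev (f + g) = ev f + ev g) ->
  (forall c f, ev (c *: f) = c * ev f) -> ev u = 0 -> ev v = 0 ->
  ev (u ^+ 2 * v - beta *: (v * u ^+ 2) - alpha *: (u * v * u)) = 0 /\
  ev (u * v ^+ 2 - beta *: (v ^+ 2 * u) - alpha *: (v * u * v)) = 0.
Proof.
move=> evM evD evZ evu evv.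
have evN f : ev (- f) = - ev f by rewrite -scaleN1r evZ mulN1r.
by split; rewrite !expr2 !(evD, evN, evZ, evM) evu evv !(mulr0, oppr0, addr0).
Qed.

Fact du_proper : ~ gen_ideal du_rel 1.
Proof.
have [ev [ev1 evM evD evZ evU]] : exists ev : free_xy k -> k,
    [/\ ev 1 = 1, forall f g, ev (f * g) = ev f * ev g,
        forall f g, ev (f + g) = ev f + ev g,
        forall c f, ev (c *: f) = c * ev f & forall b, ev << fmu b >> = 0].
  exists (mcoeff mone); split=> [|f g|f g|c f|b].
  - by rewrite mcoeff1 eqxx.
  - by rewrite sa_mulE; apply: (@rmorphM {malg k[_]} k (mcoeff mone)).
  - exact: mcoeffD.
  - by rewrite sa_scaleE; apply: mcoeffZ.
  - by rewrite mcoeffU1 fm1_eq1.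
have evx : ev x = 0 by apply: evU.
have evy : ev y = 0 by apply: evU.
have [ev_rel1 ev_rel2] := du_rel_eval evM evD evZ evx evy.
suff I0 f : gen_ideal du_rel f -> ev f = 0.
  by move=> /I0 /eqP; rewrite ev1 oner_eq0.
elim=> [h []||g h _ g0 _ h0|g h _ h0|g h _ g0].
- by apply: ev_rel1.
- by apply: ev_rel2.
- by rewrite -(scale0r 0) evZ mul0r.
- by rewrite evD g0 h0 addr0.
- by rewrite evM h0 mulr0.
- by rewrite evM g0 mul0r.
Qed.

Definition down_up : Type := alg_quot du_proper.
HB.instance Definition _ := GRing.Algebra.on down_up.
HB.instance Definition _ := EqQuotient.on down_up.

End DownUp.

Section Grading.
Variables (n : nat) (k : fieldType) (alpha beta : k).
Local Notation A := (down_up alpha beta).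

(* deg x = 1 and deg y = n *)
Definition word_deg (w : {fmonom bool}) : nat :=
  (\sum_(b <- w) if b then n else 1)%N.

Definition homog (d : nat) (f : free_xy k) : Prop :=
  forall w, f@_w != 0 -> word_deg w = d.

(* The graded component A_d: images of the homogeneous elements of degree d.  *)
Definition du_comp (d : nat) (a : A) : Prop :=
  exists2 f, homog d f & a = \pi_A f.

Lemma du_comp0 d : du_comp d 0.
Proof.
by exists 0; [move=> w; rewrite mcoeff0 eqxx | rewrite quot_pi0].
Qed.

Lemma du_comp_lin d c a b :
  du_comp d a -> du_comp d b -> du_comp d (c *: a + b).
Proof.
move=> [f hf ->] [g hg ->]; exists (c *: f + g); last first.
  by rewrite quot_piD quot_piZ.
move=> w; rewrite mcoeffD sa_scaleE mcoeffZ => nz.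
have [f0|/hf //] := eqVneq (f@_w) 0; have [g0|/hg //] := eqVneq (g@_w) 0.
by move: nz; rewrite f0 g0 mulr0 addr0 eqxx.
Qed.

Lemma du_comp1 : du_comp 0 1.
Proof.
exists 1 => // w; rewrite mcoeff1.
have [->|] := eqVneq w mone; last by rewrite eqxx.
by rewrite /word_deg fm1 big_nil.
Qed.

Lemma du_compM d e a b : du_comp d a -> du_comp e b -> du_comp (d + e) (a * b).
Proof.
move=> [f hf ->] [g hg ->]; exists (f * g); last by rewrite quot_piM.
move=> w; rewrite sa_mulE mcoeff_neq0 => /msuppM_le [u [v [fu gv ->]]].
rewrite /word_deg fmM big_cat /=.
by congr (_ + _)%N; [apply: hf | apply: hg]; rewrite mcoeff_neq0.
Qed.

End Grading.

Section Beilinson.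
Variables (n : nat) (k : fieldType) (alpha beta : k).
Local Notation A := (down_up alpha beta).

Definition beil_size : nat := (2 * (1 + n))%N.
Local Notation l := beil_size.

Definition beil_pred : pred {ffun 'I_l * 'I_l -> A} := fun a =>
  `[< forall i j : 'I_l,
        if (i <= j)%N then du_comp n (j - i) (a (i, j)) else a (i, j) = 0 >].

Fact beil_submod_closed : submod_closed beil_pred.
Proof.
split=> [|c a b /asboolP Ha /asboolP Hb]; apply/asboolP => i j.
  by rewrite ffunE; case: ifP => // _; apply: du_comp0.
rewrite !ffunE; move: (Ha i j) (Hb i j); case: ifP => [_|_ -> ->].
  exact: du_comp_lin.
by rewrite scaler0 addr0.
Qed.
HB.instance Definition _ :=
  GRing.isSubmodClosed.Build k {ffun 'I_l * 'I_l -> A} beil_pred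
    beil_submod_closed.

Record nabla : Type := Nabla {
  nabla_val :> {ffun 'I_l * 'I_l -> A};
  nabla_valP : nabla_val \in beil_pred
}.

HB.instance Definition _ := [isSub for nabla_val].
HB.instance Definition _ := [Choice of nabla by <:].
HB.instance Definition _ := [SubChoice_isSubLmodule of nabla by <:].

Fact nabla_one_subproof :
  [ffun p : 'I_l * 'I_l => (p.1 == p.2)%:R : A] \in beil_pred.
Proof.
apply/asboolP => i j; rewrite ffunE /=; have [->|ne] := eqVneq i j.
  by rewrite leqnn subnn; apply: du_comp1.
by case: ifP => // _; apply: du_comp0.
Qed.
Definition nabla_one := Nabla nabla_one_subproof.

Fact nabla_mul_subproof (a b : nabla) :
  [ffun p : 'I_l * 'I_l => \sum_(m < l) a (m, p.2) * b (p.1, m)] \in beil_pred.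
Proof.
case: a b => [a /= /asboolP Ha] [b /= /asboolP Hb].
apply/asboolP => i j; rewrite ffunE /=.
have Hm m : if (i <= j)%N then du_comp n (j - i) (a (m, j) * b (i, m))
            else a (m, j) * b (i, m) = 0.
  move: (Ha m j) (Hb i m); case: (leqP m j) => [mj|_ -> _]; last first.
    by rewrite mul0r; case: ifP => // _; apply: du_comp0.
  case: (leqP i m) => [im|_ _ ->]; last first.
    by rewrite mulr0; case: ifP => // _; apply: du_comp0.
  rewrite (leq_trans im mj) => am bm.
  have -> : (j - i = (j - m) + (m - i))%N by rewrite addnBA // subnK.
  exact: du_compM.
case: ifP Hm => ij Hm; last by rewrite big1.
apply: (big_ind (@du_comp n k alpha beta (j - i))) => //; first exact: du_comp0.
by move=> u v Hu Hv; rewrite -[u]scale1r; apply: du_comp_lin.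
Qed.
Fact nabla_mul_sealed :
  {m : nabla -> nabla -> nabla |
    forall a b, m a b = Nabla (nabla_mul_subproof a b)}.
Proof. by exists (fun a b => Nabla (nabla_mul_subproof a b)). Qed.
Definition nabla_mul := sval nabla_mul_sealed.

Lemma nablaP (a b : nabla) : (forall i j, a (i, j) = b (i, j)) -> a = b.
Proof. by move=> ab; apply: val_inj; apply/ffunP => -[i j]; apply: ab. Qed.

Lemma nabla_oneE i j : nabla_one (i, j) = (i == j)%:R.
Proof. by rewrite ffunE. Qed.

Lemma nabla_mulE a b i j :
  nabla_mul a b (i, j) = \sum_(m < l) a (m, j) * b (i, m).
Proof. by rewrite /nabla_mul (svalP nabla_mul_sealed) ffunE. Qed.

Lemma nabla_addE (a b : nabla) i j : (a + b) (i, j) = a (i, j) + b (i, j).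
Proof. by rewrite ffunE. Qed.

Lemma nabla_scaleE c (a : nabla) i j : (c *: a) (i, j) = c *: a (i, j).
Proof. by rewrite ffunE. Qed.

Fact nabla_mulA : associative nabla_mul.
Proof.
move=> a b c; apply: nablaP => i j; rewrite !nabla_mulE.
under eq_bigr => m _ do rewrite nabla_mulE mulr_sumr.
rewrite exchange_big /=; apply: eq_bigr => m _.
by rewrite nabla_mulE mulr_suml; apply: eq_bigr => p _; rewrite mulrA.
Qed.

Fact nabla_mul1 : left_id nabla_one nabla_mul.
Proof.
move=> a; apply: nablaP => i j; rewrite nabla_mulE.
rewrite (bigD1 j) //= nabla_oneE eqxx mul1r big1 ?addr0 // => m /negPf ne.
by rewrite nabla_oneE ne mul0r.
Qed.

Fact nabla_mulr1 : right_id nabla_one nabla_mul.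
Proof.
move=> a; apply: nablaP => i j; rewrite nabla_mulE.
rewrite (bigD1 i) //= nabla_oneE eqxx mulr1 big1 ?addr0 // => m /negPf ne.
by rewrite nabla_oneE eq_sym ne mulr0.
Qed.

Fact nabla_mulDl : left_distributive nabla_mul +%R.
Proof.
move=> a b c; apply: nablaP => i j; rewrite nabla_addE !nabla_mulE -big_split.
by apply: eq_bigr => m _; rewrite nabla_addE mulrDl.
Qed.

Fact nabla_mulDr : right_distributive nabla_mul +%R.
Proof.
move=> a b c; apply: nablaP => i j; rewrite nabla_addE !nabla_mulE -big_split.
by apply: eq_bigr => m _; rewrite nabla_addE mulrDr.
Qed.

Fact nabla_one_neq0 : nabla_one != 0.
Proof.
have l0 : (0 < l)%N by [].
apply/eqP => /(congr1 (fun a : nabla => a (Ordinal l0, Ordinal l0))) /eqP.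
by rewrite nabla_oneE eqxx ffunE oner_eq0.
Qed.
HB.instance Definition _ := GRing.Zmodule_isNzRing.Build nabla
  nabla_mulA nabla_mul1 nabla_mulr1 nabla_mulDl nabla_mulDr nabla_one_neq0.

Fact nabla_scaleAl (c : k) (a b : nabla) : c *: (a * b) = c *: a * b.
Proof.
apply: nablaP => i j; rewrite nabla_scaleE.
rewrite [in LHS]nabla_mulE [RHS]nabla_mulE scaler_sumr.
by apply: eq_bigr => m _; rewrite nabla_scaleE scalerAl.
Qed.
HB.instance Definition _ := GRing.Lmodule_isLalgebra.Build k nabla
  nabla_scaleAl.

Fact nabla_scaleAr (c : k) (a b : nabla) : c *: (a * b) = a * (c *: b).
Proof.
apply: nablaP => i j; rewrite nabla_scaleE.
rewrite [in LHS]nabla_mulE [RHS]nabla_mulE scaler_sumr.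
by apply: eq_bigr => m _; rewrite nabla_scaleE scalerAr.
Qed.
HB.instance Definition _ := GRing.Lalgebra_isAlgebra.Build k nabla
  nabla_scaleAr.

End Beilinson.

Definition du_delta (k : fieldType) (alpha beta : k) (n : nat) : k :=
  let T : 'M[k]_2 :=
    \matrix_(i, j) nth 0 (nth [::] [:: [:: alpha; 1]; [:: beta; 0]] i) j in
  let u : 'rV[k]_2 := \row_j [:: 1; 0]`_j in
  (u *m T ^+ n *m u^T) 0 0.

(* Main.v *)
Require Import Defs.
From HB Require Import structures.
From mathcomp Require Import all_boot all_algebra.
From mathcomp Require Import finmap boolp functions.
From mathcomp Require Import monalg.
From mathcomp Require Import zify ring.

(** Write L for the Beilinson algebra. It is generated by the vertex idempotents
    E_i, with i < 2n+2, and two elements X and Y that raise the vertex by 1 and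
    by n and satisfy the down-up relations. Since arrows of L move a vertex by at
    most 2n+1, the words W X^c E_i with W one of 1, Y, XY, Y^2, YXY and with
    target i + c + deg W below 2n+2 form a basis: they span by rewriting
    x^2 y and x y^2, and they are independent because the down-up algebra acts on
    a space of dimension 6 in which the five heads W remain independent.

    This basis gives a bimodule resolution
      0 -> P2 -> P1 -> P0 -> L -> 0
    by free bimodules: P0 has one generator g of degree 0, P1 has g_x and g_y of
    degrees 1 and n sent to the commutators Xg - gX and Yg - gY, and P2 has one
    generator for each relation, of degrees n+2 and 2n+1, sent to the value at
    that relation of the universal derivation X |-> g_x, Y |-> g_y.
    Exactness at P0 holds since modulo the image g commutes with the generators
    of L. Exactness at P1 holds since modulo the image of P2 the assignment
    X |-> g_x, Y |-> g_y extends to a derivation defined on words, which yields a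
    left inverse of P1 -> P0 modulo that image. The map P2 -> P1 is injective
    because the g_y component of the derived relation x^2 y has leading term
    a X^2 g_y w, and right multiplication by X^2 is injective where it occurs; the
    other relation lives at a single vertex and is read off one coefficient.

    By the comparison theorem (ext_dimP) the cohomology of Hom(P, L) is the
    Hochschild cohomology, whatever resolution is used in its definition. It
    vanishes from degree 3 on, and in degree 0 it is the centre, the scalars.

    A cochain of degree 1 is given by scalars:
    g_x |-> sum a_i X E_i and g_y |-> sum (b_i Y + c_i X^n) E_i.
    A coboundary removes a. The cocycle condition then says that b_i = s + t (-1)^i,
    with t = 0 unless alpha = 0 and n is odd, and that c solves the recurrence
    c_i = alpha c_(i+1) + beta c_(i+2), so it is determined by two parameters
    d0, d1. The relation x y^2, once X^(n+1) Y is rewritten with the coefficients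
    of that recurrence, leaves two conditions
      delta (2 beta d0 + alpha d1) = 0 and
      delta (alpha beta d0 + (alpha^2 + 2 beta) d1) = 0,
    where delta = p_(n+1) for the solution p of p_(m+2) = alpha p_(m+1) + beta p_m
    with p_0 = 0 and p_1 = 1. The determinant of this system is
    delta^2 beta (alpha^2 + 4 beta), which produces the four cases for HH^1.
    When alpha^2 + 4 beta = 0 the characteristic polynomial has a double root alpha/2 and
    delta = (n+1) (alpha/2)^n is nonzero in characteristic 0; when alpha = 0 and
    n is odd every other term of the recurrence vanishes, delta among them.

    The dimension of HH^2 follows from the Euler characteristic: counting words
    of the right degrees, the spaces Hom(P_i, L) have dimensions 2n+2, 4n+5 and
    3n+5, except that the last is 13 when n = 2, where Y^2 has degree n+2. *)

Set Implicit Arguments.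
Unset Strict Implicit.
Unset Printing Implicit Defensive.

Import GRing.Theory.
Local Open Scope ring_scope.

(** * Ext computed from one projective resolution *)

Section UnbundledLinear.
Variables (R : pzRingType) (U V : lmodType R) (f : U -> V).
Hypothesis f_lin : linear f.

Lemma lin0 : f 0 = 0.
Proof. by have := f_lin (-1) 0 0; rewrite scaler0 addr0 scaleN1r addNr. Qed.
Lemma linD : {morph f : u v / u + v}.
Proof. by move=> u v; have := f_lin 1 u v; rewrite !scale1r. Qed.
Lemma linZ c : {morph f : u / c *: u}.
Proof. by move=> u; have := f_lin c u 0; rewrite lin0 !addr0. Qed.
Lemma linN : {morph f : u / - u}.
Proof. by move=> u; rewrite -scaleN1r linZ scaleN1r. Qed.

End UnbundledLinear.

Section BimoduleHom.
Variables (k : fieldType) (L : algType k).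
Implicit Types M N P : bimodule L.

Lemma bim_hom_lin M N (f : M -> N) : bim_hom f -> linear f.
Proof. by case. Qed.

Lemma bim_hom0 M N (f : M -> N) : bim_hom f -> f 0 = 0.
Proof. by case=> /lin0. Qed.

Lemma bim_homD M N (f : M -> N) : bim_hom f -> {morph f : u v / u + v}.
Proof. by case=> /linD. Qed.

Lemma bim_homN M N (f : M -> N) : bim_hom f -> {morph f : u / - u}.
Proof. by case=> /linN. Qed.

Lemma bim_homB M N (f : M -> N) : bim_hom f -> {morph f : u v / u - v}.
Proof. by move=> hf u v; rewrite (bim_homD hf) (bim_homN hf). Qed.

Lemma bim_homZ M N (f : M -> N) c : bim_hom f -> {morph f : u / c *: u}.
Proof. by case=> /linZ lf _ _; apply: lf. Qed.

Lemma bim_hom_sum M N (f : M -> N) I (r : seq I) (p : pred I) (F : I -> M) :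
  bim_hom f -> f (\sum_(i <- r | p i) F i) = \sum_(i <- r | p i) f (F i).
Proof.
move=> hf; elim: r => [|i r IH]; first by rewrite !big_nil (bim_hom0 hf).
by rewrite !big_cons; case: (p i); rewrite // (bim_homD hf) IH.
Qed.

Lemma bim_hom_id M : bim_hom (fun m : M => m).
Proof. by split. Qed.

Lemma bim_hom_zero M N : bim_hom (fun _ : M => 0 : N).
Proof.
split=> [c u v|a m|m a]; first by rewrite scaler0 addr0.
- by rewrite (lin0 (lact_linearr a)).
- by rewrite (lin0 (ract_linearl a)).
Qed.

Lemma bim_hom_comp M N P (g : N -> P) (f : M -> N) :
  bim_hom g -> bim_hom f -> bim_hom (fun m => g (f m)).
Proof.
move=> [lg gl gr] [lf fl fr]; split=> [c u v|a m|m a].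
- by rewrite lf lg.
- by rewrite fl gl.
- by rewrite fr gr.
Qed.

Lemma bim_hom_linD M N (f g : M -> N) c :
  bim_hom f -> bim_hom g -> bim_hom (fun m => c *: f m + g m).
Proof.
move=> [lf fl fr] [lg gl gr]; split=> [d u v|a m|m a].
- rewrite lf lg !scalerDr !scalerA [c * d]mulrC addrACA; congr (_ + _).
- by rewrite fl gl (lact_linearr a).
- by rewrite fr gr (ract_linearl a).
Qed.

Lemma bim_hom_sub M N (f g : M -> N) :
  bim_hom f -> bim_hom g -> bim_hom (fun m => f m - g m).
Proof.
move=> hf hg; have := bim_hom_linD (-1) hg hf.
by congr bim_hom; apply: funext => m; rewrite scaleN1r addrC.
Qed.

End BimoduleHom.

(** Projectivity is stated for surjections only. The pullback of g along f
    projects onto P as soon as the image of g contains that of f. *)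
Section Pullback.
Variables (k : fieldType) (L : algType k) (M N P : bimodule L).

(** Bundling the maps lets the type of the pullback depend on them. *)
Record bhom (A B : bimodule L) := Bhom { bfun :> A -> B; bhomP : bim_hom bfun }.

Variables (g : bhom M N) (f : bhom P N).

Definition pullback_pred : pred (M * P)%type := fun u => `[< g u.1 = f u.2 >].

Fact pullback_submod : submod_closed pullback_pred.
Proof.
split=> [|c u v /asboolP gu /asboolP gv]; apply/asboolP => /=.
  by rewrite (bim_hom0 (bhomP g)) (bim_hom0 (bhomP f)).
by rewrite (bim_hom_lin (bhomP g)) (bim_hom_lin (bhomP f)) gu gv.
Qed.
HB.instance Definition _ :=
  GRing.isSubmodClosed.Build k (M * P)%type pullback_pred pullback_submod.

Record pullback : Type := Pullback {
  pb_val :> (M * P)%type;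
  pb_valP : pb_val \in pullback_pred
}.
HB.instance Definition _ := [isSub for pb_val].
HB.instance Definition _ := [Choice of pullback by <:].
HB.instance Definition _ := [SubChoice_isSubLmodule of pullback by <:].

Fact pb_lact_sub a (u : pullback) : (lact a u.1, lact a u.2) \in pullback_pred.
Proof.
apply/asboolP => /=; have /asboolP gu := pb_valP u.
by case: (bhomP g) => _ -> _; case: (bhomP f) => _ -> _; rewrite gu.
Qed.
Fact pb_ract_sub (u : pullback) a : (ract u.1 a, ract u.2 a) \in pullback_pred.
Proof.
apply/asboolP => /=; have /asboolP gu := pb_valP u.
by case: (bhomP g) => _ _ ->; case: (bhomP f) => _ _ ->; rewrite gu.
Qed.

Definition pb_bimodule : bimodule L.
Proof.
refine (@Bimodule k L pullback (fun a u => Pullback (pb_lact_sub a u))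
  (fun u a => Pullback (pb_ract_sub u a)) _ _ _ _ _ _ _ _ _).
- by move=> u c a b; apply: val_inj; rewrite /= !(lact_linearl _ c).
- by move=> a c u v; apply: val_inj; rewrite /= !(lact_linearr _ c).
- by move=> a c u v; apply: val_inj; rewrite /= !(ract_linearl _ c).
- by move=> u c a b; apply: val_inj; rewrite /= !(ract_linearr _ c).
- by move=> u; apply: val_inj; rewrite /= !lact1; case: (u) => -[].
- by move=> u; apply: val_inj; rewrite /= !ract1; case: (u) => -[].
- by move=> a b u; apply: val_inj; rewrite /= !lactM.
- by move=> a b u; apply: val_inj; rewrite /= !ractM.
- by move=> a u b; apply: val_inj; rewrite /= !lract.
Defined.

End Pullback.

Section Comparison.
Variables (k : fieldType) (L : algType k).
Implicit Types M N P : bimodule L.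

(** Lifting f along g is finding a section of the projection of the pullback
    to P. This is the form used for differentials, which are onto
    the next kernel only. *)
Lemma projective_lift P M N (g : M -> N) (f : P -> N) :
  projective P -> bim_hom g -> bim_hom f -> (forall p, exists x, g x = f p) ->
  exists2 h : P -> M, bim_hom h & forall p, g (h p) = f p.
Proof.
move=> projP hg hf fg.
pose Q := pb_bimodule (Bhom hg) (Bhom hf).
have h2 : bim_hom (fun u : Q => (val u).2) by split.
have h1 : bim_hom (fun u : Q => (val u).1) by split.
have [|h hh hK] := projP _ _ _ (fun p => p) h2 _ (bim_hom_id P).
  move=> p; have [x gx] := fg p.
  have Qx : (x, p) \in pullback_pred (Bhom hg) (Bhom hf) by apply/asboolP.
  by exists (Pullback Qx).
exists (fun p => (val (h p)).1); first exact: bim_hom_comp h1 hh.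
by move=> p; have /asboolP := pb_valP (h p); rewrite /= => ->; rewrite -[in RHS](hK p).
Qed.

Variable M : bimodule L.
Implicit Types R S : proj_resolution M.

(** With M put in degree 0, lifts and homotopies are built by a single recursion:
    the identity of M is its base and the augmentation behaves like any other
    differential. *)
Definition aug_obj R i := if i is j.+1 then pr_obj R j else M.
Definition aug_diff R i : aug_obj R i.+1 -> aug_obj R i :=
  match i with 0%N => @pr_aug _ _ _ R | j.+1 => @pr_diff _ _ _ R j end.

Arguments aug_obj : simpl never.
Arguments aug_diff : simpl never.

Lemma aug_diff_hom R i : bim_hom (@aug_diff R i).
Proof. by case: i => [|i] /=; [apply: pr_aug_hom | apply: pr_diff_hom]. Qed.

Lemma aug_diff_surj R (m : aug_obj R 0) : exists x, aug_diff x = m.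
Proof. exact: pr_aug_surj. Qed.

Lemma aug_exact R i (x : aug_obj R i.+1) :
  aug_diff x = 0 <-> exists y : aug_obj R i.+2, aug_diff y = x.
Proof. by case: i x => [|i] x /=; [apply: pr_exact0 | apply: pr_exactS]. Qed.

Lemma aug_diffK R i (x : aug_obj R i.+2) : aug_diff (aug_diff x) = 0.
Proof. by apply/aug_exact; exists x. Qed.

Lemma aug_proj R i : projective (aug_obj R i.+1).
Proof. exact: pr_projective. Qed.

(** The recursion carries, with the lift f_i, the fact that f_i maps boundaries
    to boundaries: this is what makes the next lift possible. *)
Lemma chain_map_exists R S : exists f : forall i, aug_obj R i -> aug_obj S i,
  [/\ forall i, bim_hom (f i), forall m, f 0%N m = m &
      forall i x, f i (aug_diff x) = aug_diff (f i.+1 x)].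
Proof.
pose ok i (f : aug_obj R i -> aug_obj S i) := bim_hom f /\
  forall x : aug_obj R i.+1, exists y : aug_obj S i.+1, aug_diff y = f (aug_diff x).
have step i (f : {f | @ok i f}) : {g : aug_obj R i.+1 -> aug_obj S i.+1 |
    ok _ g /\ forall x, sval f (aug_diff x) = aug_diff (g x)}.
  case: f => f /= [hf ex]; apply: cid.
  have [|||g hg gK] := @projective_lift _ _ _ (@aug_diff S i)
    (fun x => f (aug_diff x)) (@aug_proj R i).
  - exact: aug_diff_hom.
  - exact: (bim_hom_comp hf (aug_diff_hom R i)).
  - exact: ex.
  exists g; split=> //; split=> // x; apply/aug_exact.
  by rewrite gK aug_diffK (bim_hom0 hf).
have ok0 : @ok 0%N (fun m => m).
  by split=> [|x]; [apply: bim_hom_id | apply: aug_diff_surj].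
pose fix F i : {f | @ok i f} := match i with
  | 0%N => exist _ _ ok0
  | j.+1 => exist _ (sval (step j (F j))) (proj1 (svalP (step j (F j)))) end.
exists (fun i => sval (F i)); split=> [i|m|i x] //=.
  by case: (svalP (F i)).
by case: (svalP (step i (F i))).
Qed.

(** A chain map which is 0 on M is lifted through the differential one degree
    further each time, the obstruction f - s d being a cycle by induction. *)
Lemma null_homotopic R S (f : forall i, aug_obj R i -> aug_obj S i) :
    (forall i, bim_hom (f i)) -> (forall m, f 0%N m = 0) ->
    (forall i x, f i (aug_diff x) = aug_diff (f i.+1 x)) ->
  exists s : forall i, aug_obj R i -> aug_obj S i.+1,
    [/\ forall i, bim_hom (s i), forall m, s 0%N m = 0 &
        forall i x, f i.+1 x = aug_diff (s i.+1 x) + s i (aug_diff x)].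
Proof.
move=> hf f0 fd.
pose ok i (s : aug_obj R i -> aug_obj S i.+1) := bim_hom s /\
  forall x : aug_obj R i.+1, f i (aug_diff x) = aug_diff (s (aug_diff x)).
have step i (s : {s | @ok i s}) : {t : aug_obj R i.+1 -> aug_obj S i.+2 |
    ok _ t /\ forall x, f i.+1 x = aug_diff (t x) + sval s (aug_diff x)}.
  case: s => s /= [hs sd]; apply: cid.
  have hsd := bim_hom_comp hs (aug_diff_hom R i).
  have [|||t ht tK] := @projective_lift _ _ _ (@aug_diff S i.+1)
    (fun x => f i.+1 x - s (aug_diff x)) (@aug_proj R i).
  - exact: aug_diff_hom.
  - exact: bim_hom_sub.
  - move=> x; apply/aug_exact.
    by rewrite (bim_homB (aug_diff_hom S i)) -fd sd subrr.
  exists t; split=> [|x]; last by rewrite tK subrK.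
  by split=> // x; rewrite tK aug_diffK (bim_hom0 hs) subr0.
have ok0 : @ok 0%N (fun _ => 0).
  split=> [|x]; first exact: bim_hom_zero.
  by rewrite (bim_hom0 (aug_diff_hom S 0)); apply: f0.
pose fix s i : {s | @ok i s} := match i with
  | 0%N => exist _ _ ok0
  | j.+1 => exist _ (sval (step j (s j))) (proj1 (svalP (step j (s j)))) end.
exists (fun i => sval (s i)); split=> [i||i x] //=; first by case: (svalP (s i)).
by case: (svalP (step i (s i))).
Qed.

Section Transfer.
Variables (N : bimodule L) (P R : proj_resolution M).

Lemma cocycle_lin S i c (f g : pr_obj S i -> N) :
  ext_cocycle f -> ext_cocycle g -> ext_cocycle (c *: f + g).
Proof.
move=> [hf fd] [hg gd]; split; first exact: bim_hom_linD.
by move=> x; rewrite !fctE fd gd scaler0 addr0.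
Qed.

Lemma coboundary0 S i : ext_coboundary (0 : pr_obj S i -> N).
Proof. by case: i => [|i] //=; exists (fun _ => 0) => //; apply: bim_hom_zero. Qed.

Lemma coboundary_lin S i c (f g : pr_obj S i -> N) :
  ext_coboundary f -> ext_coboundary g -> ext_coboundary (c *: f + g).
Proof.
case: i f g => [|i] f g /=.
  by move=> f0 g0 x; rewrite !fctE f0 g0 scaler0 addr0.
move=> [f' hf' fE] [g' hg' gE].
exists (fun x => c *: f' x + g' x); first exact: bim_hom_linD.
by move=> x; rewrite !fctE fE gE.
Qed.

Lemma cocycle_sum S i d (e : 'I_d -> pr_obj S i -> N) (c : 'I_d -> k) :
  (forall j, ext_cocycle (e j)) -> ext_cocycle (\sum_j c j *: e j).
Proof.
move=> ez; apply: big_ind => [|f g zf zg|j _].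
- by split=> //; apply: bim_hom_zero.
- by rewrite -[f]scale1r; apply: cocycle_lin.
- rewrite -[_ *: _]addr0; apply: cocycle_lin => //.
  by split=> //; apply: bim_hom_zero.
Qed.

(** The composite of two chain maps over the identity of M is homotopic to the
    identity, and a cocycle composed with a homotopy is a coboundary. *)
Lemma cocycle_chain_map S T (f : forall i, aug_obj S i -> aug_obj T i)
    (g : forall i, aug_obj T i -> aug_obj S i) i (z : pr_obj S i -> N) :
    (forall i, bim_hom (f i)) -> (forall m, f 0%N m = m) ->
    (forall i x, f i (aug_diff x) = aug_diff (f i.+1 x)) ->
    (forall i, bim_hom (g i)) -> (forall m, g 0%N m = m) ->
    (forall i x, g i (aug_diff x) = aug_diff (g i.+1 x)) ->
  ext_cocycle z -> ext_coboundary (fun x => z (g i.+1 (f i.+1 x)) - z x).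
Proof.
move=> hf f0 fd hg g0 gd [hz zd].
have [|||s [hs s0 sE]] := @null_homotopic S S (fun i x => g i (f i x) - x).
- by move=> j; apply: bim_hom_sub (bim_hom_id _); apply: bim_hom_comp.
- by move=> m; rewrite f0 g0 subrr.
- by move=> j x; rewrite fd gd (bim_homB (aug_diff_hom S j)).
have zE x : z (g i.+1 (f i.+1 x)) - z x = z (s i (aug_diff x)).
  by rewrite -(bim_homB hz) sE (bim_homD hz) [z (@aug_diff S i.+1 _)]zd add0r.
case: i z hz zd zE => [|i] z hz zd zE /=.
  by move=> x; rewrite zE s0 (bim_hom0 hz).
exists (fun x => z (s i.+1 x)); first exact: (bim_hom_comp hz (hs i.+1)).
exact: zE.
Qed.

Lemma subquot_dim_transfer i d :
  subquot_dim (@ext_cocycle _ _ _ N P i) (@ext_coboundary _ _ _ N P i) d ->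
  subquot_dim (@ext_cocycle _ _ _ N R i) (@ext_coboundary _ _ _ N R i) d.
Proof.
move=> [e [ez eg ei]].
have [f [hf f0 fd]] := chain_map_exists P R.
have [g [hg g0 gd]] := chain_map_exists R P.
have comp_cocycle S T (h : forall i, aug_obj S i -> aug_obj T i)
    (z : pr_obj T i -> N) : (forall i, bim_hom (h i)) ->
    (forall i x, h i (aug_diff x) = aug_diff (h i.+1 x)) ->
    ext_cocycle z -> ext_cocycle (fun x : pr_obj S i => z (h i.+1 x)).
  move=> hh hd [hz zd]; split; first exact: bim_hom_comp hz (hh i.+1).
  by move=> x; rewrite [h _ _](hd i.+1); apply: zd.
have comp_coboundary S T (h : forall i, aug_obj S i -> aug_obj T i)
    (z : pr_obj T i -> N) : (forall i, bim_hom (h i)) ->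
    (forall i x, h i (aug_diff x) = aug_diff (h i.+1 x)) ->
    ext_coboundary z -> ext_coboundary (fun x : pr_obj S i => z (h i.+1 x)).
  move=> hh hd; case: (i) z => [|j] z /=; first by move=> z0 x.
  move=> [w hw zw]; exists (fun x => w (h j.+1 x)); first exact: (bim_hom_comp hw (hh j.+1)).
  by move=> x; rewrite zw; congr w; apply: esym; apply: (hd j.+1).
exists (fun j x => e j (g i.+1 x)); split.
- by move=> j; apply: (comp_cocycle _ _ g _ hg gd).
- move=> z zz; have [c zc] := eg _ (comp_cocycle _ _ f z hf fd zz).
  exists c; have := comp_coboundary _ _ g _ hg gd zc.
  have := cocycle_chain_map hg g0 gd hf f0 fd zz.
  move=> /(coboundary_lin (-1)) H /H; congr ext_coboundary.
  apply: funext => x; rewrite !fctE scaleN1r opprB !fct_sumE addrA subrK.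
  by congr (_ - _); apply: eq_bigr => j _.
- move=> c c0; apply: ei; have := comp_coboundary _ _ f _ hf fd c0.
  have := cocycle_chain_map hf f0 fd hg g0 gd (cocycle_sum c ez).
  move=> /(coboundary_lin (-1)) H /H; congr ext_coboundary.
  apply: funext => x; rewrite !fctE scaleN1r opprB !fct_sumE -addrA.
  rewrite (_ : - _ + _ = 0) ?addr0 // addrC; apply/eqP; rewrite subr_eq0.
  by apply/eqP; apply: eq_bigr => j _.
Qed.

End Transfer.

(** Precomposition with chain maps between two resolutions gives mutually inverse
    maps on cohomology. *)
Lemma ext_dimP (N : bimodule L) (P : proj_resolution M) i d :
  subquot_dim (@ext_cocycle _ _ _ N P i) (@ext_coboundary _ _ _ N P i) d ->
  ext_dim M N i d.
Proof. by move=> dimP; split=> // R; apply: subquot_dim_transfer dimP. Qed.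

End Comparison.

(** * Words in x and y acting on a space of dimension 6 *)

Section FreeEval.
Variables (k : fieldType) (B : algType k) (u v : B).

Definition letter_val (b : bool) : B := if b then v else u.
Definition word_val (w : {fmonom bool}) : B := \prod_(b <- w) letter_val b.

Fact word_val_mmorphism : mmorphism word_val.
Proof.
split=> [w w'|]; rewrite /word_val; first by rewrite fmM big_cat.
by rewrite fm1 big_nil.
Qed.
HB.instance Definition _ := isMultiplicative.Build {fmonom bool} B word_val
  word_val_mmorphism.

Definition free_eval (f : free_xy k) : B := mmap (in_alg B) word_val f.

Lemma free_evalD : {morph free_eval : f g / f + g}.
Proof. exact: (raddfD (mmap (in_alg B) word_val)). Qed.

Lemma free_eval0 : free_eval 0 = 0.
Proof. exact: (raddf0 (mmap (in_alg B) word_val)). Qed.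

Lemma free_evalZ c : {morph free_eval : f / c *: f}.
Proof.
by move=> f; rewrite sa_scaleE /free_eval mmapZ mulr_algl.
Qed.

Lemma free_evalM : {morph free_eval : f g / f * g}.
Proof.
move=> f g; rewrite sa_mulE.
have [|+ _] := @commr_mmap_is_multiplicative {fmonom bool} k B (in_alg B) word_val.
  by move=> h m m'; rewrite /GRing.comm mulr_algl mulr_algr.
exact.
Qed.

Lemma free_eval1 : free_eval 1 = 1.
Proof. exact: (@mmap1 {fmonom bool} k B (in_alg B) word_val). Qed.

Lemma free_evalU b : free_eval << fmu b >> = letter_val b.
Proof.
by rewrite /free_eval mmapU [LHS]mulr_algl scale1r /word_val fmU big_seq1.
Qed.

End FreeEval.

(** The matrices below give the action of x and y on the left module
    A / A (x - 1), cut off above degree 2 in y, in the basis formed by the classes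
    of 1, y, xy, y^2, yxy, xyxy. Column j lists the coordinates of the image of
    the j-th basis vector. *)
Section WordModule.
Variables (k : fieldType) (alpha beta : k).

Definition down_cols : seq (seq k) :=
  [:: [:: 1]; [:: 0; 0; 1]; [:: 0; beta; alpha]; [:: 0; 0; 0; beta; alpha];
      [:: 0; 0; 0; 0; 0; 1];
      [:: 0; 0; 0; 2 * alpha * beta ^+ 2; 2 * alpha ^+ 2 * beta + beta ^+ 2;
          alpha ^+ 2]].
Definition up_cols : seq (seq k) :=
  [:: [:: 0; 1]; [:: 0; 0; 0; 1]; [:: 0; 0; 0; 0; 1]].

Definition mx_of_cols (s : seq (seq k)) : 'M[k]_6 :=
  \matrix_(i, j) (nth [::] s j)`_i.
Definition down_mx := mx_of_cols down_cols.
Definition up_mx := mx_of_cols up_cols.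

Local Notation e i := (delta_mx (inord i) 0 : 'cV[k]_6).

Lemma mx_of_cols_delta s j : (j < 6)%N ->
  mx_of_cols s *m e j = \sum_(i < 6) (nth [::] s j)`_i *: e i.
Proof.
move=> lt_j; rewrite -colE; apply/colP => i; rewrite !mxE summxE inordK //.
rewrite (bigD1 i) //= big1 => [|i' ne]; rewrite !mxE inord_val ?eqxx ?mulr1 ?addr0 //.
by rewrite eq_sym (negPf ne) mulr0.
Qed.

Lemma mx6_eq (A B : 'M[k]_6) : (forall j, (j < 6)%N -> A *m e j = B *m e j) -> A = B.
Proof.
move=> AB; apply/matrixP => i j; have := AB j (ltn_ord j).
by rewrite inord_val -!colE => /colP/(_ i); rewrite !mxE.
Qed.

Ltac act_tac := rewrite mx_of_cols_delta // !big_ord_recl big_ord0 /=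
  /bump /= ?(scale0r, scale1r, add0r, addr0) //.

Lemma down0 : down_mx *m e 0 = e 0. Proof. by act_tac. Qed.
Lemma down1 : down_mx *m e 1 = e 2. Proof. by act_tac. Qed.
Lemma down2 : down_mx *m e 2 = beta *: e 1 + alpha *: e 2. Proof. by act_tac. Qed.
Lemma down3 : down_mx *m e 3 = beta *: e 3 + alpha *: e 4. Proof. by act_tac. Qed.
Lemma down4 : down_mx *m e 4 = e 5. Proof. by act_tac. Qed.
Lemma down5 : down_mx *m e 5 = (2 * alpha * beta ^+ 2) *: e 3 +
  ((2 * alpha ^+ 2 * beta + beta ^+ 2) *: e 4 + alpha ^+ 2 *: e 5).
Proof. by act_tac. Qed.
Lemma up0 : up_mx *m e 0 = e 1. Proof. by act_tac. Qed.
Lemma up1 : up_mx *m e 1 = e 3. Proof. by act_tac. Qed.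
Lemma up2 : up_mx *m e 2 = e 4. Proof. by act_tac. Qed.
Lemma up3 : up_mx *m e 3 = 0. Proof. by act_tac. Qed.
Lemma up4 : up_mx *m e 4 = 0. Proof. by act_tac. Qed.
Lemma up5 : up_mx *m e 5 = 0. Proof. by act_tac. Qed.
Definition actE := (down0, down1, down2, down3, down4, down5,
  up0, up1, up2, up3, up4, up5).

Lemma mx_rel1 : down_mx ^+ 2 * up_mx =
  beta *: (up_mx * down_mx ^+ 2) + alpha *: (down_mx * up_mx * down_mx).
Proof.
apply: mx6_eq => -[|[|[|[|[|[|//]]]]]] _; rewrite !expr2 -!mulmxE mulmxDl -!scalemxAl -!mulmxA;
 do ![rewrite actE | rewrite mulmxDr | rewrite -scalemxAr | rewrite mulmx0];
 apply/colP => i; rewrite !mxE; ring.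
Qed.

Lemma mx_rel2 : down_mx * up_mx ^+ 2 =
  beta *: (up_mx ^+ 2 * down_mx) + alpha *: (up_mx * down_mx * up_mx).
Proof.
apply: mx6_eq => -[|[|[|[|[|[|//]]]]]] _; rewrite !expr2 -!mulmxE mulmxDl -!scalemxAl -!mulmxA;
 do ![rewrite actE | rewrite mulmxDr | rewrite -scalemxAr | rewrite mulmx0];
 apply/colP => i; rewrite !mxE; ring.
Qed.

End WordModule.

(** * A basis of the down-up algebra in low degrees *)

(** The five heads 1, y, xy, y^2, yxy and their degrees: a normal word is a head
    followed by a power of x. *)
Definition head_deg (n kap : nat) : nat :=
  nth 0%N [:: 0; n; n.+1; 2 * n; (2 * n).+1]%N kap.

Definition head_word (B : pzRingType) (x y : B) (kap : nat) : B :=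
  nth 0 [:: 1; y; x * y; y * y; y * x * y] kap.

Section DownUpBasis.
Local Open Scope quotient_scope.
Variables (n : nat) (k : fieldType) (alpha beta : k).
Local Notation A := (down_up alpha beta).
Local Notation x := (\pi_A (free_x k) : A).
Local Notation y := (\pi_A (free_y k) : A).
Local Notation W := (head_word x y).

Lemma du_pi_eq0 f : gen_ideal (du_rel alpha beta) f -> \pi_A f = 0 :> A.
Proof. by move=> If; rewrite -quot_pi0; apply/quot_piP; rewrite subr0. Qed.

Lemma du_piB f g : \pi_A (f - g) = \pi_A f - \pi_A g :> A.
Proof. by rewrite quot_piD -scaleN1r quot_piZ scaleN1r. Qed.

Lemma du_xxy : x ^+ 2 * y = beta *: (y * x ^+ 2) + alpha *: (x * y * x).
Proof.
have /du_pi_eq0 := gen_idealR (du_rel1 alpha beta).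
rewrite !du_piB !quot_piZ !expr2 !quot_piM => /eqP.
by rewrite subr_eq0 subr_eq addrC => /eqP.
Qed.

Lemma du_xyy : x * y ^+ 2 = beta *: (y ^+ 2 * x) + alpha *: (y * x * y).
Proof.
have /du_pi_eq0 := gen_idealR (du_rel2 alpha beta).
rewrite !du_piB !quot_piZ !expr2 !quot_piM => /eqP.
by rewrite subr_eq0 subr_eq addrC => /eqP.
Qed.

(** The representative is irrelevant because the matrices satisfy the relations. *)
Definition du_rep (a : A) : 'M[k]_6 :=
  free_eval (down_mx alpha beta) (up_mx k) (repr a).

Lemma du_rep_pi f : du_rep (\pi_A f) = free_eval (down_mx alpha beta) (up_mx k) f.
Proof.
set ev := free_eval _ _.
have evD : {morph ev : g h / g + h} by apply: free_evalD.
have evM : {morph ev : g h / g * h} by apply: free_evalM.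
have evZ c : {morph ev : g / c *: g} by apply: free_evalZ.
have evx : ev (free_x k) = down_mx alpha beta by apply: free_evalU.
have evy : ev (free_y k) = up_mx k by apply: free_evalU.
have ev0 g : gen_ideal (du_rel alpha beta) g -> ev g = 0.
  elim=> [h []||h h' _ h0 _ h'0|h h' _ h'0|h h' _ h0].
  - rewrite -!scaleNr !(evD, evZ, expr2, evM) evx evy -!expr2 mx_rel1 !scaleNr.
    by rewrite addrAC addrK subrr.
  - rewrite -!scaleNr !(evD, evZ, expr2, evM) evx evy -!expr2 mx_rel2 !scaleNr.
    by rewrite addrAC addrK subrr.
  - exact: free_eval0.
  - by rewrite evD h0 h'0 addr0.
  - by rewrite evM h'0 mulr0.
  - by rewrite evM h0 mul0r.
rewrite /du_rep -/ev; have /quot_piP/ev0 := reprK (\pi_A f : A).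
rewrite -scaleN1r evD evZ scaleN1r => /(_ (@du_proper k alpha beta)) /eqP.
by rewrite subr_eq0 => /eqP.
Qed.

Lemma du_repD : {morph du_rep : a b / a + b}.
Proof.
move=> a b; rewrite -[a]reprK -[b]reprK -quot_piD !du_rep_pi.
exact: free_evalD.
Qed.

Lemma du_repZ c : {morph du_rep : a / c *: a}.
Proof.
move=> a; rewrite -[a]reprK -quot_piZ !du_rep_pi.
exact: free_evalZ.
Qed.

Lemma du_repM : {morph du_rep : a b / a * b}.
Proof.
move=> a b; rewrite -[a]reprK -[b]reprK -quot_piM !du_rep_pi.
exact: free_evalM.
Qed.

Lemma du_rep1 : du_rep 1 = 1.
Proof. by rewrite -quot_pi1 du_rep_pi free_eval1. Qed.

Lemma du_repx : du_rep x = down_mx alpha beta.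
Proof. by rewrite du_rep_pi free_evalU. Qed.

Lemma du_repy : du_rep y = up_mx k.
Proof. by rewrite du_rep_pi free_evalU. Qed.

(** Applied to the class of 1, on which every power of x acts trivially, a word
    W x^c gives the basis vector of its head W. *)
Definition du_coord (kap : 'I_5) (a : A) : k := du_rep a (inord kap) 0.

Lemma du_coordD kap : {morph du_coord kap : a b / a + b}.
Proof. by move=> a b; rewrite /du_coord du_repD mxE. Qed.

Lemma du_coordZ kap c : {morph du_coord kap : a / c *: a >-> c * a}.
Proof. by move=> a; rewrite /du_coord du_repZ mxE. Qed.

Lemma du_coord0 kap : du_coord kap 0 = 0.
Proof. by rewrite -(scale0r 0) du_coordZ mul0r. Qed.

Lemma du_coord_sum kap I (r : seq I) (p : pred I) (F : I -> A) :
  du_coord kap (\sum_(i <- r | p i) F i) = \sum_(i <- r | p i) du_coord kap (F i).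
Proof. exact: (big_morph _ (du_coordD kap) (du_coord0 kap)). Qed.

Lemma du_coord_word kap kap' c :
  (kap' < 5)%N -> du_coord kap (W kap' * x ^+ c) = (kap == kap' :> nat)%:R.
Proof.
move=> lt_kap'; rewrite /du_coord du_repM.
have rxE : du_rep (x ^+ c) *m delta_mx 0 0 = delta_mx (inord 0) 0 :> 'cV_6.
  elim: c => [|c IH]; first by rewrite du_rep1 mul1mx; congr delta_mx; apply: val_inj; rewrite /= inordK.
  by rewrite exprS du_repM -mulmxE -mulmxA IH du_repx down0.
have -> : (du_rep (W kap') * du_rep (x ^+ c)) (inord kap) 0 =
    (du_rep (W kap') *m delta_mx (inord 0) 0 : 'cV_6) (inord kap) 0.
  by rewrite -rxE mulmxA mulmxE -colE !mxE.
have -> : du_rep (W kap') *m delta_mx (inord 0) 0 = delta_mx (inord kap') 0 :> 'cV_6.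
  case: kap' lt_kap' => [|[|[|[|[|//]]]]] _; rewrite /head_word /=.
  - by rewrite du_rep1 mul1mx.
  - by rewrite du_repy up0.
  - by rewrite du_repM du_repx du_repy -mulmxE -mulmxA up0 down1.
  - by rewrite du_repM du_repy -mulmxE -mulmxA up0 up1.
  - by rewrite !du_repM du_repx du_repy -!mulmxE -!mulmxA up0 down1 up2.
rewrite !mxE andbT -val_eqE /= !inordK //; exact: leq_trans _ (leqnSn 5).
Qed.

(** In a fixed degree the head determines the power of x. *)
Definition du_span (d : nat) (a : A) := exists v : 'I_5 -> k,
  a = \sum_(kap < 5 | (head_deg n kap <= d)%N) v kap *: (W kap * x ^+ (d - head_deg n kap)).

Lemma du_span_lin d c a b : du_span d a -> du_span d b -> du_span d (c *: a + b).
Proof.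
move=> [u ->] [v ->]; exists (fun kap => c * u kap + v kap).
rewrite scaler_sumr -big_split /=; apply: eq_bigr => kap _.
by rewrite scalerDl scalerA.
Qed.

Lemma du_span0 d : du_span d 0.
Proof. by exists (fun=> 0); rewrite big1 // => kap _; rewrite scale0r. Qed.

Lemma du_span_word d kap c : (kap < 5)%N -> (head_deg n kap + c = d)%N ->
  du_span d (W kap * x ^+ c).
Proof.
move=> lt_kap <-; exists (fun i => (i == kap :> nat)%:R).
rewrite (bigD1 (Ordinal lt_kap)) ?leq_addr //= eqxx scale1r addKn.
rewrite big1 ?addr0 // => i /andP[_ ne].
by rewrite -val_eqE /= in ne; rewrite (negPf ne) scale0r.
Qed.

Lemma du_span_lmul d e (z a : A) :
    (forall kap c, (kap < 5)%N -> (head_deg n kap + c = d)%N ->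
      du_span e (z * (W kap * x ^+ c))) ->
  du_span d a -> du_span e (z * a).
Proof.
move=> zW [v ->]; rewrite mulr_sumr; apply: big_ind => [|b c sb sc|kap le_d].
- exact: du_span0.
- by rewrite -[b]scale1r; apply: du_span_lin.
- rewrite -scalerAr -[_ *: _]addr0; apply: du_span_lin (du_span0 _).
  by apply: zW => //; rewrite subnKC.
Qed.

(** The relations rewrite x (x y) and x (y^2) as combinations of heads. The bound
    on d excludes x (y x y), whose normal form needs the further head (xy)^2. *)
Lemma du_span_x d a : (d <= 2 * n)%N -> du_span d a -> du_span d.+1 (x * a).
Proof.
move=> le_d; apply: du_span_lmul => -[|[|[|[|[|//]]]]] c _ ec;
  rewrite /head_deg /= in ec; rewrite /head_word /= ?mul1r.
- by rewrite -exprS -[_ ^+ _]mul1r; apply: (@du_span_word _ 0); rewrite // -ec.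
- by rewrite mulrA; apply: (@du_span_word _ 2); rewrite // -ec.
- rewrite !mulrA -expr2 du_xxy mulrDl -!scalerAl; apply: du_span_lin.
    by rewrite -!mulrA -!exprS; apply: (@du_span_word _ 1); rewrite /head_deg /=; lia.
  rewrite -[_ *: _]addr0; apply: du_span_lin (du_span0 _).
  by rewrite -[x * y * x]mulrA -!mulrA -exprS mulrA; apply: (@du_span_word _ 2); rewrite /head_deg /=; lia.
- rewrite !mulrA -[x * y * y]mulrA -expr2 du_xyy mulrDl -!scalerAl; apply: du_span_lin.
    by rewrite expr2 -!mulrA -exprS mulrA; apply: (@du_span_word _ 3); rewrite /head_deg /=; lia.
  rewrite -[_ *: _]addr0; apply: du_span_lin (du_span0 _).
  have -> : c = 0%N by lia.
  by apply: (@du_span_word _ 4); rewrite /head_deg /=; lia.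
- by exfalso; lia.
Qed.

Lemma du_span_y d a : (2 <= n)%N -> (d <= n.+1)%N -> du_span d a -> du_span (n + d) (y * a).
Proof.
move=> n2 le_d; apply: du_span_lmul => -[|[|[|[|[|//]]]]] c _ ec; rewrite /head_deg /= in ec;
  rewrite /head_word /= ?mul1r ?mulrA.
- by apply: (@du_span_word _ 1); rewrite /head_deg /=; lia.
- by apply: (@du_span_word _ 3); rewrite /head_deg /=; lia.
- by apply: (@du_span_word _ 4); rewrite /head_deg /=; lia.
- by exfalso; lia.
- by exfalso; lia.
Qed.

Lemma du_comp_span d a : (2 <= n)%N -> (d <= (2 * n).+1)%N -> du_comp n d a -> du_span d a.
Proof.
move=> n2 le_d [f hf ->].
have word_span (w : seq bool) : (word_deg n (FMonom w) <= (2 * n).+1)%N ->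
    du_span (word_deg n (FMonom w)) (\pi_A (<< FMonom w >> : free_xy k)).
  elim: w => [|b w IH].
    move=> _; have -> : << FMonom [::] >> = 1 :> free_xy k by rewrite -fmoneE.
    rewrite quot_pi1 /word_deg big_nil -[1]mulr1.
    by apply: (@du_span_word 0 0 0).
  have -> : << FMonom (b :: w) >> =
      (<< fmu b >> : free_xy k) * (<< FMonom w >> : free_xy k).
    rewrite sa_mulE [RHS]fgmulUU mulr1; congr << _ >>.
    by apply/eqP; rewrite fmP fmM fmU.
  have -> : word_deg n (FMonom (b :: w)) = ((if b then n else 1) + word_deg n (FMonom w))%N.
    by rewrite /word_deg big_cons.
  rewrite quot_piM; case: b => le_w.
    by apply: du_span_y => //; [lia | apply: IH; lia].
  by apply: du_span_x; [lia | apply: IH; lia].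
have fE : f = \sum_(w <- msupp f) f@_w *: (<< w >> : free_xy k).
  rewrite [LHS]monalgE; apply: eq_bigr => w _.
  apply/malgP => v; rewrite sa_scaleE mcoeffZ !mcoeffU.
  by rewrite mulrnAr mulr1.
have -> : \pi_A f = \sum_(w <- msupp f) f@_w *: \pi_A (<< w >> : free_xy k).
  rewrite {1}fE (big_morph _ (@quot_piD _ _ _ (@du_proper k alpha beta)) (@quot_pi0 _ _ _ _)).
  by apply: eq_bigr => w _; rewrite quot_piZ.
rewrite big_seq; apply: big_ind => [|b c sb sc|w fw]; first exact: du_span0.
  by rewrite -[b]scale1r; apply: du_span_lin.
have dw : word_deg n w = d by apply: hf; rewrite mcoeff_neq0.
rewrite -[_ *: _]addr0 -dw; apply: du_span_lin (du_span0 _).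
by have := word_span w; rewrite fmK dw; apply.
Qed.

(** Independence of the heads identifies the coefficients of an expansion with
    the coordinates read on the representation. *)
Lemma du_comp_coord d a : (2 <= n)%N -> (d <= (2 * n).+1)%N -> du_comp n d a ->
  a = \sum_(kap < 5 | (head_deg n kap <= d)%N)
        du_coord kap a *: (W kap * x ^+ (d - head_deg n kap)).
Proof.
move=> n2 le_d /(du_comp_span n2 le_d) [v av].
rewrite [LHS]av; apply: eq_bigr => kap le_kap; congr (_ *: _).
rewrite [in RHS]av du_coord_sum (bigD1 kap) //= du_coordZ du_coord_word // eqxx mulr1.
rewrite big1 ?addr0 // => i /andP[_ ne].
by rewrite du_coordZ du_coord_word // val_eqE eq_sym (negPf ne) mulr0.
Qed.

End DownUpBasis.

(** * Algebras with a basis of down-up words *)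

(** The triple (W, c, i) stands for the path W X^c E_i: a head, a power of x and
    a source vertex. *)
Definition bidx (n : nat) : finType :=
  ('I_5 * 'I_(beil_size n) * 'I_(beil_size n))%type.
Definition tgt n (v : bidx n) : nat := (v.2 + (v.1.2 + head_deg n v.1.1))%N.
Definition basis_elt (n : nat) (L : pzRingType) (E : nat -> L) (X Y : L)
  (v : bidx n) : L := head_word X Y v.1.1 * X ^+ v.1.2 * E v.2.

(** What the computation of cohomology uses of the Beilinson algebra. Vertices are
    indexed by all natural numbers, those out of range being 0, so that degrees
    can be added without bounds. For the same reason all triples index the basis:
    the paths leaving the range are 0, and frcoef_out makes the coordinates
    unique in spite of them. *)
Record frame (k : fieldType) (n : nat) (alpha beta : k) (L : algType k) := Frame {
  frE : nat -> L;
  frX : L;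
  frY : L;
  frcoef : bidx n -> L -> k;
  frE_mul : forall i j, frE i * frE j = if i == j then frE i else 0;
  frE_out : forall i, (beil_size n <= i)%N -> frE i = 0;
  frE_sum : \sum_(i < beil_size n) frE i = 1;
  frXE : forall i, frX * frE i = frE i.+1 * frX;
  frYE : forall i, frY * frE i = frE (i + n)%N * frY;
  frxxy : frX ^+ 2 * frY = beta *: (frY * frX ^+ 2) + alpha *: (frX * frY * frX);
  frxyy : frX * frY ^+ 2 = beta *: (frY ^+ 2 * frX) + alpha *: (frY * frX * frY);
  frcoef_lin : forall v c a b, frcoef v (c *: a + b) = c * frcoef v a + frcoef v b;
  frexpand : forall a, a = \sum_v frcoef v a *: basis_elt frE frX frY v;
  frcoef_basis : forall v w, (tgt w < beil_size n)%N ->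
    frcoef v (basis_elt frE frX frY w) = (v == w)%:R;
  frcoef_out : forall v a, (beil_size n <= tgt v)%N -> frcoef v a = 0
}.

(** * The Beilinson algebra *)

Section NablaFrame.
Local Open Scope quotient_scope.
Variables (n : nat) (k : fieldType) (alpha beta : k).
Local Notation A := (down_up alpha beta).
Local Notation L := (nabla n alpha beta).
Local Notation l := (beil_size n).
Local Notation x := (\pi_A (free_x k) : A).
Local Notation y := (\pi_A (free_y k) : A).
Local Notation W := (head_word x y).

Lemma nablaM (a b : L) i j : (a * b) (i, j) = \sum_(m < l) a (m, j) * b (i, m).
Proof. exact: nabla_mulE. Qed.

Lemma nabla1 i j : (1 : L) (i, j) = (i == j)%:R.
Proof. exact: nabla_oneE. Qed.

(** The elements constant along a diagonal multiply as in A, so that identities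
    between homogeneous elements of A pass to L. *)
Definition on_diag d (a : A) (m : L) :=
  forall i j : 'I_l, m (i, j) = if (j == i + d :> nat)%N then a else 0.

Fact on_diag_sub d (a : A) : du_comp n d a ->
  [ffun p : 'I_l * 'I_l => if (p.2 == p.1 + d :> nat)%N then a else 0]
    \in beil_pred (n := n) (alpha := alpha) (beta := beta).
Proof.
move=> da; apply/asboolP => i j; rewrite ffunE /=.
case: ifP => [le_ij|nle_ij].
  by case: eqP => [->|_]; [rewrite addKn | apply: du_comp0].
by case: eqP nle_ij => // ->; rewrite leq_addr.
Qed.

Definition diag_elt d (a : A) (da : du_comp n d a) : L := Nabla (on_diag_sub da).

Lemma diag_eltP d a (da : du_comp n d a) : on_diag d a (diag_elt da).
Proof. by move=> i j; rewrite /= ffunE. Qed.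

Lemma on_diag_inj d a m m' : on_diag d a m -> on_diag d a m' -> m = m'.
Proof. by move=> ma m'a; apply: nablaP => i j; rewrite ma m'a. Qed.

Lemma on_diagM d e a b m m' :
  on_diag d a m -> on_diag e b m' -> on_diag (d + e) (a * b) (m * m').
Proof.
move=> ma mb i j; rewrite nablaM; case: eqP => [ej|nej].
  have lt_p : (i + e < l)%N by rewrite (leq_ltn_trans _ (ltn_ord j)) // ej; lia.
  rewrite (bigD1 (Ordinal lt_p)) //= big1 ?addr0.
    by rewrite ma mb /= eqxx ej addnA addnAC eqxx.
  move=> p; rewrite -val_eqE /= => /negPf np; rewrite mb np mulr0 //.
rewrite big1 // => p _; rewrite ma mb; case: eqP => [ep|_]; last by rewrite mul0r.
by case: eqP => [ep'|_]; [case: nej; lia | rewrite mulr0].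
Qed.

Lemma on_diag1 : on_diag 0 1 1.
Proof. by move=> i j; rewrite nabla1 addn0 -val_eqE eq_sym /=; case: (_ == _). Qed.

Lemma on_diagX d a m c : on_diag d a m -> on_diag (c * d) (a ^+ c) (m ^+ c).
Proof.
move=> ma; elim: c => [|c IH]; first exact: on_diag1.
by rewrite !exprS mulSn; apply: on_diagM.
Qed.

Lemma on_diagD d a b m m' : on_diag d a m -> on_diag d b m' -> on_diag d (a + b) (m + m').
Proof. by move=> ma mb i j; rewrite nabla_addE ma mb; case: eqP; rewrite ?addr0. Qed.

Lemma on_diagZ d c a m : on_diag d a m -> on_diag d (c *: a) (c *: m).
Proof. by move=> ma i j; rewrite nabla_scaleE ma; case: eqP; rewrite ?scaler0. Qed.

Lemma du_comp_x : du_comp n 1 x.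
Proof.
exists (free_x k) => // w; rewrite mcoeffU; have [<- _|] := eqVneq (fmu false) w; last by rewrite eqxx.
by rewrite /word_deg fmU big_seq1.
Qed.
Lemma du_comp_y : du_comp n n y.
Proof.
exists (free_y k) => // w; rewrite mcoeffU; have [<- _|] := eqVneq (fmu true) w; last by rewrite eqxx.
by rewrite /word_deg fmU big_seq1.
Qed.

Definition nabla_X : L := diag_elt du_comp_x.
Definition nabla_Y : L := diag_elt du_comp_y.

Fact nabla_E_sub i : [ffun p : 'I_l * 'I_l => ((p.1 == i :> nat) && (p.2 == i :> nat))%:R : A]
    \in beil_pred (n := n) (alpha := alpha) (beta := beta).
Proof.
apply/asboolP => i' j'; rewrite ffunE /=; case: andP => [[/eqP -> /eqP ->]|_].
  by rewrite leqnn subnn; apply: du_comp1.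
by case: ifP => // _; apply: du_comp0.
Qed.
Definition nabla_E i : L := Nabla (nabla_E_sub i).

Lemma nabla_EE i i' j' : nabla_E i (i', j') = ((i' == i :> nat) && (j' == i :> nat))%:R.
Proof. by rewrite /= ffunE. Qed.

Lemma nabla_mulE_r (m : L) i (i' j' : 'I_l) :
  (m * nabla_E i) (i', j') = if i' == i :> nat then m (i', j') else 0.
Proof.
rewrite nablaM; case: eqP => [e|ne].
  rewrite (bigD1 i') //= big1 ?addr0; first by rewrite nabla_EE e eqxx mulr1.
  move=> p ne; have {}ne : (p != i :> nat) by rewrite -e.
  by rewrite nabla_EE (negPf ne) andbF mulr0.
by rewrite big1 // => p _; rewrite nabla_EE (introF eqP ne) mulr0.
Qed.

Lemma nabla_mulE_l (m : L) j (i' j' : 'I_l) :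
  (nabla_E j * m) (i', j') = if j' == j :> nat then m (i', j') else 0.
Proof.
rewrite nablaM; case: eqP => [e|ne].
  rewrite (bigD1 j') //= big1 ?addr0; first by rewrite nabla_EE e eqxx mul1r.
  move=> p ne; have {}ne : (p != j :> nat) by rewrite -e.
  by rewrite nabla_EE (negPf ne) mul0r.
by rewrite big1 // => p _; rewrite nabla_EE (introF eqP ne) andbF mul0r.
Qed.

Lemma nabla_E_mul i j : nabla_E i * nabla_E j = if i == j then nabla_E i else 0.
Proof.
apply: nablaP => i' j'; rewrite nabla_mulE_r nabla_EE.
case: (i =P j) => [<-|ne]; rewrite ?nabla_EE ?ffunE; first by case: (_ == i).
by case: eqP => // ->; rewrite eq_sym (introF eqP ne).
Qed.

Lemma nabla_E_out i : (l <= i)%N -> nabla_E i = 0.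
Proof.
move=> le_i; apply: nablaP => i' j'; rewrite nabla_EE [RHS]ffunE.
by case: eqP => // e; have := ltn_ord i'; lia.
Qed.

Lemma nabla_sumE I (r : seq I) (p : pred I) (F : I -> L) i j :
  (\sum_(t <- r | p t) F t) (i, j) = \sum_(t <- r | p t) F t (i, j).
Proof.
elim/big_rec2: _ => [|t u v _ <-]; first by rewrite ffunE.
by rewrite nabla_addE.
Qed.

Lemma nabla_E_sum : \sum_(i < l) nabla_E i = 1.
Proof.
apply: nablaP => i j; rewrite nabla_sumE nabla1 (bigD1 i) //= big1 ?addr0.
  by rewrite nabla_EE eqxx eq_sym.
by move=> p ne; rewrite nabla_EE eq_sym (negPf (ne : (p != i :> nat))).
Qed.

Lemma on_diag_E d a m i : on_diag d a m -> m * nabla_E i = nabla_E (i + d) * m.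
Proof.
move=> ma; apply: nablaP => i' j'; rewrite nabla_mulE_r nabla_mulE_l ma.
case: (i' =P i :> nat) => [->|ne]; first by case: eqP.
by do 2![case: eqP => //]; lia.
Qed.

Lemma nabla_xxy : nabla_X ^+ 2 * nabla_Y =
  beta *: (nabla_Y * nabla_X ^+ 2) + alpha *: (nabla_X * nabla_Y * nabla_X).
Proof.
have Xd := diag_eltP du_comp_x; have Yd := diag_eltP du_comp_y.
apply: (@on_diag_inj (2 * 1 + n) (x ^+ 2 * y)).
  exact: on_diagM (on_diagX 2 Xd) Yd.
rewrite du_xxy; apply: on_diagD; apply: on_diagZ.
  by rewrite addnC; apply: on_diagM Yd (on_diagX 2 Xd).
rewrite (_ : 2 * 1 + n = 1 + n + 1)%N; last by lia.
exact: on_diagM (on_diagM Xd Yd) Xd.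
Qed.

Lemma nabla_xyy : nabla_X * nabla_Y ^+ 2 =
  beta *: (nabla_Y ^+ 2 * nabla_X) + alpha *: (nabla_Y * nabla_X * nabla_Y).
Proof.
have Xd := diag_eltP du_comp_x; have Yd := diag_eltP du_comp_y.
apply: (@on_diag_inj (1 + 2 * n) (x * y ^+ 2)).
  exact: on_diagM Xd (on_diagX 2 Yd).
rewrite du_xyy; apply: on_diagD; apply: on_diagZ.
  by rewrite addnC; apply: on_diagM (on_diagX 2 Yd) Xd.
rewrite (_ : 1 + 2 * n = n + 1 + n)%N; last by lia.
exact: (on_diagM (on_diagM Yd Xd) Yd).
Qed.

Lemma on_diag_word kap : (kap < 5)%N ->
  on_diag (head_deg n kap) (W kap) (head_word nabla_X nabla_Y kap).
Proof.
have Xd := diag_eltP du_comp_x; have Yd := diag_eltP du_comp_y.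
case: kap => [|[|[|[|[|//]]]]] _; rewrite /head_word /=.
- exact: on_diag1.
- exact: Yd.
- exact: (on_diagM Xd Yd).
- by rewrite /head_deg /= mul2n -addnn; exact: (on_diagM Yd Yd).
- rewrite /head_deg /= (_ : (2 * n).+1 = n + 1 + n)%N; last by lia.
  exact: (on_diagM (on_diagM Yd Xd) Yd).
Qed.

Local Notation b := (basis_elt nabla_E nabla_X nabla_Y).

Lemma nabla_basisE (v : bidx n) i j : b v (i, j) =
  if (i == v.2) && (j == tgt v :> nat) then W v.1.1 * x ^+ v.1.2 else 0.
Proof.
rewrite /basis_elt nabla_mulE_r val_eqE; case: eqP => [->|_] //=.
have := on_diagM (on_diag_word (ltn_ord v.1.1)) (on_diagX v.1.2 (diag_eltP du_comp_x)).
by move=> ->; rewrite muln1 /tgt [(head_deg _ _ + _)%N]addnC.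
Qed.

(** Only the entry from the source to the target of the path can contain it. *)
Definition nabla_coef (v : bidx n) (a : L) : k :=
  if insub (tgt v) is Some j then du_coord v.1.1 (a (v.2, j)) else 0.

Lemma nabla_coef_lin v c (a a' : L) :
  nabla_coef v (c *: a + a') = c * nabla_coef v a + nabla_coef v a'.
Proof.
rewrite /nabla_coef; case: insubP => [j _ _|_]; last by rewrite mulr0 addr0.
by rewrite nabla_addE nabla_scaleE du_coordD du_coordZ.
Qed.

Lemma nabla_coef_out v a : (l <= tgt v)%N -> nabla_coef v a = 0.
Proof. by move=> le_t; rewrite /nabla_coef; case: insubP => // j; lia. Qed.

Lemma nabla_coef_basis v w : (tgt w < l)%N -> nabla_coef v (b w) = (v == w)%:R.
Proof.
move=> lt_w; rewrite /nabla_coef; case: insubP => [j lt_v jE|out].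
  rewrite nabla_basisE jE; case: eqP => [e2|ne2] /=; last first.
    by rewrite du_coord0; case: eqP ne2 => [->|].
  case: eqP => [et|net]; last first.
    by rewrite du_coord0; case: eqP net => [->|].
  rewrite du_coord_word //; case: (eqVneq v w) => [->|ne]; first by rewrite eqxx.
  case: eqP => // e1; case/eqP: ne.
  case: v w e1 e2 et {jE lt_v lt_w} => [[kap c] i] [[kap' c'] i'] /= e1 e2; rewrite /tgt /= e1 e2 => et.
  congr (_, _, _); apply: val_inj => //=; lia.
by case: eqP out => // ->; rewrite lt_w.
Qed.

Hypothesis n_ge2 : (2 <= n)%N.

(** The entries of an array have degree at most 2n+1, within the range in which
    the five heads span. *)
Lemma nabla_expand a : a = \sum_v nabla_coef v a *: b v.
Proof.
apply: nablaP => i j; rewrite nabla_sumE.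
under eq_bigr => v _ do rewrite nabla_scaleE nabla_basisE.
have /asboolP /(_ i j) := nabla_valP a; case: ifP => [le_ij|gt_ij] aij.
  rewrite [LHS](du_comp_coord n_ge2 _ aij); last first.
    by have := ltn_ord j; rewrite /beil_size; lia.
  rewrite (bigID (fun v : bidx n => (i == v.2) && (j == tgt v :> nat))) /=.
  rewrite [X in _ = _ + X]big1 ?addr0; last by move=> v /negPf ->; rewrite scaler0.
  have lt_c (kap : 'I_5) : (j - i - head_deg n kap < l)%N by have := ltn_ord j; lia.
  rewrite (reindex_onto (fun kap => ((kap, Ordinal (lt_c kap)), i) : bidx n) (fun v => v.1.1)) /=; last first.
    move=> [[kap c] i'] /= /andP[/eqP <-]; rewrite /tgt /= => /eqP et.
    by congr (_, _, _); apply: val_inj => /=; lia.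
  apply: eq_big => [kap|kap le_kap].
    by rewrite !eqxx andbT /tgt /=; apply/idP/eqP; lia.
  rewrite eqxx /= (_ : (nat_of_ord j == _) = true); last by apply/eqP; rewrite /tgt /=; lia.
  rewrite /nabla_coef; case: insubP => [j' _ jE|]; last by rewrite /tgt /=; have := ltn_ord j; lia.
  by rewrite (_ : j' = j) //; apply: val_inj; rewrite jE /tgt /=; lia.
rewrite aij big1 // => v _; case: eqP => [iv|_] /=; last by rewrite scaler0.
case: eqP => [jE|_]; last by rewrite scaler0.
by move: gt_ij; rewrite jE iv /tgt leq_addr.
Qed.

Definition nabla_frame : frame n alpha beta L :=
  Frame nabla_E_mul nabla_E_out nabla_E_sum
    (fun i => etrans (on_diag_E i (diag_eltP du_comp_x)) (f_equal (fun t => nabla_E t * nabla_X) (addn1 i)))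
    (fun i => on_diag_E i (diag_eltP du_comp_y))
    nabla_xxy nabla_xyy nabla_coef_lin nabla_expand nabla_coef_basis nabla_coef_out.

End NablaFrame.

(** * Graded elements and free bimodules *)

Section BimoduleTheory.
Variables (k : fieldType) (L : algType k) (M : bimodule L).
Implicit Types (m : M) (a : L).

Lemma lactDl m a b : lact (a + b) m = lact a m + lact b m.
Proof. exact: (linD (lact_linearl m)). Qed.
Lemma lactZl m c a : lact (c *: a) m = c *: lact a m.
Proof. exact: (linZ (lact_linearl m)). Qed.
Lemma lact0l m : lact 0 m = 0.
Proof. exact: (lin0 (lact_linearl m)). Qed.
Lemma lactDr m m' a : lact a (m + m') = lact a m + lact a m'.
Proof. exact: (linD (lact_linearr a)). Qed.
Lemma lact0r a : lact a (0 : M) = 0.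
Proof. exact: (lin0 (lact_linearr a)). Qed.
Lemma lactZr m c a : lact a (c *: m) = c *: lact a m.
Proof. exact: (linZ (lact_linearr a)). Qed.
Lemma lactNr m a : lact a (- m) = - lact a m.
Proof. exact: (linN (lact_linearr a)). Qed.
Lemma ractDl m m' a : ract (m + m') a = ract m a + ract m' a.
Proof. exact: (linD (ract_linearl a)). Qed.
Lemma ract0l a : ract (0 : M) a = 0.
Proof. exact: (lin0 (ract_linearl a)). Qed.
Lemma ractZl m c a : ract (c *: m) a = c *: ract m a.
Proof. exact: (linZ (ract_linearl a)). Qed.
Lemma ractNl m a : ract (- m) a = - ract m a.
Proof. exact: (linN (ract_linearl a)). Qed.
Lemma ractDr m a b : ract m (a + b) = ract m a + ract m b.
Proof. exact: (linD (ract_linearr m)). Qed.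
Lemma ractZr m c a : ract m (c *: a) = c *: ract m a.
Proof. exact: (linZ (ract_linearr m)). Qed.
Lemma ract0r m : ract m 0 = 0.
Proof. exact: (lin0 (ract_linearr m)). Qed.

Lemma lact_sumr I (r : seq I) (p : pred I) (F : I -> M) a :
  lact a (\sum_(i <- r | p i) F i) = \sum_(i <- r | p i) lact a (F i).
Proof. by apply: (big_morph (lact a)); [move=> u v; apply: lactDr | apply: lact0r]. Qed.
Lemma lact_suml I (r : seq I) (p : pred I) (F : I -> L) m :
  lact (\sum_(i <- r | p i) F i) m = \sum_(i <- r | p i) lact (F i) m.
Proof. exact: (big_morph (fun a => lact a m) (lactDl m) (lact0l m)). Qed.
Lemma ract_suml I (r : seq I) (p : pred I) (F : I -> M) a :
  ract (\sum_(i <- r | p i) F i) a = \sum_(i <- r | p i) ract (F i) a.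
Proof. exact: (big_morph (fun m => ract m a) (fun u v => ractDl u v a) (ract0l a)). Qed.
Lemma ract_sumr I (r : seq I) (p : pred I) (F : I -> L) m :
  ract m (\sum_(i <- r | p i) F i) = \sum_(i <- r | p i) ract m (F i).
Proof. by apply: (big_morph (ract m)); [move=> u v; apply: ractDr | apply: ract0r]. Qed.
End BimoduleTheory.

Lemma sum_pair (V : nmodType) (I J : finType) (F : I * J -> V) :
  \sum_p F p = \sum_i \sum_j F (i, j).
Proof. by rewrite pair_bigA; apply: eq_bigr => -[]. Qed.

Section Words.
Variables (n : nat) (B : pzRingType) (E : nat -> B) (X Y : B).
Hypothesis XE : forall i, X * E i = E i.+1 * X.
Hypothesis YE : forall i, Y * E i = E (i + n)%N * Y.

Lemma expX_E c i : X ^+ c * E i = E (i + c)%N * X ^+ c.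
Proof.
elim: c i => [|c IH] i; first by rewrite mul1r mulr1 addn0.
by rewrite exprSr -mulrA XE mulrA IH addSnnS !mulrA.
Qed.

Lemma word_E kap c i : (kap < 5)%N ->
  head_word X Y kap * X ^+ c * E i =
  E (i + (c + head_deg n kap))%N * (head_word X Y kap * X ^+ c).
Proof.
move=> lt_kap; rewrite -mulrA expX_E !mulrA addnA; congr (_ * _).
case: kap lt_kap => [|[|[|[|[|//]]]]] _; rewrite /head_word /head_deg /=.
- by rewrite mul1r mulr1 addn0.
- exact: YE.
- by rewrite -mulrA YE mulrA XE addnS mulrA.
- by rewrite -mulrA YE mulrA YE mulrA; congr (E _ * _ * _); lia.
- by rewrite -mulrA YE mulrA -[Y * X * E _]mulrA XE mulrA YE !mulrA; congr (E _ * _ * _ * _); lia.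
Qed.
End Words.

Section FrameTheory.
Variables (k : fieldType) (n : nat) (alpha beta : k) (L : algType k).
Variable fr : frame n alpha beta L.
Local Notation E := (frE fr).
Local Notation X := (frX fr).
Local Notation Y := (frY fr).
Local Notation coef := (frcoef fr).
Local Notation l := (beil_size n).
Local Notation b := (basis_elt E X Y).
Implicit Types (v w : bidx n) (a : L).

Lemma frcoefD v a a' : coef v (a + a') = coef v a + coef v a'.
Proof. by have := frcoef_lin fr v 1 a a'; rewrite scale1r mul1r. Qed.
Lemma frcoef0 v : coef v 0 = 0.
Proof. by have := frcoef_lin fr v (-1) 0 0; rewrite scaler0 addr0 mulN1r addNr. Qed.
Lemma frcoefZ v c a : coef v (c *: a) = c * coef v a.
Proof. by have := frcoef_lin fr v c a 0; rewrite frcoef0 !addr0. Qed.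
Lemma frcoef_sum v I (r : seq I) (p : pred I) (F : I -> L) :
  coef v (\sum_(i <- r | p i) F i) = \sum_(i <- r | p i) coef v (F i).
Proof. exact: (big_morph _ (frcoefD v) (frcoef0 v)). Qed.

Lemma coef_inj a a' : (forall v, coef v a = coef v a') -> a = a'.
Proof.
by move=> aa'; rewrite (frexpand fr a) (frexpand fr a'); apply: eq_bigr => v _; rewrite aa'.
Qed.

Lemma basis_tgt v : E (tgt v) * b v = b v.
Proof.
have := word_E (frXE fr) (frYE fr) v.1.2 v.2 (ltn_ord v.1.1).
by rewrite /basis_elt => ->; rewrite [LHS]mulrA frE_mul eqxx.
Qed.

Lemma basis_out v : (l <= tgt v)%N -> b v = 0.
Proof. by move=> le_t; rewrite -basis_tgt frE_out // mul0r. Qed.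

Lemma basis_El t v : E t * b v = if t == tgt v then b v else 0.
Proof. by rewrite -basis_tgt mulrA frE_mul; case: eqP => [->|_]; rewrite ?mul0r. Qed.

Lemma basis_Er i v : b v * E i = if v.2 == i :> nat then b v else 0.
Proof. by rewrite /basis_elt -mulrA frE_mul; case: eqP => _; rewrite ?mulr0. Qed.

Lemma coef_b v w : coef v (b w) = ((v == w) && (tgt w < l)%N)%:R.
Proof.
case: ltnP => [/frcoef_basis ->|/basis_out ->]; first by rewrite andbT.
by rewrite andbF frcoef0.
Qed.

Lemma coef_El v t a : coef v (E t * a) = if t == tgt v then coef v a else 0.
Proof.
rewrite {1}(frexpand fr a) mulr_sumr frcoef_sum (bigD1 v) //= big1 ?addr0.
  rewrite -scalerAr frcoefZ basis_El; case: eqP => _; last by rewrite frcoef0 mulr0.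
  rewrite coef_b eqxx; case: ltnP => [_|le]; first by rewrite mulr1.
  by rewrite (frcoef_out fr a le) mul0r.
move=> w /negPf ne; rewrite -scalerAr frcoefZ basis_El; case: eqP => _.
  by rewrite coef_b eq_sym ne mulr0.
by rewrite frcoef0 mulr0.
Qed.

Lemma coef_Er v i a : coef v (a * E i) = if v.2 == i :> nat then coef v a else 0.
Proof.
rewrite {1}(frexpand fr a) mulr_suml frcoef_sum (bigD1 v) //= big1 ?addr0.
  rewrite -scalerAl frcoefZ basis_Er; case: eqP => _; last by rewrite frcoef0 mulr0.
  rewrite coef_b eqxx; case: ltnP => [_|le]; first by rewrite mulr1.
  by rewrite (frcoef_out fr a le) mul0r.
move=> w /negPf ne; rewrite -scalerAl frcoefZ basis_Er; case: eqP => _.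
  by rewrite coef_b eq_sym ne mulr0.
by rewrite frcoef0 mulr0.
Qed.

Lemma mulE1r a : a = \sum_(i < l) a * E i.
Proof. by rewrite -mulr_sumr frE_sum mulr1. Qed.

(** These are the possible images of a generator of degree d of a free bimodule. *)
Definition graded (M : bimodule L) (d : nat) (m : M) :=
  forall i, ract m (E i) = lact (E (i + d)%N) m.

Section FreeBimodule.
Variable s : seq nat.
Local Notation gidx := ('I_(size s) * bidx n)%type.

(** The free bimodule on generators g_j of degrees s_j is the sum of the
    L E_(i+s_j) (x) E_i L. Expanding the right factor in the basis of paths, its
    elements are the sums of the f(j, w) g_j w with f(j, w) ending at the vertex
    where the generator leads from the target of w. *)
Definition fb_pred : pred {ffun gidx -> L} := fun f =>
  `[< forall p, f p * E (tgt p.2 + nth 0%N s p.1)%N = f p >].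

Fact fb_submod : submod_closed fb_pred.
Proof.
split=> [|c f g /asboolP sf /asboolP sg]; apply/asboolP => p.
  by rewrite ffunE mul0r.
by rewrite !ffunE mulrDl -scalerAl sf sg.
Qed.
HB.instance Definition _ :=
  GRing.isSubmodClosed.Build k {ffun gidx -> L} fb_pred fb_submod.

Record free_bim : Type := FreeBim {
  fb_val :> {ffun gidx -> L};
  fb_valP : fb_val \in fb_pred
}.
HB.instance Definition _ := [isSub for fb_val].
HB.instance Definition _ := [Choice of free_bim by <:].
HB.instance Definition _ := [SubChoice_isSubLmodule of free_bim by <:].

Lemma fbP (f g : free_bim) : (forall p, f p = g p) -> f = g.
Proof. by move=> fg; apply: val_inj; apply/ffunP. Qed.

Lemma fbE (f : free_bim) p : f p * E (tgt p.2 + nth 0%N s p.1)%N = f p.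
Proof. by have /asboolP := fb_valP f. Qed.

Lemma fb_addE (f g : free_bim) p : (f + g) p = f p + g p.
Proof. by rewrite ffunE. Qed.
Lemma fb_scaleE c (f : free_bim) p : (c *: f) p = c *: f p.
Proof. by rewrite ffunE. Qed.
Lemma fb_0E p : (0 : free_bim) p = 0.
Proof. by rewrite ffunE. Qed.

Fact fb_lact_sub a (f : free_bim) : [ffun p => a * f p] \in fb_pred.
Proof. by apply/asboolP => p; rewrite ffunE -mulrA fbE. Qed.
Definition fb_lact a f := FreeBim (fb_lact_sub a f).

Lemma coef_mul_tgt w v a : coef w (b v * a) != 0 -> tgt w = tgt v.
Proof.
have -> : b v * a = E (tgt v) * (b v * a) by rewrite mulrA basis_tgt.
by rewrite coef_El; case: (tgt v =P tgt w) => [->|_] //; rewrite eqxx.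
Qed.

Fact fb_ract_sub (f : free_bim) a :
  [ffun p : gidx => \sum_v coef p.2 (b v * a) *: f (p.1, v)] \in fb_pred.
Proof.
apply/asboolP => -[j w]; rewrite ffunE /= mulr_suml; apply: eq_bigr => v _.
rewrite -scalerAl; have [->|/coef_mul_tgt ->] := eqVneq (coef w (b v * a)) 0.
  by rewrite !scale0r.
by have := fbE f (j, v) => /= ->.
Qed.
Definition fb_ract f a := FreeBim (fb_ract_sub f a).

Lemma fb_ractE f a j w : fb_ract f a (j, w) = \sum_v coef w (b v * a) *: f (j, v).
Proof. by rewrite ffunE. Qed.
Lemma fb_lactE f a p : fb_lact a f p = a * f p.
Proof. by rewrite ffunE. Qed.

Lemma fb_out (f : free_bim) j v : (l <= tgt v)%N -> f (j, v) = 0.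
Proof. by move=> le_v; rewrite -fbE frE_out ?mulr0 //= (leq_trans le_v) ?leq_addr. Qed.

Definition fb : bimodule L.
Proof.
refine (@Bimodule k L free_bim fb_lact fb_ract _ _ _ _ _ _ _ _ _).
- move=> f c a a'; apply: fbP => p.
  by rewrite fb_addE fb_scaleE !fb_lactE mulrDl scalerAl.
- move=> a c f g; apply: fbP => p.
  by rewrite fb_addE fb_scaleE !fb_lactE fb_addE fb_scaleE mulrDr scalerAr.
- move=> a c f g; apply: fbP => -[j w].
  rewrite fb_addE fb_scaleE !fb_ractE scaler_sumr -big_split; apply: eq_bigr => v _.
  by rewrite fb_addE fb_scaleE scalerDr !scalerA mulrC.
- move=> f c a a'; apply: fbP => -[j w].
  rewrite fb_addE fb_scaleE !fb_ractE scaler_sumr -big_split; apply: eq_bigr => v _.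
  by rewrite mulrDr -scalerAr frcoefD frcoefZ scalerDl !scalerA.
- by move=> f; apply: fbP => p; rewrite fb_lactE mul1r.
- move=> f; apply: fbP => -[j w]; rewrite fb_ractE (bigD1 w) //= big1 ?addr0.
    rewrite mulr1 coef_b eqxx; case: ltnP => [_|/fb_out ->]; first by rewrite scale1r.
    by rewrite scaler0.
  by move=> v ne; rewrite mulr1 coef_b eq_sym (negPf ne) scale0r.
- by move=> a a' f; apply: fbP => p; rewrite !fb_lactE mulrA.
- move=> a a' f; apply: fbP => -[j w]; rewrite !fb_ractE.
  under [RHS]eq_bigr => u _ do rewrite fb_ractE scaler_sumr.
  rewrite exchange_big; apply: eq_bigr => v _ /=.
  rewrite mulrA {1}(frexpand fr (b v * a)) mulr_suml frcoef_sum scaler_suml.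
  by apply: eq_bigr => u _; rewrite -scalerAl frcoefZ scalerA mulrC.
- move=> a f a'; apply: fbP => -[j w].
  rewrite fb_lactE !fb_ractE mulr_sumr; apply: eq_bigr => v _.
  by rewrite fb_lactE scalerAr.
Defined.

Lemma fbm_linE c (f g : fb) p :
  fb_val (c *: f + g) p = c *: fb_val f p + fb_val g p.
Proof. by rewrite [LHS]fb_addE [in LHS]fb_scaleE. Qed.
Lemma fbm_ractE (f : fb) a j w :
  fb_val (ract f a) (j, w) = \sum_v coef w (b v * a) *: fb_val f (j, v).
Proof. exact: fb_ractE. Qed.

(** The element a g_j c, for g_j the j-th generator *)
Fact fb_elt_sub (j : 'I_(size s)) a c :
  [ffun p : gidx => if p.1 == j
     then coef p.2 c *: (a * E (tgt p.2 + nth 0%N s j)%N) else 0] \in fb_pred.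
Proof.
apply/asboolP => -[j' v]; rewrite ffunE /=; case: eqP => [->|_]; last by rewrite mul0r.
by rewrite -scalerAl -mulrA frE_mul eqxx.
Qed.
Definition fb_elt j a c : fb := FreeBim (fb_elt_sub j a c).

Lemma fb_eltE j a c j' v : (fb_elt j a c : free_bim) (j', v) =
  if j' == j then coef v c *: (a * E (tgt v + nth 0%N s j)%N) else 0.
Proof. by rewrite ffunE. Qed.

Lemma fb_elt_lact j a c a' : lact a' (fb_elt j a c) = fb_elt j (a' * a) c.
Proof.
apply: fbP => -[j' v]; rewrite [LHS]fb_lactE !fb_eltE.
by case: eqP => _; rewrite ?mulr0 // -scalerAr mulrA.
Qed.

Lemma fb_elt_ract j a c c' : ract (fb_elt j a c) c' = fb_elt j a (c * c').
Proof.
apply: fbP => -[j' w]; rewrite [LHS]fb_ractE !fb_eltE.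
under eq_bigr => v _ do rewrite fb_eltE.
case: eqP => _; last by rewrite big1 // => v _; rewrite scaler0.
rewrite {2}(frexpand fr c) mulr_suml frcoef_sum scaler_suml; apply: eq_bigr => v _.
rewrite -scalerAl frcoefZ [coef v c * _]mulrC -scalerA.
by have [->|/coef_mul_tgt ->] := eqVneq (coef w (b v * c')) 0; rewrite ?scale0r.
Qed.

Lemma fb_elt_linl j c : linear (fun a => fb_elt j a c).
Proof.
move=> d a a'; apply: fbP => -[j' v]; rewrite fb_addE fb_scaleE !fb_eltE.
case: eqP => _; last by rewrite scaler0 addr0.
by rewrite mulrDl scalerDr -scalerAl !scalerA [d * _]mulrC.
Qed.

(** Both sides keep the terms w of c with target t: tensoring is over the
    vertices. *)
Lemma fb_elt_E (j : 'I_(size s)) a c t : fb_elt j (a * E (t + nth 0%N s j)%N) c = fb_elt j a (E t * c).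
Proof.
apply: fbP => -[j' v]; rewrite !fb_eltE; case: eqP => _ //.
rewrite -mulrA frE_mul eqn_add2r coef_El; case: eqP => [->|_] //.
by rewrite mulr0 scaler0 scale0r.
Qed.

Definition fb_gen j : fb := fb_elt j 1 1.

Lemma fb_gen_graded (j : 'I_(size s)) : graded (nth 0%N s j) (fb_gen j).
Proof.
by move=> i; rewrite fb_elt_lact fb_elt_ract mulr1 mul1r -[in RHS](mul1r (E _)) fb_elt_E mulr1.
Qed.

Lemma fb_sumE I (r : seq I) (p : pred I) (G : I -> free_bim) q :
  (\sum_(i <- r | p i) G i) q = \sum_(i <- r | p i) G i q.
Proof.
by apply: (big_morph (fun f : free_bim => f q) (fun f g => fb_addE f g q) (fb_0E q)).
Qed.

Lemma fb_decomp (f : fb) : f = \sum_p fb_elt p.1 ((f : free_bim) p) (b p.2).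
Proof.
apply: fbP => -[j v]; rewrite fb_sumE (bigD1 (j, v)) //= big1 ?addr0.
  rewrite fb_eltE eqxx coef_b eqxx; have /= -> := fbE f (j, v).
  by case: ltnP => [_|/fb_out ->]; rewrite ?scale1r ?scaler0.
move=> [j' v'] ne; rewrite fb_eltE /= coef_b; case: (j =P j') => // ej.
rewrite (_ : (v == v') = false) ?scale0r //; apply/negbTE; apply: contra ne => /eqP <-.
by rewrite ej eqxx.
Qed.

Section Lift.
Variables (M : bimodule L) (m : 'I_(size s) -> M).

(** The map sending g_j to m_j. It is a bimodule map for every m, but it takes
    the prescribed value on g_j only when m_j has the degree of g_j. *)
Definition fb_lift (f : fb) : M :=
  \sum_p ract (lact ((f : free_bim) p) (m p.1)) (b p.2).

Lemma fb_lift_hom : bim_hom fb_lift.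
Proof.
split=> [c f g|a f|f a]; rewrite /fb_lift.
- rewrite scaler_sumr -big_split; apply: eq_bigr => p _ /=.
  by rewrite fbm_linE lactDl lactZl ractDl ractZl.
- by rewrite lact_sumr; apply: eq_bigr => p _; rewrite fb_lactE lactM lract.
- rewrite ract_suml.
  under [RHS]eq_bigr => p _ do rewrite -ractM [b p.2 * a](frexpand fr) ract_sumr.
  rewrite !sum_pair /=.
  apply: eq_bigr => j _; rewrite exchange_big; apply: eq_bigr => w _.
  rewrite fbm_ractE lact_suml ract_suml; apply: eq_bigr => v _.
  by rewrite lactZl ractZl ractZr.
Qed.

Hypothesis m_graded : forall j : 'I_(size s), graded (nth 0%N s j) (m j).

Lemma fb_lift_elt j a c : fb_lift (fb_elt j a c) = ract (lact a (m j)) c.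
Proof.
rewrite /fb_lift sum_pair /=.
rewrite (bigD1 j) //= [X in _ + X]big1 ?addr0 => [|j' /negPf ne]; last first.
  by apply: big1 => v _; rewrite fb_eltE ne lact0l ract0l.
rewrite [in RHS](frexpand fr c) ract_sumr; apply: eq_bigr => v _.
rewrite fb_eltE eqxx lactZl ractZl ractZr; congr (_ *: _).
by rewrite lactM -m_graded -lract -ractM basis_tgt.
Qed.

Lemma fb_lift_gen j : fb_lift (fb_gen j) = m j.
Proof. by rewrite fb_lift_elt lact1 ract1. Qed.

End Lift.

Lemma fb_elt_gen j a c : fb_elt j a c = ract (lact a (fb_gen j)) c.
Proof. by rewrite fb_elt_lact fb_elt_ract mulr1 mul1r. Qed.

Lemma fb_hom_eq (M : bimodule L) (f g : fb -> M) : bim_hom f -> bim_hom g ->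
  (forall j, f (fb_gen j) = g (fb_gen j)) -> forall x, f x = g x.
Proof.
move=> hf hg fg x; rewrite [x]fb_decomp !bim_hom_sum //; apply: eq_bigr => p _.
rewrite fb_elt_gen; case: hf => _ fl fr'; case: hg => _ gl gr.
by rewrite fr' fl gr gl fg.
Qed.

Lemma graded_hom (M N : bimodule L) (f : M -> N) d m :
  bim_hom f -> graded d m -> graded d (f m).
Proof. by move=> [_ fl fr'] gm i; rewrite -fr' gm fl. Qed.

(** The component of degree d, by which a lift of a graded element is corrected. *)
Definition graded_part (M : bimodule L) d (m : M) :=
  \sum_(i < l) ract (lact (E (i + d)%N) m) (E i).

Lemma graded_partP (M : bimodule L) d (m : M) : graded d (graded_part d m).
Proof.
move=> t; rewrite /graded_part ract_suml lact_sumr; apply: eq_bigr => i _.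
rewrite -ractM -lract -lactM !frE_mul eqn_add2r eq_sym.
by case: eqP => [->|_] //; rewrite ract0r lact0l ract0l.
Qed.

Lemma graded_part_id (M : bimodule L) d (m : M) : graded d m -> graded_part d m = m.
Proof.
move=> gm; rewrite -[RHS]ract1 -(frE_sum fr) ract_sumr; apply: eq_bigr => i _.
by rewrite -gm -ractM frE_mul eqxx.
Qed.

(** Lift the images of the generators arbitrarily, then replace the lifts by their
    components of the right degrees, which have the same images. *)
Lemma fb_projective : projective fb.
Proof.
move=> M N g f hg g_surj hf.
have [m gm] := choice (fun j => g_surj (f (fb_gen j))).
pose m' (j : 'I_(size s)) := graded_part (nth 0%N s j) (m j).
have m'_graded (j : 'I_(size s)) : graded (nth 0%N s j) (m' j) by apply: graded_partP.
exists (fb_lift m'); first exact: fb_lift_hom.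
apply: fb_hom_eq => //; first exact: bim_hom_comp hg (fb_lift_hom _).
move=> j; rewrite fb_lift_gen // -[RHS](graded_part_id (graded_hom hf (fb_gen_graded j))).
rewrite /m' /graded_part (bim_hom_sum _ _ _ hg) -gm; apply: eq_bigr => i _.
by case: hg => _ gl gr; rewrite gr gl.
Qed.

End FreeBimodule.
End FrameTheory.

(** * Derivations through the trivial extension *)

(** In the square-zero extension of L by M the product of (a, m) and (b, p) is
    (ab, mb + ap): its second component is the Leibniz rule. The pairs (a, D a)
    multiply as in L when D is a derivation, so derived relations can be computed
    as relations in this algebra. *)
Definition trivext (k : fieldType) (L : algType k) (M : bimodule L) : Type :=
  (L * M)%type.

Section TrivialExtension.
Variables (k : fieldType) (L : algType k) (M : bimodule L).
Local Notation T := (trivext M).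

HB.instance Definition _ := GRing.Lmodule.on T.

Definition te_mul (s t : T) : T := (s.1 * t.1, ract s.2 t.1 + lact s.1 t.2).
Definition te_one : T := (1, 0).

Fact te_mulA : associative te_mul.
Proof.
move=> [a m] [b p] [c q]; rewrite /te_mul /= mulrA; congr (_, _).
by rewrite ractDl lactDr ractM lactM lract addrA.
Qed.
Fact te_mul1 : left_id te_one te_mul.
Proof. by move=> [a m]; rewrite /te_mul /= mul1r ract0l lact1 add0r. Qed.
Fact te_mulr1 : right_id te_one te_mul.
Proof. by move=> [a m]; rewrite /te_mul /= mulr1 lact0r ract1 addr0. Qed.
Fact te_mulDl : left_distributive te_mul +%R.
Proof.
move=> [a m] [b p] [c q]; rewrite /te_mul /= mulrDl; congr (_, _).
by rewrite ractDl lactDl addrACA.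
Qed.
Fact te_mulDr : right_distributive te_mul +%R.
Proof.
move=> [a m] [b p] [c q]; rewrite /te_mul /= mulrDr; congr (_, _).
by rewrite ractDr lactDr addrACA.
Qed.
Fact te_one_neq0 : te_one != 0.
Proof. by apply/eqP => -[/eqP]; rewrite oner_eq0. Qed.
HB.instance Definition _ := GRing.Zmodule_isNzRing.Build T
  te_mulA te_mul1 te_mulr1 te_mulDl te_mulDr te_one_neq0.

Fact te_scaleAl (c : k) (s t : T) : c *: (s * t) = c *: s * t.
Proof.
case: s t => a m [b p]; congr (_, _) => /=; first exact: scalerAl.
by rewrite scalerDr ractZl lactZl.
Qed.
HB.instance Definition _ := GRing.Lmodule_isLalgebra.Build k T te_scaleAl.
Fact te_scaleAr (c : k) (s t : T) : c *: (s * t) = s * (c *: t).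
Proof.
case: s t => a m [b p]; congr (_, _) => /=; first exact: scalerAr.
by rewrite scalerDr ractZr lactZr.
Qed.
HB.instance Definition _ := GRing.Lalgebra_isAlgebra.Build k T te_scaleAr.

Lemma te_mulE (s t : T) : s * t = (s.1 * t.1, ract s.2 t.1 + lact s.1 t.2) :> T.
Proof. by []. Qed.

End TrivialExtension.

Section Relations.
Variables (k : fieldType) (alpha beta : k).

Definition rel_xxy (B : algType k) (x y : B) : B :=
  x * x * y - beta *: (y * x * x) - alpha *: (x * y * x).
Definition rel_xyy (B : algType k) (x y : B) : B :=
  x * y * y - beta *: (y * y * x) - alpha *: (y * x * y).

Lemma rel_morph (B C : algType k) (f : B -> C) (x y : B) :
    {morph f : u v / u * v} -> {morph f : u v / u - v} ->
    (forall c, {morph f : u / c *: u}) ->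
  f (rel_xxy x y) = rel_xxy (f x) (f y) /\ f (rel_xyy x y) = rel_xyy (f x) (f y).
Proof. by move=> fM fB fZ; rewrite /rel_xxy /rel_xyy !(fB, fM, fZ). Qed.

Lemma rel_conj (B : algType k) (u v x y : B) : u * v = 1 ->
  rel_xxy (v * x * u) (v * y * u) = v * rel_xxy x y * u /\
  rel_xyy (v * x * u) (v * y * u) = v * rel_xyy x y * u.
Proof.
move=> uv; have cj a c : v * a * u * (v * c * u) = v * (a * c) * u.
  by rewrite !mulrA -[v * a * u * v]mulrA uv mulr1.
by rewrite /rel_xxy /rel_xyy !cj !(mulrBl, mulrBr) -!scalerAr -!scalerAl.
Qed.

End Relations.

Section RingGrading.
Variables (B : pzRingType) (E : nat -> B).

Definition rgraded d (a : B) := forall i, a * E i = E (i + d)%N * a.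

Lemma rgradedM d e a c : rgraded d a -> rgraded e c -> rgraded (e + d) (a * c).
Proof. by move=> ga gc i; rewrite -mulrA gc mulrA ga addnA mulrA. Qed.

Lemma rgradedB d a c : rgraded d a -> rgraded d c -> rgraded d (a - c).
Proof. by move=> ga gc i; rewrite mulrBl mulrBr ga gc. Qed.
End RingGrading.

Lemma rgradedZ (k : fieldType) (B : algType k) (E : nat -> B) d c a :
  rgraded E d a -> rgraded E d (c *: a).
Proof. by move=> ga i; rewrite -scalerAl -scalerAr ga. Qed.

Lemma rel_graded (k : fieldType) (alpha beta : k) (B : algType k)
    (E : nat -> B) n (x y : B) : rgraded E 1 x -> rgraded E n y ->
  rgraded E n.+2 (rel_xxy alpha beta x y) /\
  rgraded E (2 * n).+1 (rel_xyy alpha beta x y).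
Proof.
move=> gx gy; split; (apply: rgradedB; [apply: rgradedB|]);
  try apply: rgradedZ.
- have := rgradedM (rgradedM gx gx) gy; congr rgraded; lia.
- have := rgradedM (rgradedM gy gx) gx; congr rgraded; lia.
- have := rgradedM (rgradedM gx gy) gx; congr rgraded; lia.
- have := rgradedM (rgradedM gx gy) gy; congr rgraded; lia.
- have := rgradedM (rgradedM gy gy) gx; congr rgraded; lia.
- have := rgradedM (rgradedM gy gx) gy; congr rgraded; lia.
Qed.

Section Derivations.
Variables (k : fieldType) (n : nat) (alpha beta : k) (L : algType k).
Variable fr : frame n alpha beta L.
Local Notation E := (frE fr).
Local Notation X := (frX fr).
Local Notation Y := (frY fr).
Local Notation R1 := (rel_xxy alpha beta).
Local Notation R2 := (rel_xyy alpha beta).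

Lemma gradedX : rgraded E 1 X.
Proof. by move=> i; rewrite addn1 frXE. Qed.
Lemma gradedY : rgraded E n Y.
Proof. exact: frYE. Qed.
Lemma frame_rel : R1 X Y = 0 /\ R2 X Y = 0.
Proof.
rewrite /rel_xxy /rel_xyy; have := frxxy fr; have := frxyy fr.
rewrite !expr2 !mulrA => -> ->.
by rewrite !(addrC (beta *: _)) !addrK !subrr.
Qed.

Section Cochain.
Variables (M : bimodule L).
Local Notation T := (trivext M).

Definition teE i : T := (E i, 0).

Lemma te_graded d (a : L) (m : M) :
  rgraded teE d (a, m) <-> rgraded E d a /\ graded fr d m.
Proof.
split=> [g|[ga gm] i].
  by split=> i; have [] := g i; rewrite lact0r ract0l addr0 add0r.
by rewrite !te_mulE /= lact0r ract0l addr0 add0r ga gm.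
Qed.

(** The values on the two relations of the derivation of the free algebra
    sending x to u and y to v. *)
Definition der_xxy (u v : M) : M := (R1 ((X, u) : T) (Y, v)).2.
Definition der_xyy (u v : M) : M := (R2 ((X, u) : T) (Y, v)).2.

Lemma rel_te (u v : M) : R1 ((X, u) : T) (Y, v) = (0, der_xxy u v) /\
  R2 ((X, u) : T) (Y, v) = (0, der_xyy u v).
Proof.
have [r1 r2] := @rel_morph k alpha beta T L fst (X, u) (Y, v)
  (fun _ _ => erefl) (fun _ _ => erefl) (fun _ _ => erefl).
have [f1 f2] := frame_rel; rewrite /der_xxy /der_xyy.
move: (etrans r1 f1) (etrans r2 f2).
by case: (R1 _ _) => a m; case: (R2 _ _) => a' m' /= -> ->.
Qed.

Lemma der_graded (u v : M) : graded fr 1 u -> graded fr n v ->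
  graded fr n.+2 (der_xxy u v) /\ graded fr (2 * n).+1 (der_xyy u v).
Proof.
move=> gu gv.
have [||] := @rel_graded k alpha beta T teE n (X, u) (Y, v).
- by apply/te_graded; split => //; apply: gradedX.
- by apply/te_graded; split => //; apply: gradedY.
by have [-> ->] := rel_te u v; move=> /te_graded[_ ?] /te_graded[_ ?].
Qed.

Definition inner (g : M) (a : L) : M := lact a g - ract g a.

(** In the trivial extension, a |-> (a, ag - ga) is conjugation by 1 + g, which
    preserves the relations. *)
Lemma der_inner (g : M) :
  der_xxy (inner g X) (inner g Y) = 0 /\ der_xyy (inner g X) (inner g Y) = 0.
Proof.
pose U : T := (1, g); pose V : T := (1, - g).
have UV : U * V = 1 by rewrite te_mulE /= mulr1 lact1 ract1 subrr.
have innE a : ((a, inner g a) : T) = V * ((a, 0) : T) * U.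
  rewrite te_mulE /= !mul1r !mulr1 lact0r addr0 ract1 ractNl.
  by rewrite /inner addrC.
rewrite /der_xxy /der_xyy !innE.
have [-> ->] := @rel_conj k alpha beta T U V (X, 0) (Y, 0) UV.
have i0 : {morph (fun a => (a, 0) : T) : a c / a * c}.
  by move=> a c; rewrite te_mulE /= lact0r ract0l addr0.
have i1 : {morph (fun a => (a, 0) : T) : a c / a - c}.
  by move=> a c; congr (_, _); rewrite /= subrr.
have i2 d : {morph (fun a => (a, 0) : T) : a / d *: a}.
  by move=> a; congr (_, _); rewrite /= scaler0.
have [<- <-] := @rel_morph k alpha beta L T _ X Y i0 i1 i2.
have [-> ->] := frame_rel.
by rewrite !te_mulE /= !(mulr0, mul0r, lact0r, ract0l, ract0r, lact0l, addr0).
Qed.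

End Cochain.

(** A bimodule map extends to a morphism of trivial extensions. *)
Lemma der_hom (M N : bimodule L) (f : M -> N) (u v : M) : bim_hom f ->
  f (der_xxy u v) = der_xxy (f u) (f v) /\ f (der_xyy u v) = der_xyy (f u) (f v).
Proof.
move=> hf; pose F (t : trivext M) : trivext N := (t.1, f t.2).
have FM : {morph F : s t / s * t}.
  move=> [a m] [c p]; rewrite !te_mulE /F /=; congr (_, _).
  by rewrite (bim_homD hf); case: hf => _ -> ->.
have FB : {morph F : s t / s - t}.
  by move=> [a m] [c p]; congr (_, _); rewrite /= (bim_homB hf).
have FZ d : {morph F : t / d *: t}.
  by move=> [a m]; congr (_, _); rewrite /= (bim_homZ _ hf).
have [r1 r2] := @rel_morph k alpha beta _ _ F (X, u) (Y, v) FM FB FZ.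
by split; [have /(congr1 snd) := r1 | have /(congr1 snd) := r2].
Qed.

End Derivations.

(** * The universal derivation modulo the relations *)

Lemma addr_sub2 (V : zmodType) (p q z : V) : p + q + (z - p - q) = z.
Proof. by rewrite -[z - p - q]addrA -opprD [LHS]addrC subrK. Qed.

Section WordProducts.
Variables (k : fieldType) (n : nat) (alpha beta : k) (B : algType k).
Variables (E : nat -> B) (x y : B).
Hypothesis n_ge2 : (2 <= n)%N.
Hypothesis gx : rgraded E 1 x.
Hypothesis gy : rgraded E n y.
Hypothesis E_out : forall i, (beil_size n <= i)%N -> E i = 0.

(** Paths with natural indices, in any algebra with vertices and two elements of
    degrees 1 and n: L itself or its trivial extensions. The defect of the
    relations stays visible in the products computed below. *)
Definition wd kap c i : B := head_word x y kap * x ^+ c * E i.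

Lemma wd_E kap c i : (kap < 5)%N ->
  wd kap c i = E (i + (c + head_deg n kap))%N * (head_word x y kap * x ^+ c).
Proof. by move=> ?; apply: word_E => // j; rewrite gx addn1. Qed.

Lemma wd_out kap c i : (kap < 5)%N -> (beil_size n <= i + (c + head_deg n kap))%N ->
  wd kap c i = 0.
Proof. by move=> lt_kap le; rewrite wd_E // E_out // mul0r. Qed.

Lemma mul_wd_out d z kap c i : rgraded E d z -> (kap < 5)%N ->
  (beil_size n <= d + head_deg n kap)%N -> z * wd kap c i = 0.
Proof. by move=> gz lt_kap le; rewrite wd_E // mulrA gz E_out ?mul0r //; lia. Qed.

Lemma x_wd0 c i : x * wd 0 c i = wd 0 c.+1 i.
Proof. by rewrite /wd /head_word /= !mul1r mulrA exprS. Qed.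
Lemma x_wd1 c i : x * wd 1 c i = wd 2 c i.
Proof. by rewrite /wd /head_word /= !mulrA. Qed.
Lemma x_wd2 c i : x * wd 2 c i = beta *: wd 1 c.+2 i + alpha *: wd 2 c.+1 i +
  rel_xxy alpha beta x y * (x ^+ c * E i).
Proof.
rewrite /wd /rel_xxy /head_word /= !exprS !mulrBl -!scalerAl !mulrA.
by rewrite addr_sub2.
Qed.
Lemma x_wd3 c i : x * wd 3 c i = beta *: wd 3 c.+1 i + alpha *: wd 4 c i +
  rel_xyy alpha beta x y * (x ^+ c * E i).
Proof.
rewrite /wd /rel_xyy /head_word /= !exprS !mulrBl -!scalerAl !mulrA.
by rewrite addr_sub2.
Qed.
Lemma x_wd4 c i : x * wd 4 c i = 0.
Proof. by apply: mul_wd_out gx _ _ => //; rewrite /beil_size /head_deg /=; lia. Qed.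
Lemma y_wd0 c i : y * wd 0 c i = wd 1 c i.
Proof. by rewrite /wd /head_word /= mul1r mulrA. Qed.
Lemma y_wd1 c i : y * wd 1 c i = wd 3 c i.
Proof. by rewrite /wd /head_word /= !mulrA. Qed.
Lemma y_wd2 c i : y * wd 2 c i = wd 4 c i.
Proof. by rewrite /wd /head_word /= !mulrA. Qed.
Lemma y_wd3 c i : y * wd 3 c i = 0.
Proof. by apply: mul_wd_out gy _ _ => //; rewrite /beil_size /head_deg /=; lia. Qed.
Lemma y_wd4 c i : y * wd 4 c i = 0.
Proof. by apply: mul_wd_out gy _ _ => //; rewrite /beil_size /head_deg /=; lia. Qed.

End WordProducts.

(** A choice of values u and v at x and y defines a map on paths through their
    lifts to the trivial extension. Rewriting a product of a path by X or Y back
    to paths only costs multiples of the derived relations, so modulo a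
    submodule S containing these the map obeys the Leibniz rule. *)
Section Derivation.
Variables (k : fieldType) (n : nat) (alpha beta : k) (L : algType k).
Variable fr : frame n alpha beta L.
Hypothesis n_ge2 : (2 <= n)%N.
Local Notation E := (frE fr).
Local Notation X := (frX fr).
Local Notation Y := (frY fr).
Local Notation coef := (frcoef fr).
Local Notation l := (beil_size n).
Local Notation b := (basis_elt E X Y).

Variables (M : bimodule L) (u v : M).
Hypothesis gu : graded fr 1 u.
Hypothesis gv : graded fr n v.
Variable S : M -> Prop.
Hypothesis S0 : S 0.
Hypothesis SD : forall c m p, S m -> S p -> S (c *: m + p).
Hypothesis Sr : forall a m, S m -> S (ract m a).
Hypothesis S1 : S (der_xxy fr u v).
Hypothesis S2 : S (der_xyy fr u v).

Local Notation T := (trivext M).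
Local Notation tX := ((X, u) : T).
Local Notation tY := ((Y, v) : T).
Local Notation tE := (teE fr M).
Local Notation tb := (@basis_elt n T tE tX tY).

Let gtX : rgraded tE 1 tX.
Proof. by apply/te_graded; split=> //; apply: gradedX. Qed.
Let gtY : rgraded tE n tY.
Proof. by apply/te_graded; split=> //; apply: gradedY. Qed.
Let tE_out i : (l <= i)%N -> tE i = 0.
Proof. by move=> le; rewrite /teE frE_out. Qed.

Definition der_lift (a : L) : T := \sum_w coef w a *: tb w.

Lemma der_liftZD c a a' : der_lift (c *: a + a') = c *: der_lift a + der_lift a'.
Proof.
rewrite /der_lift scaler_sumr -big_split; apply: eq_bigr => w _ /=.
by rewrite frcoefD frcoefZ scalerDl scalerA.
Qed.
Lemma der_lift0 : der_lift 0 = 0.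
Proof. by apply: big1 => w _; rewrite frcoef0 scale0r. Qed.
Lemma der_liftD a a' : der_lift (a + a') = der_lift a + der_lift a'.
Proof. by have := der_liftZD 1 a a'; rewrite !scale1r. Qed.
Lemma der_liftZ c a : der_lift (c *: a) = c *: der_lift a.
Proof. by have := der_liftZD c a 0; rewrite der_lift0 !addr0. Qed.

Lemma te_basis_fst (w : bidx n) : (tb w).1 = b w.
Proof.
have f1 : {morph (fst : T -> L) : s t / s * t} by [].
have fX c : (tX ^+ c).1 = X ^+ c.
  by elim: c => [|c IH] //; rewrite !exprS f1 IH.
rewrite /basis_elt !f1 fX; congr (_ * _ * _).
by case: w => -[[[|[|[|[|[|//]]]]] ?] ?] ?.
Qed.

Lemma fst_sum I (r : seq I) (G : I -> T) : (\sum_(i <- r) G i).1 = \sum_(i <- r) (G i).1.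
Proof. exact: (big_morph (fst : T -> L) (fun _ _ => erefl) erefl). Qed.
Lemma snd_sum I (r : seq I) (G : I -> T) : (\sum_(i <- r) G i).2 = \sum_(i <- r) (G i).2.
Proof. exact: (big_morph (snd : T -> M) (fun _ _ => erefl) erefl). Qed.

Lemma der_lift_fst a : (der_lift a).1 = a.
Proof.
rewrite fst_sum [RHS](frexpand fr); apply: eq_bigr => w _.
by rewrite -[in RHS]te_basis_fst.
Qed.

Lemma der_lift_wd kap c i : (kap < 5)%N ->
  der_lift (wd E X Y kap c i) = wd tE tX tY kap c i.
Proof.
move=> lt_kap; case: (ltnP (i + (c + head_deg n kap)) l) => [lt|le]; last first.
  rewrite (wd_out (gradedX fr) (gradedY fr) (@frE_out _ _ _ _ _ fr)) //.
  by rewrite (wd_out gtX gtY tE_out) // der_lift0.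
have lt_c : (c < l)%N by lia.
have lt_i : (i < l)%N by lia.
pose w : bidx n := (Ordinal lt_kap, Ordinal lt_c, Ordinal lt_i).
rewrite /der_lift (bigD1 w) //= big1 => [|w' ne].
  by rewrite (@frcoef_basis _ _ _ _ _ fr w w) // eqxx scale1r addr0.
by rewrite (@frcoef_basis _ _ _ _ _ fr w' w) // (negPf ne) scale0r.
Qed.

Definition cong (s t : T) := s.1 = t.1 /\ S (s.2 - t.2).

Lemma cong_refl t : cong t t.
Proof. by split; rewrite ?subrr. Qed.
Lemma cong_lin c s s' t t' : cong s s' -> cong t t' -> cong (c *: s + t) (c *: s' + t').
Proof.
move=> [e Ss] [e' St]; split; rewrite /= ?e ?e' //.
by rewrite opprD addrACA -scalerBr; apply: SD.
Qed.
Lemma cong_sum I (r : seq I) (c : I -> k) (F G : I -> T) :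
  (forall i, cong (F i) (G i)) -> cong (\sum_(i <- r) c i *: F i) (\sum_(i <- r) c i *: G i).
Proof.
move=> FG; elim/big_rec2: _ => [|i s t _ st]; first exact: cong_refl.
exact: cong_lin.
Qed.

Lemma cong_rel (s t q : T) : (q = (0, der_xxy fr u v) \/ q = (0, der_xyy fr u v)) ->
  cong (s + q * t) s.
Proof.
move=> qE; split; first by case: qE => ->; rewrite te_mulE /= mul0r addr0.
rewrite /= addrAC subrr add0r.
by case: qE => -> /=; rewrite lact0l addr0; apply: Sr.
Qed.

Lemma cong_lift (t : T) (z a : L) :
  (forall kap c i, (kap < 5)%N ->
     cong (t * wd tE tX tY kap c i) (der_lift (z * wd E X Y kap c i))) ->
  cong (t * der_lift a) (der_lift (z * a)).
Proof.
move=> tz.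
have -> : t * der_lift a = \sum_w coef w a *: (t * tb w).
  by rewrite /der_lift mulr_sumr; apply: eq_bigr => w _; rewrite [RHS]scalerAr.
have -> : der_lift (z * a) = \sum_w coef w a *: der_lift (z * b w).
  rewrite {1}(frexpand fr a) mulr_sumr (big_morph _ der_liftD der_lift0).
  by apply: eq_bigr => w _; rewrite -scalerAr der_liftZ.
by apply: cong_sum => w; apply: tz.
Qed.

Lemma der_lift_X a : cong (tX * der_lift a) (der_lift (X * a)).
Proof.
have [r1 r2] := rel_te fr u v.
apply: cong_lift => -[|[|[|[|[|//]]]]] c i _.
- by rewrite !x_wd0 der_lift_wd //; apply: cong_refl.
- by rewrite !x_wd1 der_lift_wd //; apply: cong_refl.
- rewrite !(x_wd2 alpha beta) r1 (proj1 (frame_rel fr)) mul0r addr0 der_liftD !der_liftZ.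
  by rewrite !der_lift_wd //; apply: cong_rel; left.
- rewrite !(x_wd3 alpha beta) r2 (proj2 (frame_rel fr)) mul0r addr0 der_liftD !der_liftZ.
  by rewrite !der_lift_wd //; apply: cong_rel; right.
- rewrite (x_wd4 n_ge2 (gradedX fr) (gradedY fr) (@frE_out _ _ _ _ _ fr)).
  by rewrite (x_wd4 n_ge2 gtX gtY tE_out) der_lift0; apply: cong_refl.
Qed.

Lemma der_lift_Y a : cong (tY * der_lift a) (der_lift (Y * a)).
Proof.
apply: cong_lift => -[|[|[|[|[|//]]]]] c i _.
- by rewrite !y_wd0 der_lift_wd //; apply: cong_refl.
- by rewrite !y_wd1 der_lift_wd //; apply: cong_refl.
- by rewrite !y_wd2 der_lift_wd //; apply: cong_refl.
- rewrite (y_wd3 n_ge2 (gradedX fr) (gradedY fr) (@frE_out _ _ _ _ _ fr)).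
  by rewrite (y_wd3 n_ge2 gtX gtY tE_out) der_lift0; apply: cong_refl.
- rewrite (y_wd4 n_ge2 (gradedX fr) (gradedY fr) (@frE_out _ _ _ _ _ fr)).
  by rewrite (y_wd4 n_ge2 gtX gtY tE_out) der_lift0; apply: cong_refl.
Qed.

Definition der_map (a : L) : M := (der_lift a).2.

Lemma der_map_X a : S (ract u a + lact X (der_map a) - der_map (X * a)).
Proof. by have [_] := der_lift_X a; rewrite te_mulE /= der_lift_fst. Qed.
Lemma der_map_Y a : S (ract v a + lact Y (der_map a) - der_map (Y * a)).
Proof. by have [_] := der_lift_Y a; rewrite te_mulE /= der_lift_fst. Qed.

(** The left linear extension of the derivation, a g c |-> a D(c), which is the
    contracting homotopy from P0 to P1. *)
Definition der_fold (f : fb fr [:: 0%N]) : M :=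
  \sum_p lact (fb_val f p) (tb p.2).2.

Lemma der_fold_linD : linear der_fold.
Proof.
move=> c f g; rewrite /der_fold scaler_sumr -big_split; apply: eq_bigr => p _.
by rewrite fbm_linE lactDl lactZl.
Qed.

Lemma tb_tgt (w : bidx n) : lact (E (tgt w)) (tb w).2 = (tb w).2.
Proof.
have e : tE (tgt w) * tb w = tb w.
  rewrite [tb w](wd_E gtX gtY) //= mulrA.
  congr (_ * _); rewrite te_mulE /= /teE lact0r ract0l addr0; congr (_, _).
  by rewrite frE_mul eqxx.
by rewrite -[in RHS]e te_mulE /= ract0l add0r.
Qed.

Lemma der_fold_elt a c : der_fold (fb_elt fr (s := [:: 0%N]) ord0 a c) = lact a (der_map c).
Proof.
rewrite /der_fold sum_pair big_ord1 /der_map /der_lift snd_sum lact_sumr.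
apply: eq_bigr => w _; rewrite fb_eltE eqxx addn0 lactZl lactZr.
by rewrite lactM tb_tgt.
Qed.

End Derivation.

(** * The resolution and its exactness *)

Section Resolution.
Variables (k : fieldType) (n : nat) (alpha beta : k) (L : algType k).
Variable fr : frame n alpha beta L.
Hypothesis n_ge2 : (2 <= n)%N.
Local Notation E := (frE fr).
Local Notation X := (frX fr).
Local Notation Y := (frY fr).
Local Notation coef := (frcoef fr).
Local Notation l := (beil_size n).
Local Notation b := (@basis_elt n L E X Y).
Local Notation wdL := (wd E X Y).

Lemma coef_wd (w : bidx n) kap c i : (kap < 5)%N ->
  coef w (wdL kap c i) =
  [&& w.1.1 == kap :> nat, w.1.2 == c :> nat, w.2 == i :> nat & (tgt w < l)%N]%:R.
Proof.
move=> lt_kap; case: (ltnP (i + (c + head_deg n kap)) l) => [lt|le].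
  have lt_c : (c < l)%N by lia.
  have lt_i : (i < l)%N by lia.
  pose v : bidx n := (Ordinal lt_kap, Ordinal lt_c, Ordinal lt_i).
  rewrite (_ : wdL kap c i = b v) // coef_b; congr (_%:R).
  case: w => [[kw cw] iw] /=; rewrite /v !xpair_eqE -!val_eqE /=.
  do 3![case: eqP => //= ?]; rewrite /tgt /= lt; subst.
  by apply/esym; lia.
rewrite (wd_out (gradedX fr) (gradedY fr) (@frE_out _ _ _ _ _ fr)) // frcoef0.
case: w => [[kw cw] iw] /=; do 3![case: eqP => //= ?]; subst.
by rewrite ltnNge le.
Qed.

Lemma E0_X : E 0 * X = 0.
Proof.
rewrite (mulE1r fr (E 0 * X)) big1 // => i _.
by rewrite -mulrA frXE mulrA frE_mul mul0r.
Qed.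

Lemma wd_X kap c i : wdL kap c i.+1 * X = wdL kap c.+1 i.
Proof. by rewrite /wd -[LHS]mulrA -frXE !mulrA exprSr !mulrA. Qed.
Lemma wd_X0 kap c : wdL kap c 0 * X = 0.
Proof. by rewrite /wd -[LHS]mulrA E0_X mulr0. Qed.

Lemma coef_mulX (w v : bidx n) a : w.1.1 = v.1.1 -> w.1.2 = v.1.2.+1 :> nat ->
  v.2 = w.2.+1 :> nat -> coef w (a * X) = coef v a.
Proof.
move=> e1 e2 e3.
rewrite [in LHS](frexpand fr a) mulr_suml frcoef_sum (bigD1 v) //= big1 ?addr0.
  rewrite -scalerAl frcoefZ (_ : b v * X = wdL v.1.1 v.1.2.+1 w.2); last by rewrite -wd_X -e3.
  rewrite coef_wd //.
  rewrite e1 e2 !eqxx /=; case: ltnP => [_|le]; first by rewrite mulr1.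
  by rewrite mulr0 frcoef_out //; apply: leq_trans le _; rewrite /tgt e1 e2 e3; lia.
move=> u ne; rewrite -scalerAl frcoefZ.
have -> : coef w (b u * X) = 0; last by rewrite mulr0.
case: u ne => [[ku cu] [[|iu] lt_iu]] ne; first by rewrite [b _ * X]wd_X0 frcoef0.
rewrite [b _ * X]wd_X coef_wd //= e1 e2.
case: v {e1} e2 e3 ne => [[kv cv] iv] /= e2 e3 ne.
do 3![case: eqP => //= ?]; case/eqP: ne; congr (_, _, _); apply: val_inj => //=; lia.
Qed.

Lemma coef_mulX0 (w : bidx n) a : w.1.2 = 0%N :> nat -> coef w (a * X) = 0.
Proof.
move=> e; rewrite (frexpand fr a) mulr_suml frcoef_sum big1 // => u _.
rewrite -scalerAl frcoefZ.
have -> : coef w (b u * X) = 0; last by rewrite mulr0.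
case: u => [[ku cu] [[|iu] lt_iu]]; first by rewrite [b _ * X]wd_X0 frcoef0.
by rewrite [b _ * X]wd_X coef_wd //= e andbF.
Qed.

(** Right multiplication by X maps the word W X^c E_(i+1) to W X^(c+1) E_i and
    kills those with source 0. *)
Lemma mulX_inj a t : a * E t.+2 = a -> a * X * X = 0 -> a = 0.
Proof.
move=> aE aXX; apply: (coef_inj (fr := fr)) => v; rewrite frcoef0.
have [le|lt] := leqP l (tgt v); first by rewrite frcoef_out.
rewrite -aE coef_Er; case: eqP => // e2.
have lt_c : (v.1.2.+2 < l)%N by rewrite /tgt in lt; lia.
have lt_c1 : (v.1.2.+1 < l)%N by lia.
have lt_t : (t < l)%N by rewrite /tgt in lt; lia.
have lt_t1 : (t.+1 < l)%N by rewrite /tgt in lt; lia.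
pose u : bidx n := (v.1.1, Ordinal lt_c1, Ordinal lt_t1).
pose w : bidx n := (v.1.1, Ordinal lt_c, Ordinal lt_t).
by rewrite -(@coef_mulX u v) // -(@coef_mulX w u) // aXX frcoef0.
Qed.

(** The degrees of the generators of P_i, in homological degrees 0, 1 and 2 *)
Definition gens i := nth [::] [:: [:: 0]; [:: 1; n]; [:: n.+2; (2 * n).+1]]%N i.
Local Notation P i := (fb fr (gens i)).

Definition gen_g : P 0 := @fb_gen _ _ _ _ _ fr (gens 0) (@ord0 0).
Definition gen_x : P 1 := @fb_gen _ _ _ _ _ fr (gens 1) (@Ordinal 2 0 isT).
Definition gen_y : P 1 := @fb_gen _ _ _ _ _ fr (gens 1) (@Ordinal 2 1 isT).

Lemma graded_g : graded fr 0 gen_g. Proof. exact: fb_gen_graded. Qed.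
Lemma graded_x : graded fr 1 gen_x. Proof. exact: fb_gen_graded. Qed.
Lemma graded_y : graded fr n gen_y. Proof. exact: fb_gen_graded. Qed.

Lemma graded_inner (M : bimodule L) (g : M) d a :
  graded fr 0 g -> rgraded E d a -> graded fr d (inner g a).
Proof.
move=> gg ga i; rewrite /inner ractDl ractNl lactDr lactNr; congr (_ - _).
  by rewrite lract gg addn0 -!lactM ga.
by rewrite -ractM ga ractM gg addn0 lract.
Qed.

(** Values at the two generators of a free bimodule *)
Definition pick2 (T : Type) (u v : T) (j : nat) : T := if j == 0%N then u else v.

Definition res_d0 : P 1 -> P 0 :=
  fb_lift (s := gens 1) (fun j => pick2 (inner gen_g X) (inner gen_g Y) j).
Definition res_d1 : P 2 -> P 1 :=
  fb_lift (s := gens 2) (fun j => pick2 (der_xxy fr gen_x gen_y) (der_xyy fr gen_x gen_y) j).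
Definition res_aug : P 0 -> regular_bimodule L :=
  fb_lift (s := gens 0) (M := regular_bimodule L) (fun _ => 1 : L).

Lemma res_d0_hom : bim_hom res_d0. Proof. exact: fb_lift_hom. Qed.
Lemma res_d1_hom : bim_hom res_d1. Proof. exact: fb_lift_hom. Qed.
Lemma res_aug_hom : bim_hom res_aug. Proof. exact: fb_lift_hom. Qed.

Definition res_diff i : P i.+1 -> P i :=
  match i with
  | 0 => res_d0
  | 1 => res_d1
  | _ => fun _ => 0
  end.

Lemma res_diff_hom i : bim_hom (@res_diff i).
Proof. by case: i => [|[|i]]; [apply: fb_lift_hom | apply: fb_lift_hom | apply: bim_hom_zero]. Qed.

Lemma res_d0_graded (j : 'I_(size (gens 1))) :
  graded fr (nth 0%N (gens 1) j) (pick2 (inner gen_g X) (inner gen_g Y) j).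
Proof.
case: j => -[|[|//]] ?; apply: graded_inner graded_g _; first exact: gradedX.
exact: gradedY.
Qed.

Lemma res_d1_graded (j : 'I_(size (gens 2))) :
  graded fr (nth 0%N (gens 2) j) (pick2 (der_xxy fr gen_x gen_y) (der_xyy fr gen_x gen_y) j).
Proof. by have [g1 g2] := der_graded graded_x graded_y; case: j => -[|[|//]] ?. Qed.

Lemma res_aug_graded (j : 'I_(size (gens 0))) :
  graded fr (M := regular_bimodule L) (nth 0%N (gens 0) j) (1 : L).
Proof. by case: j => -[|//] ? i; rewrite /= mul1r mulr1 addn0. Qed.

(** The two generators are sent to the derived relations of an inner derivation. *)
Lemma res_d01 x : res_d0 (res_d1 x) = 0.
Proof.
apply: (fb_hom_eq (s := gens 2) (f := fun x => res_d0 (res_d1 x)) (g := fun _ => 0)).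
- by apply: bim_hom_comp; apply: fb_lift_hom.
- exact: bim_hom_zero.
move=> j; rewrite /res_d1 fb_lift_gen; last exact: res_d1_graded.
have [e1 e2] := der_hom fr gen_x gen_y res_d0_hom.
have ex : res_d0 gen_x = inner gen_g X by apply: fb_lift_gen; apply: res_d0_graded.
have ey : res_d0 gen_y = inner gen_g Y by apply: fb_lift_gen; apply: res_d0_graded.
have [i1 i2] := der_inner fr gen_g.
case: j => -[|[|//]] ?; rewrite /pick2 /=.
  by rewrite [LHS]e1 /= ex ey.
by rewrite [LHS]e2 /= ex ey.
Qed.

Definition elt0 a c : P 0 := fb_elt fr (s := gens 0) (@ord0 0) a c.
Definition elt1 (j : 'I_2) a c : P 1 := fb_elt fr (s := gens 1) j a c.

Lemma inner_g_elt a c d :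
  ract (lact a (inner gen_g d)) c = elt0 (a * d) c - elt0 a (d * c).
Proof.
rewrite /inner lactDr lactNr ractDl ractNl -lract -ractM -lactM.
by rewrite /elt0 !fb_elt_gen.
Qed.

Lemma res_d0_elt (j : 'I_2) a c : res_d0 (elt1 j a c) =
  elt0 (a * pick2 X Y j) c - elt0 a (pick2 X Y j * c).
Proof.
rewrite /res_d0 /elt1 fb_lift_elt; last exact: res_d0_graded.
have -> : pick2 (inner gen_g X) (inner gen_g Y) j = inner gen_g (pick2 X Y j).
  by rewrite /pick2; case: eqP.
exact: inner_g_elt.
Qed.

Lemma res_aug_elt a c : res_aug (elt0 a c) = a * c.
Proof.
rewrite /res_aug /elt0 fb_lift_elt; last exact: res_aug_graded.
by rewrite /= mulr1.
Qed.

Lemma fb_decomp0 (f : P 0) : f = \sum_v elt0 (fb_val f (@ord0 0, v)) (b v).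
Proof. by rewrite {1}[f]fb_decomp sum_pair big_ord1. Qed.

Lemma fb_decomp1 (f : P 1) : f = \sum_(j < 2) \sum_v elt1 j (fb_val f (j, v)) (b v).
Proof. by rewrite {1}[f]fb_decomp sum_pair. Qed.

Lemma elt0_suml c I (r : seq I) (F : I -> L) :
  elt0 (\sum_(i <- r) F i) c = \sum_(i <- r) elt0 (F i) c.
Proof.
have lin := fb_elt_linl fr (s := gens 0) (@ord0 0) c.
exact: (big_morph (elt0^~ c) (linD lin) (lin0 lin)).
Qed.

Section Image.
Variables (M N : bimodule L) (f : M -> N) (hf : bim_hom f).
Definition im_of (y : N) := exists x, f x = y.
Lemma im0 : im_of 0. Proof. by exists 0; apply: bim_hom0. Qed.
Lemma im_lin c y z : im_of y -> im_of z -> im_of (c *: y + z).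
Proof. by move=> [u <-] [v <-]; exists (c *: u + v); case: hf => ->. Qed.
Lemma im_add y z : im_of y -> im_of z -> im_of (y + z).
Proof. by move=> yi zi; rewrite -[y]scale1r; apply: im_lin. Qed.
Lemma im_opp y : im_of y -> im_of (- y).
Proof. by move=> [u <-]; exists (- u); apply: bim_homN. Qed.
Lemma im_sum I (r : seq I) (F : I -> N) :
  (forall i, im_of (F i)) -> im_of (\sum_(i <- r) F i).
Proof. by move=> Fi; apply: big_ind => //; [apply: im0 | apply: im_add]. Qed.
Lemma im_lact a y : im_of y -> im_of (lact a y).
Proof. by move=> [u <-]; exists (lact a u); case: hf => _ ->. Qed.
Lemma im_ract a y : im_of y -> im_of (ract y a).
Proof. by move=> [u <-]; exists (ract u a); case: hf => _ _ ->. Qed.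
End Image.

Lemma res_aug_surj (a : regular_bimodule L) : exists x, res_aug x = a.
Proof. by exists (elt0 (a : L) 1); rewrite res_aug_elt mulr1. Qed.

(** Modulo the image of P1 the generator g commutes with X and Y, and it commutes
    with the vertices because its degree is 0; it then commutes with every path. *)
Lemma commute_gen v : im_of res_d0 (elt0 1 (b v) - elt0 (b v) 1).
Proof.
pose S a := im_of res_d0 (elt0 1 a - elt0 a 1).
have h0 := res_d0_hom.
have SE i : S (E i).
  rewrite /S -[X in _ - elt0 X _]mul1r -[i in X in _ - X]addn0.
  have -> : elt0 (1 * E (i + 0)%N) 1 = elt0 1 (E i * 1) by apply: fb_elt_E.
  by rewrite mulr1 subrr; apply: im0 h0.
have SZ (j : 'I_2) a : S a -> S (pick2 X Y j * a).
  move=> Sa; rewrite /S.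
  have -> : elt0 1 (pick2 X Y j * a) - elt0 (pick2 X Y j * a) 1 =
     lact (pick2 X Y j) (elt0 1 a - elt0 a 1) - res_d0 (elt1 j 1 a).
    rewrite res_d0_elt lactDr lactNr /elt0 !fb_elt_lact mulr1 mul1r.
    by rewrite opprB [RHS]addrC addrA subrK.
  by apply: (im_add h0); [apply: im_lact | apply: im_opp => //; exists (elt1 j 1 a)].
have SX a : S a -> S (X * a) := SZ (@Ordinal 2 0 isT) a.
have SY a : S a -> S (Y * a) := SZ (@Ordinal 2 1 isT) a.
have SXn c a : S a -> S (X ^+ c * a).
  by move=> Sa; elim: c => [|c IH]; rewrite ?mul1r // exprS -mulrA; apply: SX.
rewrite -/(S (b v)) /basis_elt -mulrA.
case: v => -[[[|[|[|[|[|//]]]]] ?] c] i; rewrite /head_word /= -?mulrA -?mulrA ?mul1r.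
- exact: (SXn _ _ (SE _)).
- exact: (SY _ (SXn _ _ (SE _))).
- exact: (SX _ (SY _ (SXn _ _ (SE _)))).
- exact: (SY _ (SY _ (SXn _ _ (SE _)))).
- exact: (SY _ (SX _ (SY _ (SXn _ _ (SE _))))).
Qed.

Lemma elt0_0l c : elt0 0 c = 0.
Proof. by have := elt0_suml c [::] (fun i : nat => 0); rewrite !big_nil. Qed.

Lemma res_aug_decomp (x : P 0) : res_aug x = \sum_v fb_val x (@ord0 0, v) * b v.
Proof.
rewrite {1}[x]fb_decomp0 (bim_hom_sum _ _ _ res_aug_hom).
by apply: eq_bigr => v _; rewrite res_aug_elt.
Qed.

(** Modulo the image of P1 an element sum a_w g w is (sum a_w w) g, which is its
    augmentation times g. *)
Lemma res_exact0 (x : P 0) : res_aug x = 0 <-> exists y, res_d0 y = x.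
Proof.
have h0 := res_d0_hom; split=> [x0|[y <-]].
  have : im_of res_d0 (\sum_v lact (fb_val x (@ord0 0, v)) (elt0 1 (b v) - elt0 (b v) 1)).
    by apply: im_sum => // v; apply: im_lact => //; apply: commute_gen.
  congr im_of; rewrite [RHS]fb_decomp0.
  rewrite (eq_bigr (fun v => elt0 (fb_val x (@ord0 0, v)) (b v) -
     elt0 (fb_val x (@ord0 0, v) * b v) 1)); last first.
    by move=> v _; rewrite lactDr lactNr /elt0 !fb_elt_lact mulr1.
  by rewrite sumrB -elt0_suml -res_aug_decomp x0 elt0_0l subr0.
have ha := res_aug_hom.
rewrite [y]fb_decomp1 (bim_hom_sum _ _ _ h0) (bim_hom_sum _ _ _ ha) big1 // => j _.
rewrite (bim_hom_sum _ _ _ h0) (bim_hom_sum _ _ _ ha) big1 // => v _.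
by rewrite res_d0_elt (bim_homB ha) !res_aug_elt mulrA subrr.
Qed.

(** With H(a g c) = a D(c), where D is the universal derivation modulo the image
    of P2, the map id + H d0 takes values in that image: on a g_x c it is
    a (g_x c + X D(c) - D(Xc)). *)
Lemma res_exact1 (x : P 1) : res_d0 x = 0 <-> exists y, res_d1 y = x.
Proof.
split=> [x0|[y <-]]; last exact: res_d01.
have h0 := res_d0_hom; have h1 := res_d1_hom.
pose S := im_of res_d1.
have S1 : S (der_xxy fr gen_x gen_y).
  exists (@fb_gen _ _ _ _ _ fr (gens 2) (@Ordinal 2 0 isT)).
  by rewrite /res_d1 fb_lift_gen //; apply: res_d1_graded.
have S2 : S (der_xyy fr gen_x gen_y).
  exists (@fb_gen _ _ _ _ _ fr (gens 2) (@Ordinal 2 1 isT)).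
  by rewrite /res_d1 fb_lift_gen //; apply: res_d1_graded.
have S0 : S 0 := im0 h1.
have SD c m p : S m -> S p -> S (c *: m + p) := @im_lin _ _ _ h1 c m p.
have Sr a m : S m -> S (ract m a) := @im_ract _ _ _ h1 a m.
have Sl a m : S m -> S (lact a m) := @im_lact _ _ _ h1 a m.
pose D := der_map fr gen_x gen_y.
have DX a : S (ract gen_x a + lact X (D a) - D (X * a)).
  exact: (der_map_X n_ge2 graded_x graded_y S0 SD Sr S1 S2).
have DY a : S (ract gen_y a + lact Y (D a) - D (Y * a)).
  exact: (der_map_Y n_ge2 graded_x graded_y S0 SD).
pose H := @der_fold _ _ _ _ _ fr _ gen_x gen_y.
have H_lin : linear H by move=> c f g; apply: der_fold_linD.
have HD := linD H_lin; have H0 := lin0 H_lin; have HN := linN H_lin.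
have Helt a c : H (elt0 a c) = lact a (D c).
  by apply: der_fold_elt; [apply: graded_x | apply: graded_y].
have key (j : 'I_2) a c : S (elt1 j a c + H (res_d0 (elt1 j a c))).
  rewrite res_d0_elt HD HN !Helt.
  have -> : elt1 j a c = lact a (ract (pick2 gen_x gen_y j) c).
    rewrite /elt1 fb_elt_gen lract; congr (lact a (ract _ c)).
    by case: j => -[|[|//]] ?; congr fb_gen; apply: val_inj.
  rewrite lactM -lactNr -!lactDr; apply: Sl; rewrite addrA.
  by case: j => -[|[|//]] ?; rewrite /pick2 /=; [apply: DX | apply: DY].
have : S (x + H (res_d0 x)).
  rewrite {2}[x]fb_decomp1 (bim_hom_sum _ _ _ h0) (big_morph H HD H0).
  rewrite {1}[x]fb_decomp1 -big_split /=; apply: im_sum => // j.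
  rewrite (bim_hom_sum _ _ _ h0) (big_morph H HD H0) -big_split /=.
  by apply: im_sum => // v; apply: key.
by rewrite x0 H0 addr0.
Qed.

End Resolution.

(** * Injectivity of the last differential *)

Lemma sum_eq1 (V : nmodType) (I : finType) (i : I) (F : I -> V) :
  (forall j, j != i -> F j = 0) -> \sum_j F j = F i.
Proof. by move=> F0; rewrite (bigD1 i) //= big1 ?addr0. Qed.

Section DerFormula.
Variables (k : fieldType) (n : nat) (alpha beta : k) (L : algType k).
Variable fr : frame n alpha beta L.
Local Notation X := (frX fr).
Local Notation Y := (frY fr).
Variable M : bimodule L.

Local Notation sand a m c := (ract (lact a m) c).

Lemma der_xxyE (u v : M) : der_xxy fr u v =
  sand 1 u (X * Y) + sand X u Y + sand (X * X) v 1
  - beta *: (sand 1 v (X * X) + sand Y u X + sand (Y * X) u 1)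
  - alpha *: (sand 1 u (Y * X) + sand X v X + sand (X * Y) u 1).
Proof.
rewrite /der_xxy /rel_xxy !te_mulE /= !ractDl -!ractM !lact1 !ract1.
by [].
Qed.

Lemma der_xyyE (u v : M) : der_xyy fr u v =
  sand 1 u (Y * Y) + sand X v Y + sand (X * Y) v 1
  - beta *: (sand 1 v (Y * X) + sand Y v X + sand (Y * Y) u 1)
  - alpha *: (sand 1 v (X * Y) + sand Y u Y + sand (Y * X) v 1).
Proof.
rewrite /der_xyy /rel_xyy !te_mulE /= !ractDl -!ractM !lact1 !ract1.
by [].
Qed.
End DerFormula.

(** Only the g_y component of the differential is used, at the words X^c E_i. For
    degree reasons the coefficients f(j, v) of an element of P2 vanish unless v is
    such a word with target below n, and v is E_0 for the second relation. *)
Section Injectivity.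
Variables (k : fieldType) (n : nat) (alpha beta : k) (L : algType k).
Variable fr : frame n alpha beta L.
Hypothesis n_ge2 : (2 <= n)%N.
Local Notation E := (frE fr).
Local Notation X := (frX fr).
Local Notation Y := (frY fr).
Local Notation coef := (frcoef fr).
Local Notation l := (beil_size n).
Local Notation b := (@basis_elt n L E X Y).
Local Notation wdL := (wd E X Y).
Local Notation P i := (fb fr (gens n i)).
Local Notation jx := (@Ordinal 2 0 isT).
Local Notation jy := (@Ordinal 2 1 isT).

(** The coefficient of g_y w in an element of P1 *)
Definition ycomp (w : bidx n) (f : P 1) : L := fb_val f (jy, w).

Lemma ycompD w : {morph ycomp w : f g / f + g}.
Proof. by move=> f g; rewrite /ycomp -[f]scale1r fbm_linE !scale1r. Qed.
Lemma ycompZ w c : {morph ycomp w : f / c *: f}.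
Proof.
move=> f; rewrite /ycomp; have := fbm_linE c f 0 (jy, w); rewrite addr0 => ->.
by rewrite [fb_val 0 _]fb_0E addr0.
Qed.
Lemma ycompN w : {morph ycomp w : f / - f}.
Proof. by move=> f; rewrite -scaleN1r ycompZ scaleN1r. Qed.
Lemma ycomp_sum w I (r : seq I) (F : I -> P 1) :
  ycomp w (\sum_(i <- r) F i) = \sum_(i <- r) ycomp w (F i).
Proof.
apply: (big_morph _ (ycompD w)).
by rewrite -(scale0r 0) ycompZ scale0r.
Qed.

Lemma ycomp_elt w (j : 'I_2) a c : ycomp w (elt1 fr j a c) =
  if j == jy then coef w c *: (a * E (tgt w + n)%N) else 0.
Proof. by rewrite /ycomp /elt1 fb_eltE eq_sym; case: eqP => // ->. Qed.

Lemma sand_gen j a c a' c' :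
  ract (lact a (ract (lact a' (@fb_gen _ _ _ _ _ fr (gens n 1) j)) c')) c =
  elt1 fr j (a * a') (c' * c).
Proof. by rewrite -lract -ractM -lactM /elt1 fb_elt_gen. Qed.

Lemma ycomp_xxy w a c :
  ycomp w (ract (lact a (der_xxy fr (gen_x fr) (gen_y fr))) c) =
  (coef w c *: (a * X * X) - beta *: (coef w (X * X * c) *: a)
    - alpha *: (coef w (X * c) *: (a * X))) * E (tgt w + n)%N.
Proof.
rewrite der_xxyE !(lactDr, lactNr, lactZr, ractDl, ractNl, ractZl) !sand_gen.
rewrite !(ycompD, ycompN, ycompZ) !ycomp_elt /= !(add0r, addr0, scaler0, oppr0).
by rewrite !mulr1 mul1r !mulrBl -!scalerAl !mulrA.
Qed.

Lemma ycomp_xyy w a c :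
  ycomp w (ract (lact a (der_xyy fr (gen_x fr) (gen_y fr))) c) =
  (coef w (Y * c) *: (a * X) + coef w c *: (a * X * Y)
    - beta *: (coef w (Y * X * c) *: a + coef w (X * c) *: (a * Y))
    - alpha *: (coef w (X * Y * c) *: a + coef w c *: (a * Y * X)))
   * E (tgt w + n)%N.
Proof.
rewrite der_xyyE !(lactDr, lactNr, lactZr, ractDl, ractNl, ractZl) !sand_gen.
rewrite !(ycompD, ycompN, ycompZ) !ycomp_elt /= !(add0r, addr0, scaler0, oppr0).
by rewrite !mulr1 !mul1r !(mulrBl, mulrDl) -!scalerAl !mulrDl -!scalerAl !mulrA.
Qed.

Lemma ycomp_d1 w (f : P 2) : ycomp w (res_d1 f) =
  \sum_v ycomp w (ract (lact (fb_val f (jx, v)) (der_xxy fr (gen_x fr) (gen_y fr))) (b v)) +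
  \sum_v ycomp w (ract (lact (fb_val f (jy, v)) (der_xyy fr (gen_x fr) (gen_y fr))) (b v)).
Proof.
rewrite /res_d1 /fb_lift sum_pair big_ord_recl big_ord1.
rewrite (_ : ord0 = jx); last exact: val_inj.
rewrite (_ : lift jx _ = jy); last exact: val_inj.
by rewrite ycompD !ycomp_sum.
Qed.

Section Kernel.
Variable f : P 2.
Local Notation f0 v := (fb_val f (jx, v)).
Local Notation f1 v := (fb_val f (jy, v)).

Lemma basis_wd (v : bidx n) : b v = wdL v.1.1 v.1.2 v.2.
Proof. by []. Qed.

Lemma f0E v : f0 v * E (tgt v + n).+2 = f0 v.
Proof. by rewrite -[RHS]fbE /= !addnS. Qed.
Lemma f1E v : f1 v * E (tgt v + (2 * n).+1)%N = f1 v.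
Proof. exact: fbE. Qed.

Lemma f0_out v : (n <= tgt v)%N -> f0 v = 0.
Proof. by move=> le; rewrite -f0E frE_out ?mulr0 // /beil_size; lia. Qed.
Lemma f1_out v : (0 < tgt v)%N -> f1 v = 0.
Proof. by move=> lt; rewrite -f1E frE_out ?mulr0 // /beil_size; lia. Qed.

Lemma word_E2 a t : a * E t.+2 = a -> a * X * X * E t = a * X * X.
Proof. by move=> aE; rewrite -!mulrA !frXE (mulrA X) frXE -mulrA mulrA aE. Qed.

Lemma head_zero (v : bidx n) : (tgt v < n)%N -> v.1.1 = 0%N :> nat.
Proof.
case: v => -[[[|[|[|[|[|//]]]]] ?] c] i; rewrite /tgt /head_deg //=; lia.
Qed.

(** The derived relation x^2 y contributes a X^2 g_y w, a g_y X^2 w and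
    a X g_y X w. The last two involve longer words on the right, so the
    coefficient at w only sees shorter words besides w itself. *)
Lemma ycomp_sum0 (w : bidx n) : w.1.1 = 0%N :> nat ->
    (forall v : bidx n, v.1.1 = 0%N :> nat -> v.2 = w.2 -> (v.1.2 < w.1.2)%N -> f0 v = 0) ->
  \sum_v ycomp w (ract (lact (f0 v) (der_xxy fr (gen_x fr) (gen_y fr))) (b v)) =
  f0 w * X * X.
Proof.
move=> w0 lower; rewrite (sum_eq1 (i := w)) => [|v ne].
  rewrite ycomp_xxy; have [le|lt] := leqP n (tgt w).
    by rewrite f0_out // !mul0r !scaler0 !subr0 mul0r.
  have -> : coef w (X * X * b w) = 0.
    rewrite -mulrA basis_wd w0 !x_wd0 coef_wd // (ltn_eqF (leqnSn _)).
    by rewrite andbF.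
  have -> : coef w (X * b w) = 0.
    by rewrite basis_wd w0 !x_wd0 coef_wd // (ltn_eqF (ltnSn _)) andbF.
  rewrite coef_b eqxx (_ : (tgt w < l)%N) /beil_size; last by lia.
  by rewrite !scale0r scaler0 scaler0 !subr0 scale1r word_E2 // f0E.
have [le|lt] := leqP n (tgt v).
  by rewrite f0_out // lact0l ract0l -(scale0r 0) ycompZ scale0r.
have v0 := head_zero lt.
rewrite ycomp_xxy coef_b eq_sym (negPf ne) scale0r sub0r.
rewrite -[X * X * _]mulrA basis_wd v0 !x_wd0.
have no d : (0 < d)%N -> coef w (wdL 0 (v.1.2 + d) v.2) *: f0 v = 0.
  move=> d0; rewrite coef_wd //; case: and4P => [[_ /eqP e /eqP e' _]|_]; last by rewrite scale0r.
  by rewrite lower ?scaler0 //; [apply: val_inj | rewrite e; lia].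
have no2 := no 2 isT; have no1 := no 1 isT.
rewrite addn2 in no2; rewrite addn1 in no1.
by rewrite no2 scalerAl no1 mul0r !scaler0 !oppr0 addr0 mul0r.
Qed.

Definition v_zero : bidx n := (ord0, @Ordinal l 0 isT, @Ordinal l 0 isT).

Lemma ycomp_sum1 (w : bidx n) : w.1.1 = 0%N :> nat ->
  \sum_v ycomp w (ract (lact (f1 v) (der_xyy fr (gen_x fr) (gen_y fr))) (b v)) =
  (coef w (b v_zero) *: (f1 v_zero * X * Y) - beta *: (coef w (X * b v_zero) *: (f1 v_zero * Y))
    - alpha *: (coef w (b v_zero) *: (f1 v_zero * Y * X))) * E (tgt w + n)%N.
Proof.
move=> w0; rewrite (sum_eq1 (i := v_zero)) => [|v ne]; last first.
  rewrite f1_out; first by rewrite lact0l ract0l -(scale0r 0) ycompZ scale0r.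
  rewrite lt0n; apply: contra ne => /eqP tv.
  have v0 : v.1.1 = 0%N :> nat by apply: head_zero; rewrite tv; lia.
  case: v v0 tv => [[kv cv] iv] /= v0; rewrite /tgt /= v0 => e.
  by apply/eqP; congr (_, _, _); apply: val_inj => //=; lia.
rewrite ycomp_xyy; have e : b v_zero = wdL 0 0 0 by [].
have -> : coef w (Y * b v_zero) = 0 by rewrite e y_wd0 coef_wd // w0.
have -> : coef w (Y * X * b v_zero) = 0 by rewrite e -mulrA x_wd0 y_wd0 coef_wd // w0.
have -> : coef w (X * Y * b v_zero) = 0 by rewrite e -mulrA y_wd0 x_wd1 coef_wd // w0.
by rewrite !scale0r !add0r.
Qed.

Hypothesis f_ker : res_d1 f = 0.

Lemma ycomp_ker w : ycomp w (res_d1 f) = 0.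
Proof. by rewrite f_ker -(scale0r 0) ycompZ scale0r. Qed.

(** At w = E_0 the coefficient is f0 X^2 + mu (XY - alpha YX) with mu a multiple of
    the vertex 2n+1. The path XY does not end with X on the right, so its
    coordinate isolates mu. *)
Lemma f1_zero : f1 v_zero = 0.
Proof.
set mu := f1 v_zero.
have lt_t : ((2 * n).+1 < l)%N by rewrite /beil_size; lia.
pose vt : bidx n := (ord0, @Ordinal l 0 isT, Ordinal lt_t).
have muE : mu = coef vt mu *: E (2 * n).+1.
  rewrite [LHS](frexpand fr) (bigD1 vt) //= big1 ?addr0.
    by rewrite /basis_elt /head_word /= !mul1r.
  move=> v ne; rewrite -/mu -[mu]f1E coef_Er; case: eqP => [e|]; last by rewrite scale0r.
  rewrite (_ : tgt v_zero + _ = (2 * n).+1)%N in e; last by rewrite /tgt /=.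
  have [le|lt] := leqP l (tgt v); first by rewrite basis_out // scaler0.
  case/eqP: ne; case: v e lt => -[kv cv] iv /= e; rewrite /tgt /= e /beil_size => lt.
  case: kv lt => -[|[|[|[|[|//]]]]] ? /=; rewrite /head_deg /= => lt; try lia.
  by congr (_, _, _); apply: val_inj => //=; lia.
suff t0 : coef vt mu = 0 by rewrite muE t0 scale0r.
have := ycomp_ker v_zero; rewrite ycomp_d1 ycomp_sum0 // ycomp_sum1 // -/mu.
have lt_n : (n < l)%N by rewrite /beil_size; lia.
pose z : bidx n := (@Ordinal 5 2 isT, @Ordinal l 0 isT, Ordinal lt_n).
move/(congr1 (coef z)); rewrite frcoef0 frcoefD coef_mulX0 // add0r.
rewrite (_ : tgt v_zero + n = n)%N //.
rewrite coef_b eqxx (_ : (tgt v_zero < l)%N) // !scale1r.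
rewrite (_ : coef v_zero (X * b v_zero) = 0) ?scale0r ?scaler0 ?subr0; last first.
  by rewrite basis_wd x_wd0 coef_wd //= andbF.
have muM a : mu * a = coef vt mu *: (E (2 * n).+1 * a) by rewrite {1}muE -scalerAl.
rewrite mulrBl -!scalerAl -!mulrA !muM.
have -> : X * (Y * E n) = wdL 2 0 n by rewrite /wd /head_word /= mulr1 !mulrA.
have -> : Y * (X * E n) = wdL 1 1 n by rewrite /wd /head_word /= expr1 !mulrA.
have Ewd kap c : (kap < 5)%N -> (n + (c + head_deg n kap) = (2 * n).+1)%N ->
    E (2 * n).+1 * wdL kap c n = wdL kap c n.
  move=> lt_kap e; rewrite (wd_E (gradedX fr) (gradedY fr)) // e mulrA frE_mul eqxx.
  by rewrite -e -(wd_E (gradedX fr) (gradedY fr)).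
rewrite !Ewd //; try by rewrite /head_deg /=; lia.
rewrite -scaleN1r frcoefD !frcoefZ !coef_wd // eqxx.
rewrite (_ : (tgt z < l)%N = true) /=; last by rewrite /tgt /head_deg /beil_size /=; lia.
by rewrite eqxx !mulr0 addr0 mulr1.
Qed.

(** By induction on the power of x in w, only f0(w) X^2 remains in the coefficient
    of g_y w. *)
Lemma f0_zero (w : bidx n) : f0 w = 0.
Proof.
have [le|lt] := leqP n (tgt w); first exact: f0_out.
have := head_zero lt; have [c] := ubnP w.1.2; elim: c w lt => // c IH w lt lt_c w0.
apply: (mulX_inj n_ge2 (f0E w)).
have := ycomp_ker w; rewrite ycomp_d1 ycomp_sum0 // => [|v v0 e2 lt_v].
  by rewrite ycomp_sum1 // f1_zero !mul0r !scaler0 !subr0 mul0r addr0.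
apply: IH => //; last by apply: leq_trans lt_v _.
by move: lt; rewrite /tgt v0 w0 e2; lia.
Qed.

End Kernel.

Lemma res_d1_inj (f : P 2) : res_d1 f = 0 -> f = 0.
Proof.
move=> f_ker; apply: fbP => -[j v]; rewrite [RHS]fb_0E.
case: j => -[|[|//]] lt_j; last first.
  rewrite (_ : Ordinal _ = jy); last exact: val_inj.
  have [e|lt] := posnP (tgt v); last exact: f1_out.
  rewrite (_ : v = v_zero) ?f1_zero //.
  have v0 : v.1.1 = 0%N :> nat by apply: head_zero; rewrite e; lia.
  case: v v0 e => [[kv cv] iv] /= v0; rewrite /tgt /= v0 => e.
  by congr (_, _, _); apply: val_inj => //=; lia.
rewrite (_ : Ordinal _ = jx); last exact: val_inj.
exact: f0_zero.
Qed.

Lemma res_obj_trivial i (x : P i.+3) : x = 0.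
Proof.
apply: fbP => -[j v]; exfalso.
by case: j => m; rewrite /gens nth_default.
Qed.

Definition res : proj_resolution (regular_bimodule L).
Proof.
refine (@ProjResolution k L (regular_bimodule L) (fun i => P i)
  (fun i => @res_diff _ _ _ _ _ fr i) (@res_aug _ _ _ _ _ fr) _ _ _ _ _ _).
- by move=> i; apply: fb_projective.
- exact: res_diff_hom.
- exact: res_aug_hom.
- exact: res_aug_surj.
- exact: res_exact0.
- case=> [|[|i]] x; first exact: res_exact1.
    split=> [/res_d1_inj ->|[y <-]]; first by exists 0.
    exact: (bim_hom0 (res_d1_hom fr)).
  by split=> // _; exists 0; rewrite [x]res_obj_trivial.
Defined.

End Injectivity.

(** * Dimensions of subquotients *)

Section SubquotMap.
Variables (k : fieldType) (V' V : lmodType k).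

Definition lin_closed (U : lmodType k) (S : U -> Prop) :=
  S 0 /\ forall c u v, S u -> S v -> S (c *: u + v).

Lemma lin_closed_sum (U : lmodType k) (S : U -> Prop) d (c : 'I_d -> k) (e : 'I_d -> U) :
  lin_closed S -> (forall j, S (e j)) -> S (\sum_j c j *: e j).
Proof.
move=> [S0 SD] Se; apply: big_ind => // [u v Su Sv|j _].
  by rewrite -[u]scale1r; apply: SD.
by rewrite -[_ *: _]addr0; apply: SD.
Qed.

Variables (Z' B' : V' -> Prop) (Z B : V -> Prop) (phi : V' -> V).
Hypothesis phi_lin : linear phi.
Hypothesis B_closed : lin_closed B.
Hypothesis Zphi : forall v, Z' v -> Z (phi v).
Hypothesis Zgen : forall z, Z z -> exists2 v, Z' v & B (z - phi v).
Hypothesis Bphi : forall v, B' v -> B (phi v).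

Lemma phi_sum d (c : 'I_d -> k) (e : 'I_d -> V') :
  phi (\sum_j c j *: e j) = \sum_j c j *: phi (e j).
Proof.
elim/big_rec2: _ => [|j v u _ <-]; first exact: lin0.
exact: phi_lin.
Qed.

Lemma phiB u v : phi (u - v) = phi u - phi v.
Proof. by rewrite addrC -scaleN1r phi_lin scaleN1r addrC. Qed.

(** The hypotheses make phi an isomorphism from Z'/B' to Z/B, along which a basis
    is carried; the next lemma carries it back. *)
Lemma subquot_dim_map d : lin_closed Z' ->
  (forall v, Z' v -> B (phi v) -> B' v) ->
  subquot_dim Z' B' d -> subquot_dim Z B d.
Proof.
move=> Z'_closed phi_inj [e [eZ eg ei]]; exists (fun j => phi (e j)); split.
- by move=> j; apply: Zphi.
- move=> z /Zgen[v Zv Bv]; have [c Bc] := eg v Zv; exists c.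
  rewrite -phi_sum; have -> : z - phi (\sum_j c j *: e j) =
     1 *: (z - phi v) + phi (v - \sum_j c j *: e j).
    by rewrite scale1r phiB addrA subrK.
  by case: B_closed => _; apply; [|apply: Bphi].
- move=> c; rewrite -phi_sum => Bc; apply: ei; apply: phi_inj Bc.
  exact: lin_closed_sum.
Qed.

Lemma subquot_dim_pull d : (forall v, Z' v -> B (phi v) -> B' v) -> lin_closed Z' ->
  subquot_dim Z B d -> subquot_dim Z' B' d.
Proof.
move=> phi_inj Z'_closed [e [eZ eg ei]].
have /choice[f fP] j : exists v, Z' v /\ B (e j - phi v).
  by have [v ? ?] := Zgen (eZ j); exists v.
have Bsum (c : 'I_d -> k) : B (\sum_j c j *: e j - \sum_j c j *: phi (f j)).
  rewrite -sumrB (eq_bigr (fun j => c j *: (e j - phi (f j)))).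
    by apply: lin_closed_sum => // j; case: (fP j).
  by move=> j _; rewrite scalerBr.
exists f; split=> [j|v Zv|c Bc]; first by case: (fP j).
  have [c Bc] := eg _ (Zphi Zv); exists c; apply: phi_inj.
    have := lin_closed_sum c Z'_closed (fun j => proj1 (fP j)).
    by case: Z'_closed => _ Z'D Ss; have := Z'D (-1) _ _ Ss Zv; rewrite scaleN1r addrC.
  rewrite phiB phi_sum.
  have -> : phi v - \sum_j c j *: phi (f j) = 1 *: (phi v - \sum_j c j *: e j) +
      (\sum_j c j *: e j - \sum_j c j *: phi (f j)).
    by rewrite scale1r addrA subrK.
  by case: B_closed => _; apply.
apply: ei; case: B_closed => _ BD.
have := BD 1 _ _ (Bsum c) (Bphi Bc); rewrite phi_sum scale1r subrK; exact.
Qed.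

End SubquotMap.

Section RowSpaces.
Variables (k : fieldType) (c : nat).
Implicit Types A B : 'M[k]_c.

Lemma mxsub_closed m (A : 'M[k]_(m, c)) : lin_closed (fun v : 'rV[k]_c => (v <= A)%MS).
Proof.
split=> [|a u v]; first exact: sub0mx.
by move=> uA vA; rewrite addmx_sub // scalemx_sub.
Qed.

(** In a space of row vectors dimensions are ranks, which makes the dimension of a
    subquotient unique and computable. *)
Lemma subquot_dim_mx m m' (A : 'M[k]_(m, c)) (B : 'M[k]_(m', c)) d : (B <= A)%MS ->
  subquot_dim (fun v : 'rV[k]_c => (v <= A)%MS : Prop) (fun v => (v <= B)%MS : Prop) d <->
  d = (\rank A - \rank B)%N.
Proof.
move=> sBA; split=> [[e [eA eg ei]]|->].
  pose M := \matrix_j e j.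
  have sumE (u : 'rV_d) : \sum_j u 0 j *: e j = u *m M.
    by rewrite mulmx_sum_row; apply: eq_bigr => j _; rewrite rowK.
  have sMA : (M <= A)%MS by apply/row_subP => j; rewrite rowK.
  have indep (u : 'rV_d) : (u *m M <= B)%MS -> u = 0.
    by rewrite -sumE => /ei u0; apply/rowP => j; rewrite u0 mxE.
  have eqA : (A :=: M + B)%MS.
    apply/eqmxP; rewrite addsmx_sub sMA sBA !andbT; apply/row_subP => i.
    have [a] := eg _ (row_sub i A); set s := \sum_j _ => sB.
    rewrite -[row i A](subrK s) addmx_sub //; last first.
      apply: submx_trans (addsmxSl _ _).
      have -> : s = (\row_j a j) *m M by rewrite -sumE; apply: eq_bigr => j _; rewrite mxE.
      exact: submxMl.
    exact: submx_trans sB (addsmxSr _ _).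
  have Mfree : \rank M = d.
    apply/eqP; rewrite -/(row_free M) -kermx_eq0; apply/rowV0P => u /sub_kermxP uM.
    by apply: indep; rewrite uM sub0mx.
  have cap0 : \rank (M :&: B)%MS = 0%N.
    apply/eqP; rewrite mxrank_eq0; apply/rowV0P => v; rewrite sub_capmx.
    by case/andP=> /submxP[u ->] /indep ->; rewrite mul0mx.
  have := mxrank_sum_cap M B; rewrite cap0 addn0 Mfree -eqA => ->.
  by rewrite addnK.
pose D := (A :\: B)%MS.
have rD : \rank D = (\rank A - \rank B)%N.
  by rewrite -(mxrank_cap_compl A B) (capmx_idPr sBA) addKn.
have capDB : (D :&: B)%MS = 0 by apply: capmx_diff.
have sDA : (D <= A)%MS by apply: diffmxSl.
rewrite -rD; exists (fun j => row j (row_base D)); split.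
- by move=> j; rewrite (submx_trans (row_sub _ _)) // eq_row_base.
- move=> v vA; have : (v <= D + B)%MS.
    apply: submx_trans vA _; rewrite -(addsmx_diff_cap_eq A B).
    by rewrite addsmxS // capmxSr.
  case/sub_addsmxP => -[u1 u2] /= vE.
  have /submxP[w wE] : (u1 *m D <= row_base D)%MS by rewrite eq_row_base submxMl.
  exists (fun j => w 0 j); rewrite -mulmx_sum_row -wE vE addrC addKr submxMl.
  by [].
- move=> a; have -> : \sum_j a j *: row j (row_base D) = (\row_j a j) *m row_base D.
    by rewrite mulmx_sum_row; apply: eq_bigr => j _; rewrite mxE.
  move=> aB j; suff /rowP/(_ j) : \row_j a j = 0 by rewrite !mxE.
  have : (\row_j a j) *m row_base D = 0.
    apply/eqP; rewrite -submx0 -capDB sub_capmx aB andbT.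
    by rewrite -(eq_row_base D) submxMl.
  by move/eqP; rewrite mulmx_free_eq0 ?row_base_free // => /eqP.
Qed.

End RowSpaces.

Section EulerCharacteristic.
Variables (k : fieldType) (V0 V1 V2 : lmodType k).
Variables (C0 : V0 -> Prop) (C1 : V1 -> Prop) (C2 : V2 -> Prop).
Variables (d0 : V0 -> V1) (d1 : V1 -> V2).
Hypothesis C0_closed : lin_closed C0.
Hypothesis C1_closed : lin_closed C1.
Hypothesis C2_closed : lin_closed C2.
Hypothesis d0_lin : linear d0.
Hypothesis d1_lin : linear d1.
Hypothesis d0C : forall v, C0 v -> C1 (d0 v).
Hypothesis d1C : forall v, C1 v -> C2 (d1 v).
Hypothesis d10 : forall v, C0 v -> d1 (d0 v) = 0.

Definition comb (V : lmodType k) c (e : 'I_c -> V) (u : 'rV[k]_c) : V :=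
  \sum_j u 0 j *: e j.

Lemma comb_lin (V : lmodType k) c (e : 'I_c -> V) : linear (comb e).
Proof.
move=> a u v; rewrite /comb scaler_sumr -big_split; apply: eq_bigr => j _ /=.
by rewrite !mxE scalerDl scalerA.
Qed.

Lemma zero_closed (V : lmodType k) : lin_closed (fun v : V => v = 0).
Proof. by split=> // a u v -> ->; rewrite scaler0 addr0. Qed.

Lemma linear_comb (V W : lmodType k) c (e : 'I_c -> V) (d : V -> W) u :
  linear d -> d (comb e u) = comb (fun j => d (e j)) u.
Proof. by move=> d_lin; rewrite /comb (phi_sum d_lin). Qed.

Lemma comb_mul (V : lmodType k) c c' (e : 'I_c -> V) (M : 'M[k]_(c', c)) u :
  comb (fun j => comb e (row j M)) u = comb e (u *m M).
Proof.
by rewrite mulmx_sum_row (phi_sum (comb_lin e)).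
Qed.

Lemma mx_of_linear (V W : lmodType k) (C : V -> Prop) (D : W -> Prop) c c'
    (e : 'I_c -> V) (e' : 'I_c' -> W) (d : V -> W) :
    linear d -> (forall v, C v -> D (d v)) -> (forall j, C (e j)) ->
    (forall w, D w -> exists u, w = comb e' u) ->
  exists M : 'M[k]_(c, c'), forall u, d (comb e u) = comb e' (u *m M).
Proof.
move=> d_lin dC eC De.
have /choice[r rE] j : exists u, d (e j) = comb e' u by apply: De; apply: dC.
exists (\matrix_j r j) => u; rewrite linear_comb // -comb_mul.
by apply: eq_bigr => j _; rewrite rowK rE.
Qed.

Lemma basis_of_dim (V : lmodType k) (C : V -> Prop) c :
  subquot_dim C (fun v => v = 0) c -> exists e : 'I_c -> V,
    [/\ forall j, C (e j), forall w, C w -> exists u, w = comb e u &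
        forall u, comb e u = 0 -> u = 0].
Proof.
move=> [e [eC eg ei]]; exists e; split=> // [w /eg[a /eqP]|u u0].
  rewrite subr_eq0 => /eqP ->; exists (\row_j a j).
  by apply: eq_bigr => j _; rewrite mxE.
by apply/rowP => j; rewrite (ei (fun j => u 0 j) u0) mxE.
Qed.

(** Coordinates turn a complex of length 2 into two matrices D0 and D1, with
    h0 = c0 - rank D0 and h1 = c1 - rank D1 - rank D0, from which the
    corank of D1 follows. *)
Lemma subquot_dim_euler c0 c1 c2 h0 h1 :
    subquot_dim C0 (fun v => v = 0) c0 -> subquot_dim C1 (fun v => v = 0) c1 ->
    subquot_dim C2 (fun v => v = 0) c2 ->
    subquot_dim (fun v => C0 v /\ d0 v = 0) (fun v => v = 0) h0 ->
    subquot_dim (fun v => C1 v /\ d1 v = 0) (fun v => exists2 w, C0 w & v = d0 w) h1 ->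
  subquot_dim C2 (fun v => exists2 w, C1 w & v = d1 w) (c2 + c0 + h1 - (c1 + h0)).
Proof.
move=> /basis_of_dim[e0 [e0C e0g e0i]] /basis_of_dim[e1 [e1C e1g e1i]].
move=> /basis_of_dim[e2 [e2C e2g e2i]] H0 H1.
have [D0 D0E] := mx_of_linear d0_lin d0C e0C e1g.
have [D1 D1E] := mx_of_linear d1_lin d1C e1C e2g.
have combC (V : lmodType k) (C : V -> Prop) c (e : 'I_c -> V) u :
    lin_closed C -> (forall j, C (e j)) -> C (comb e u).
  by move=> CC eC; apply: lin_closed_sum.
have D01 : D0 *m D1 = 0.
  apply/row_matrixP => i; rewrite row0 row_mul; apply: e2i.
  rewrite -D1E rowE -D0E; apply: d10; exact: combC.
have sD : (D0 <= kermx D1)%MS by apply/sub_kermxP.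
have im_closed (V W : lmodType k) (C : V -> Prop) (d : V -> W) :
    lin_closed C -> linear d -> lin_closed (fun v => exists2 w, C w & v = d w).
  move=> [CC0 CD] d_lin; split.
    by exists 0; rewrite ?lin0.
  by move=> a u v [u' Cu ->] [v' Cv ->]; exists (a *: u' + v'); [apply: CD | rewrite d_lin].
have h0E : h0 = (c0 - \rank D0)%N.
  rewrite -mxrank_ker -[RHS]subn0 -(@mxrank0 k c0 c0).
  apply/(subquot_dim_mx _ (sub0mx _ _)).
  apply: (subquot_dim_pull (comb_lin e0) (zero_closed V0) _ _ _ _ (mxsub_closed _) H0).
  - move=> u /sub_kermxP uD; split; first exact: combC.
    by rewrite D0E uD /comb big1 // => j _; rewrite mxE scale0r.
  - move=> v [/e0g[u ->] du]; exists u; last by rewrite subrr.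
    by apply/sub_kermxP; apply: e1i; rewrite -D0E.
  - by move=> u; rewrite submx0 => /eqP ->; rewrite /comb big1 // => j _; rewrite mxE scale0r.
  - by move=> u _ /e0i ->; apply: sub0mx.
have h1E : h1 = (c1 - \rank D1 - \rank D0)%N.
  rewrite -mxrank_ker; apply/(subquot_dim_mx _ sD).
  apply: (subquot_dim_pull (comb_lin e1) (im_closed _ _ _ _ C0_closed d0_lin) _ _ _ _ (mxsub_closed _) H1).
  - move=> u /sub_kermxP uD; split; first exact: combC.
    by rewrite D1E uD /comb big1 // => j _; rewrite mxE scale0r.
  - move=> v [/e1g[u ->] du]; exists u.
      by apply/sub_kermxP; apply: e2i; rewrite -D1E.
    by rewrite subrr; exists 0; [case: C0_closed | rewrite lin0].
  - move=> u /submxP[w ->]; rewrite -D0E; exists (comb e0 w) => //; exact: combC.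
  - move=> u _ [w /e0g[r ->]]; rewrite D0E => /eqP; rewrite -subr_eq0 => /eqP.
    by rewrite -(phiB (comb_lin e1)) => /e1i/eqP; rewrite subr_eq0 => /eqP ->; rewrite submxMl.
have -> : (c2 + c0 + h1 - (c1 + h0) = \rank (1%:M : 'M[k]_c2) - \rank D1)%N.
  have r0 := rank_leq_row D0; have r1 := rank_leq_row D1; have r2 := rank_leq_col D1.
  have := mxrankS sD; rewrite mxrank_ker mxrank1 h0E h1E; lia.
apply: (subquot_dim_map (comb_lin e2) (im_closed _ _ _ _ C1_closed d1_lin) _ _ _ (mxsub_closed _)); last first.
- exact/(subquot_dim_mx _ (submx1 D1)).
- move=> u _ [w /e1g[r ->]]; rewrite D1E => /eqP; rewrite -subr_eq0 => /eqP.
  by rewrite -(phiB (comb_lin e2)) => /e2i/eqP; rewrite subr_eq0 => /eqP ->; rewrite submxMl.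
- by move=> u /submxP[w ->]; rewrite -D1E; exists (comb e1 w) => //; apply: combC.
- move=> v /e2g[u ->]; exists u; first exact: submx1.
  rewrite subrr; exists 0; first by case: C1_closed.
  by rewrite lin0.
- by move=> u _; apply: combC.
Qed.

End EulerCharacteristic.

(** * Counting cochains *)

Lemma subquot_dim_fin (k : fieldType) (V : lmodType k) (Z B : V -> Prop)
    (I : finType) (A : pred I) (e : I -> V) :
    (forall i, A i -> Z (e i)) ->
    (forall z, Z z -> exists c : I -> k, B (z - \sum_(i | A i) c i *: e i)) ->
    (forall c : I -> k, B (\sum_(i | A i) c i *: e i) -> forall i, A i -> c i = 0) ->
  subquot_dim Z B #|A|.
Proof.
move=> eZ eg ei; exists (fun j => e (enum_val j)); split=> [j|z Zz|c Bc j].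
- by apply: eZ; apply: (enum_valP j).
- have [c Bc] := eg z Zz; exists (fun j => c (enum_val j)).
  by rewrite -(big_enum_val (fun i => c i *: e i)).
have Aj := enum_valP j.
pose c' i := if i \in A =P true is ReflectT Ai then c (enum_rank_in Aj i) else 0.
have c'E i : c' (enum_val i) = c i.
  rewrite /c'; case: eqP => [_|]; first by rewrite enum_valK_in.
  by rewrite enum_valP.
rewrite -c'E; apply: (ei c') => //; rewrite (big_enum_val (fun i => c' i *: e i)).
by under eq_bigr => i _ do rewrite c'E.
Qed.

Section HomDim.
Variables (k : fieldType) (n : nat) (alpha beta : k) (L : algType k).
Variable fr : frame n alpha beta L.
Local Notation E := (frE fr).
Local Notation coef := (frcoef fr).
Local Notation l := (beil_size n).
Local Notation b := (@basis_elt n L E (frX fr) (frY fr)).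
Local Notation reg := (regular_bimodule L).

(** The paths of degree d that do not leave the range of vertices: a basis of the
    graded elements of degree d. *)
Definition jump (d : nat) : pred (bidx n) := fun v => (tgt v == v.2 + d :> nat)%N && (tgt v < l)%N.

Lemma graded_coef d (m : reg) v : graded fr d m -> ~~ jump d v -> coef v m = 0.
Proof.
move=> gm nj; have [le|lt] := leqP l (tgt v); first exact: frcoef_out.
move: nj; rewrite /jump lt andbT => ne.
have -> : coef v m = coef v ((m : L) * E v.2) by rewrite coef_Er eqxx.
by have /= -> := gm v.2; rewrite coef_El eq_sym (negPf ne).
Qed.

Lemma graded_basis d v : jump d v -> graded fr d (b v : reg).
Proof.
move=> /andP[/eqP tv _] i /=; rewrite basis_Er basis_El tv eqn_add2r eq_sym.
by case: eqP => // ->.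
Qed.

Lemma graded_decomp d (m : reg) : graded fr d m ->
  m = \sum_(v | jump d v) coef v m *: (b v : reg).
Proof.
move=> gm; rewrite {1}(frexpand fr m) (bigID (jump d)) /= [X in _ + X]big1 ?addr0 //.
by move=> v nj; rewrite (graded_coef gm nj) scale0r.
Qed.

Lemma graded0 (M : bimodule L) d : graded fr d (0 : M).
Proof. by move=> i; rewrite ract0l lact0r. Qed.

Section Dim.
Variable s : seq nat.
Local Notation gidx := ('I_(size s) * bidx n)%type.
Local Notation gen j := (@fb_gen _ _ _ _ _ fr s j).
Definition hom_idx : pred gidx := fun p => jump (nth 0%N s p.1) p.2.

(** A map out of a free bimodule is a choice, for each generator, of an element of
    the same degree. *)
Lemma fb_hom_dim : subquot_dim (fun f : fb fr s -> reg => bim_hom f)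
  (fun f => f = 0) #|hom_idx|.
Proof.
pose m (p : gidx) (j : 'I_(size s)) : reg :=
  if (j == p.1) && hom_idx p then b p.2 else 0.
have gm p (j : 'I_(size s)) : graded fr (nth 0%N s j) (m p j).
  rewrite /m; case: andP => [[/eqP -> ok]|_]; last exact: graded0.
  exact: graded_basis.
pose e p : fb fr s -> reg := fb_lift (m p).
have e_gen p j : e p (gen j) = m p j by apply: fb_lift_gen.
have sum_gen (c : gidx -> k) j : (\sum_(p | hom_idx p) c p *: e p) (gen j) =
    \sum_(v | jump (nth 0%N s j) v) c (j, v) *: (b v : reg).
  rewrite fct_sumE big_mkcond sum_pair (sum_eq1 (i := j)) => [|i ne].
    rewrite [RHS]big_mkcond; apply: eq_bigr => v _; rewrite /hom_idx /=.
    case: ifP => // ok; have -> : (c (j, v) *: e (j, v)) (gen j) = c (j, v) *: e (j, v) (gen j) by [].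
    by rewrite e_gen /m eqxx /hom_idx /= ok.
  apply: big1 => v _; case: ifP => // ok.
  have -> : (c (i, v) *: e (i, v)) (gen j) = c (i, v) *: e (i, v) (gen j) by [].
  by rewrite e_gen /m /= eq_sym (negPf ne) scaler0.
apply: (@subquot_dim_fin _ _ _ _ _ _ e) => [p _|f hf|c c0 [j v] ok].
- exact: fb_lift_hom.
- exists (fun p => coef p.2 (f (gen p.1))).
  apply/eqP; rewrite subr_eq0; apply/eqP; apply: funext.
  apply: fb_hom_eq => //.
    apply: (big_ind (fun g : fb fr s -> reg => bim_hom g)) => [|g h hg hh|p _].
    + exact: bim_hom_zero.
    + by have := bim_hom_linD 1 hg hh; congr bim_hom; apply: funext => x; rewrite scale1r.
    + have := bim_hom_linD (coef p.2 (f (gen p.1))) (fb_lift_hom fr (m p)) (bim_hom_zero _ _).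
      by congr bim_hom; apply: funext => x; rewrite addr0.
  by move=> j; rewrite sum_gen {1}(graded_decomp (graded_hom hf (fb_gen_graded fr j))).
- have := sum_gen c j; rewrite c0 => /esym/(congr1 (coef v)).
  rewrite frcoef0 frcoef_sum (bigD1 v) //= frcoefZ coef_b eqxx.
  have /andP[_ ->] := ok; rewrite mulr1 big1 ?addr0 // => w /andP[_ ne].
  by rewrite frcoefZ coef_b eq_sym (negPf ne) mulr0.
Qed.

End Dim.

Lemma sum_lt_ord m d : (\sum_(i < m) (i + d < m) = m - d)%N.
Proof.
elim: m d => [|m IH] d; first by rewrite big_ord0.
case: d => [|d].
  rewrite (eq_bigr (fun _ => 1%N)) ?sum_nat_const ?card_ord ?muln1 ?subn0 // => i _.
  by rewrite addn0 ltn_ord.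
by rewrite big_ord_recr /= subSS -IH (_ : (m + d.+1 < m.+1)%N = false) ?addn0;
  [apply: eq_bigr => i _; rewrite addnS ltnS | lia].
Qed.

Lemma sum_eq_ord m e d : (d < m)%N -> (\sum_(c < m) (c + e == d) = (e <= d))%N.
Proof.
move=> lt_d; case: leqP => [le|lt].
  have lt_c : (d - e < m)%N by lia.
  rewrite (bigD1 (Ordinal lt_c)) //= subnK // eqxx big1 // => c ne.
  by apply/eqP; rewrite eqb0; apply: contra ne => /eqP e'; apply/eqP/val_inj => /=; lia.
by rewrite big1 // => c _; apply/eqP; rewrite eqb0; apply/eqP; lia.
Qed.

(** The number of paths of degree d, for d in range: one for each head of degree
    at most d and each source that leaves room for it *)
Definition jump_count d : nat := \sum_(kap < 5) (head_deg n kap <= d) * (l - d).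

Lemma jump_sum d : (d < l)%N -> (\sum_v (jump d v : nat) = jump_count d)%N.
Proof.
move=> lt_d; rewrite !sum_pair; apply: eq_bigr => kap _.
rewrite -(sum_eq_ord _ lt_d) big_distrl /=; apply: eq_bigr => c _.
rewrite -sum_lt_ord big_distrr /=; apply: eq_bigr => i _.
rewrite /jump /tgt /= eqn_add2l; case: eqP => [->|_]; first by rewrite mul1n.
by rewrite mul0n.
Qed.

Lemma hom_idx_card s : all (fun d => d < l)%N s ->
  #|hom_idx (s := s)| = (\sum_(d <- s) jump_count d)%N.
Proof.
move=> /allP lt_s; rewrite -sum1_card big_mkcond sum_pair [RHS](big_nth 0%N) big_mkord.
apply: eq_bigr => j _; rewrite -jump_sum; last by apply: lt_s; rewrite mem_nth.
by apply: eq_bigr => v _; rewrite unfold_in /= /hom_idx /=; case: (jump _ _).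
Qed.

End HomDim.

(** * The recurrence and the values of a derivation *)

Section Recurrence.
Variables (k : fieldType) (alpha beta : k).

(** The pair (u_m, u_(m+1)), for the solution of u_(m+2) = alpha u_(m+1) + beta u_m
    with u_0 = d0 and u_1 = d1 *)
Fixpoint lucas2 (d0 d1 : k) (m : nat) : k * k :=
  if m is m'.+1 then let: (u, v) := lucas2 d0 d1 m' in (v, alpha * v + beta * u)
  else (d0, d1).
Definition lucas d0 d1 m := (lucas2 d0 d1 m).1.

Lemma lucasSS d0 d1 m :
  lucas d0 d1 m.+2 = alpha * lucas d0 d1 m.+1 + beta * lucas d0 d1 m.
Proof. by rewrite /lucas /=; case: (lucas2 d0 d1 m) => u v. Qed.

Lemma rec2_ind (P : nat -> Prop) : P 0%N -> P 1%N ->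
  (forall m, P m -> P m.+1 -> P m.+2) -> forall m, P m.
Proof.
move=> P0 P1 PS m; suff: P m /\ P m.+1 by case.
by elim: m => [|m [? ?]]; split=> //; apply: PS.
Qed.

Lemma lucas_lin d0 d1 m :
  lucas d0 d1 m.+1 = d1 * lucas 0 1 m.+1 + d0 * (beta * lucas 0 1 m).
Proof.
elim/rec2_ind: m => [||m IH IH'].
- by rewrite /lucas /= mulr1 !mulr0 addr0.
- rewrite /lucas /=; ring.
- rewrite (lucasSS d0) IH IH' !lucasSS; ring.
Qed.

Lemma du_deltaE m : du_delta alpha beta m = lucas 0 1 m.+1.
Proof.
rewrite /du_delta; set u := matrix_of_fun _ _; set T := matrix_of_fun _ _.
have uT : u *m T ^+ m = \row_j (if j == 0 then lucas 0 1 m.+1 else lucas 0 1 m).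
  elim: m => [|m IH].
    rewrite expr0 mulmx1; apply/rowP => j; rewrite !mxE.
    by case: j => -[|[|//]].
  rewrite exprSr -mulmxE mulmxA IH; apply/rowP => j; rewrite !mxE.
  rewrite big_ord_recl big_ord1 !mxE /=.
  case: j => -[|[|//]] ? /=; first by rewrite lucasSS; ring.
  by rewrite mulr1 mulr0 addr0.
rewrite uT !mxE big_ord_recl big_ord1 !mxE /=; ring.
Qed.

End Recurrence.

(** Keeping a combination of four fixed vectors locked lets the many terms of a
    derived relation be collected, and reduces the comparison of two combinations
    to ring identities between coefficients. *)
Section Lin4.
Variables (k : fieldType) (V : lmodType k) (A B C D : V).
Definition lin4 (p q r s : k) : V := locked (p *: A + q *: B + r *: C + s *: D).

Lemma lin4D p q r s p' q' r' s' :
  lin4 p q r s + lin4 p' q' r' s' = lin4 (p + p') (q + q') (r + r') (s + s').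
Proof.
rewrite /lin4 -!lock !scalerDl addrACA; congr (_ + _).
by rewrite addrACA; congr (_ + _); rewrite addrACA.
Qed.
Lemma lin4Z c p q r s : c *: lin4 p q r s = lin4 (c * p) (c * q) (c * r) (c * s).
Proof. by rewrite /lin4 -!lock !scalerDr !scalerA. Qed.
Lemma lin4N p q r s : - lin4 p q r s = lin4 (- p) (- q) (- r) (- s).
Proof. by rewrite /lin4 -!lock !opprD !scaleNr. Qed.
Lemma lin4_1 : A = lin4 1 0 0 0. Proof. by rewrite /lin4 -!lock scale1r !scale0r !addr0. Qed.
Lemma lin4_2 : B = lin4 0 1 0 0. Proof. by rewrite /lin4 -!lock scale1r !scale0r !addr0 add0r. Qed.
Lemma lin4_3 : C = lin4 0 0 1 0. Proof. by rewrite /lin4 -!lock scale1r !scale0r !addr0 !add0r. Qed.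
Lemma lin4_4 : D = lin4 0 0 0 1. Proof. by rewrite /lin4 -!lock scale1r !scale0r !add0r. Qed.
End Lin4.

Section CochainFormulas.
Variables (k : fieldType) (n : nat) (alpha beta : k) (L : algType k).
Variable fr : frame n alpha beta L.
Hypothesis n_ge2 : (2 <= n)%N.
Local Notation E := (frE fr).
Local Notation X := (frX fr).
Local Notation Y := (frY fr).
Local Notation wdL := (wd E X Y).
Local Notation reg := (regular_bimodule L).
Local Notation p := (lucas alpha beta 0 1).

Lemma XXY : X * X * Y = beta *: (Y * X * X) + alpha *: (X * Y * X).
Proof. by have := frxxy fr; rewrite !expr2 !mulrA. Qed.
Lemma XYY : X * Y * Y = beta *: (Y * Y * X) + alpha *: (Y * X * Y).
Proof. by have := frxyy fr; rewrite !expr2 !mulrA. Qed.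

(** Pushing Y to the left through powers of X follows the recurrence. *)
Lemma expX_Y m : X ^+ m.+1 * Y = p m.+1 *: (X * Y * X ^+ m) + (beta * p m) *: (Y * X ^+ m.+1).
Proof.
elim: m => [|m IH]; first by rewrite /lucas /= expr1 mulr1 mulr0 scale1r scale0r addr0.
rewrite exprS -mulrA IH mulrDr -!scalerAr lucasSS.
have -> : X * (X * Y * X ^+ m) = beta *: (Y * X ^+ m.+2) + alpha *: (X * Y * X ^+ m.+1).
  by rewrite !exprS !mulrA XXY mulrDl -!scalerAl.
have -> : X * (Y * X ^+ m.+1) = X * Y * X ^+ m.+1 by rewrite mulrA.
rewrite scalerDr !scalerA -[LHS]addrA [LHS]addrC -scalerDl; congr (_ *: _ + _ *: _); ring.
Qed.

Section Values.
Variables (mx my : reg) (a b c : nat -> k).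
Hypothesis mxE : forall i, (mx : L) * E i = a i *: (X * E i).
Hypothesis myE : forall i, (my : L) * E i = b i *: (Y * E i) + c i *: (X ^+ n * E i).

Lemma gradedE_id e (w : L) i : rgraded E e w -> w * E i = E (i + e)%N * (w * E i).
Proof. by move=> gw; rewrite gw mulrA frE_mul eqxx. Qed.

Lemma sand_mx e (q w : L) i : rgraded E e w ->
  q * (mx : L) * w * E i = a (i + e)%N *: (q * X * w * E i).
Proof.
move=> gw; rewrite -mulrA (gradedE_id i gw) -mulrA (mulrA (mx : L)) mxE.
by rewrite -scalerAl -scalerAr -[X * _ * _]mulrA -gradedE_id // !mulrA.
Qed.

Lemma sand_my e (q w : L) i : rgraded E e w ->
  q * (my : L) * w * E i =
  b (i + e)%N *: (q * Y * w * E i) + c (i + e)%N *: (q * X ^+ n * w * E i).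
Proof.
move=> gw; rewrite -mulrA (gradedE_id i gw) -mulrA (mulrA (my : L)) myE.
rewrite mulrDl mulrDr -!scalerAl -!scalerAr -[Y * _ * _]mulrA -[X ^+ n * _ * _]mulrA.
by rewrite -gradedE_id // !mulrA.
Qed.

Lemma rgraded1 : rgraded E 0 1.
Proof. by move=> i; rewrite mul1r mulr1 addn0. Qed.

(** How far scaling X by a and Y by b is from commuting with the relations: the
    difference of the weights of XY and YX at vertex i *)
Definition com_defect i := a (i + n)%N + b i - b i.+1 - a i.

(** The words of degree n+2 that occur are YX^2, XYX and X^(n+2). *)
Lemma der_xxy_value i : (der_xxy fr mx my : L) * E i =
  lin4 (wdL 1 2 i) (wdL 2 1 i) (wdL 0 n.+2 i) 0
    (beta * (com_defect i + com_defect i.+1)) (alpha * com_defect i)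
    (c i - beta * c i.+2 - alpha * c i.+1) 0.
Proof.
have gX := gradedX fr; have gY := gradedY fr.
rewrite der_xxyE /= !mulrBl -!scalerAl !mulrDl.
rewrite !(sand_mx _ _ (rgradedM gX gY)) !(sand_mx _ _ gX) !(sand_mx _ _ gY)
  !(sand_mx _ _ (rgradedM gY gX)) !(sand_mx _ _ rgraded1).
rewrite !(sand_my _ _ (rgradedM gX gX)) !(sand_my _ _ gX) !(sand_my _ _ rgraded1).
rewrite !mul1r !mulr1 !mulrA.
set lin := lin4 _ _ _ _.
have eA : Y * X * X * E i = lin 1 0 0 0 by rewrite /lin -lin4_1 /wd /head_word /= !mulrA.
have eB : X * Y * X * E i = lin 0 1 0 0 by rewrite /lin -lin4_2 /wd /head_word /= expr1.
have eC : X ^+ n.+2 * E i = lin 0 0 1 0 by rewrite /lin -lin4_3 /wd /head_word /= mul1r.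
have eXXY : X * X * Y * E i = lin beta alpha 0 0.
  by rewrite XXY mulrDl -!scalerAl eA eB !lin4Z lin4D; congr lin; ring.
rewrite eA eB eXXY.
have -> : X * X * X ^+ n * E i = lin 0 0 1 0 by rewrite -[X * X * X ^+ n]mulrA -!exprS eC.
have -> : X ^+ n * X * X * E i = lin 0 0 1 0 by rewrite -!exprSr eC.
have -> : X * X ^+ n * X * E i = lin 0 0 1 0 by rewrite -exprS -exprSr eC.
rewrite !(lin4Z, lin4D, lin4N) /com_defect.
congr lin; rewrite ?addn0 ?addnS ?addn0 ?addSn; ring.
Qed.

(** The terms X^(n+1) Y and X^n Y X produced by the X^n part of v are rewritten by
    expX_Y, whence the values of the recurrence in the last two coefficients. *)
Lemma der_xyy_value : (der_xyy fr mx my : L) * E 0 =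
  lin4 (wdL 3 1 0) (wdL 4 0 0) (wdL 2 n 0) (wdL 1 n.+1 0)
    (beta * (com_defect n + com_defect 0)) (alpha * com_defect n)
    ((c n - alpha * c n.+1) * p n.+1 + c 0%N - beta * c n.+1 * p n)
    ((c n - alpha * c n.+1) * (beta * p n) - beta * c n.+1 * (beta * p n.-1)
       - beta * c 1%N - alpha * c 0%N).
Proof.
have gX := gradedX fr; have gY := gradedY fr.
rewrite der_xyyE /= !mulrBl -!scalerAl !mulrDl.
rewrite !(sand_mx _ _ (rgradedM gY gY)) !(sand_mx _ _ gY)
  !(sand_mx _ _ rgraded1).
rewrite !(sand_my _ _ (rgradedM gX gY)) !(sand_my _ _ (rgradedM gY gX))
  !(sand_my _ _ gX) !(sand_my _ _ gY) !(sand_my _ _ rgraded1).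
rewrite !mul1r !mulr1 !mulrA.
set lin := lin4 _ _ _ _.
have eD : Y * Y * X * E 0 = lin 1 0 0 0 by rewrite /lin -lin4_1 /wd /head_word /= expr1.
have eF : Y * X * Y * E 0 = lin 0 1 0 0 by rewrite /lin -lin4_2 /wd /head_word /= mulr1.
have eG : X * Y * X ^+ n * E 0 = lin 0 0 1 0 by rewrite /lin -lin4_3 /wd /head_word /=.
have eH : Y * X ^+ n.+1 * E 0 = lin 0 0 0 1 by rewrite /lin -lin4_4 /wd /head_word /=.
have eXYY : X * Y * Y * E 0 = lin beta alpha 0 0.
  by rewrite XYY mulrDl -!scalerAl eD eF !lin4Z lin4D; congr lin; ring.
have eXnY : X ^+ n.+1 * Y * E 0 = lin 0 0 (p n.+1) (beta * p n).
  by rewrite expX_Y mulrDl -!scalerAl eG eH !lin4Z lin4D; congr lin; ring.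
have eXYX : X ^+ n * Y * X * E 0 = lin 0 0 (p n) (beta * p n.-1).
  have n_gt0 : (0 < n)%N by lia.
  have -> : X ^+ n * Y = p n *: (X * Y * X ^+ n.-1) + (beta * p n.-1) *: (Y * X ^+ n).
    by have := expX_Y n.-1; rewrite prednK.
  rewrite !mulrDl -!scalerAl -[X * Y * _ * X]mulrA -[Y * X ^+ n * X]mulrA -!exprSr.
  rewrite prednK // eG eH.
  by rewrite !lin4Z lin4D; congr lin; ring.
rewrite eD eF eXYY eG eXYX.
have -> : X * X ^+ n * Y * E 0 = lin 0 0 (p n.+1) (beta * p n) by rewrite -exprS.
have -> : X ^+ n * X * Y * E 0 = lin 0 0 (p n.+1) (beta * p n) by rewrite -exprSr.
have -> : Y * X ^+ n * X * E 0 = lin 0 0 0 1 by rewrite -[Y * _ * X]mulrA -exprSr.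
have -> : Y * X * X ^+ n * E 0 = lin 0 0 0 1 by rewrite -[Y * X * _]mulrA -exprS.
rewrite !(lin4Z, lin4D, lin4N) /com_defect.
rewrite !add0n !addn1 !add1n; congr lin; ring.
Qed.

End Values.
End CochainFormulas.

(** * Graded elements of the algebra *)

Section Values.
Variables (k : fieldType) (n : nat) (alpha beta : k) (L : algType k).
Variable fr : frame n alpha beta L.
Hypothesis n_ge2 : (2 <= n)%N.
Local Notation E := (frE fr).
Local Notation X := (frX fr).
Local Notation Y := (frY fr).
Local Notation coef := (frcoef fr).
Local Notation l := (beil_size n).
Local Notation wdL := (wd E X Y).
Local Notation reg := (regular_bimodule L).

(** Coordinates with natural indices, extended by 0 *)
Definition ncoef kap c i (a : L) : k :=
  if insub kap is Some kap' then if insub c is Some c' then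
  if insub i is Some i' then coef (kap', c', i') a else 0 else 0 else 0.

Lemma ncoefD kap c i : {morph ncoef kap c i : a a' / a + a'}.
Proof.
move=> a a'; rewrite /ncoef; case: insubP => [? _ _|_]; last by rewrite addr0.
case: insubP => [? _ _|_]; last by rewrite addr0.
by case: insubP => [? _ _|_]; rewrite ?addr0 // frcoefD.
Qed.
Lemma ncoefZ kap c i d a : ncoef kap c i (d *: a) = d * ncoef kap c i a.
Proof.
rewrite /ncoef; case: insubP => [? _ _|_]; last by rewrite mulr0.
case: insubP => [? _ _|_]; last by rewrite mulr0.
by case: insubP => [? _ _|_]; rewrite ?mulr0 // frcoefZ.
Qed.
Lemma ncoef0 kap c i : ncoef kap c i 0 = 0.
Proof. by rewrite -(scale0r 0) ncoefZ mul0r. Qed.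

Lemma ncoef_wd kap c i kap' c' i' : (kap < 5)%N -> (kap' < 5)%N ->
  (i + (c + head_deg n kap) < l)%N ->
  ncoef kap c i (wdL kap' c' i') = [&& kap == kap', c == c' & i == i']%:R.
Proof.
move=> lt_kap lt_kap' lt; rewrite /ncoef.
case: insubP => [K _ KE|]; last by rewrite lt_kap.
case: insubP => [C _ CE|]; last by lia.
case: insubP => [I _ IE|]; last by lia.
by rewrite coef_wd //= KE CE IE /tgt /= KE CE IE lt andbT.
Qed.

Lemma ext_vertices (a a' : L) : (forall i, (i < l)%N -> a * E i = a' * E i) -> a = a'.
Proof.
move=> aa'; rewrite (mulE1r fr a) (mulE1r fr a'); apply: eq_bigr => i _.
exact: aa'.
Qed.

Lemma wdL_out kap c i : (kap < 5)%N -> (l <= i + (c + head_deg n kap))%N -> wdL kap c i = 0.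
Proof. exact: (wd_out (gradedX fr) (gradedY fr) (@frE_out _ _ _ _ _ fr)). Qed.

Lemma graded_value d (m : reg) : graded fr d m -> (d < l)%N -> forall i,
  (m : L) * E i = \sum_(kap < 5 | (head_deg n kap <= d)%N)
     ncoef kap (d - head_deg n kap) i m *: wdL kap (d - head_deg n kap) i.
Proof.
move=> gm lt_d i; apply: (coef_inj (fr := fr)) => w.
rewrite coef_Er frcoef_sum.
have termE (kap : 'I_5) : coef w (ncoef kap (d - head_deg n kap) i m *: wdL kap (d - head_deg n kap) i) =
    if [&& w.1.1 == kap :> nat, w.1.2 == d - head_deg n kap :> nat, w.2 == i :> nat & (tgt w < l)%N]%N
    then coef w m else 0.
  rewrite frcoefZ coef_wd //; case: and4P => [[/eqP e1 /eqP e2 /eqP e3 lt]|_]; last by rewrite mulr0.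
  rewrite mulr1 /ncoef -e2 -e3.
  case: insubP => [K _ KE|]; last by rewrite ltn_ord.
  case: insubP => [C _ CE|]; last by rewrite ltn_ord.
  case: insubP => [I _ IE|]; last by rewrite ltn_ord.
  congr (coef _ m); case: w e1 {e2 e3 lt} CE IE => [[kw cw] iw] /= e1 CE IE.
  by congr (_, _, _); apply: val_inj => //=; rewrite KE e1.
rewrite (eq_bigr _ (fun kap _ => termE kap)).
case: (boolP (jump d w)) => [/andP[/eqP tw lt]|nj].
  have le_w : (head_deg n w.1.1 <= d)%N by rewrite /tgt in tw; lia.
  rewrite (bigD1 w.1.1) //= big1 ?addr0 => [|kap /andP[_ ne]].
    have e2 : nat_of_ord w.1.2 = (d - head_deg n w.1.1)%N by move: tw; rewrite /tgt; lia.
    by rewrite lt -e2 !eqxx andbT.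
  by rewrite -val_eqE eq_sym /= in ne *; rewrite (negPf ne).
by rewrite (graded_coef gm nj) big1 ?if_same // => kap _; case: ifP.
Qed.

Lemma sum5 (V : nmodType) (Q : pred nat) (F : nat -> V) :
  \sum_(kap < 5 | Q kap) F kap = (if Q 0%N then F 0%N else 0) + ((if Q 1%N then F 1%N else 0)
   + ((if Q 2 then F 2 else 0) + ((if Q 3 then F 3 else 0) + (if Q 4 then F 4 else 0)))).
Proof. by rewrite big_mkcond !big_ord_recl big_ord0 /= addr0. Qed.

Lemma graded0_value (m : reg) : graded fr 0 m ->
  exists z, forall i, (m : L) * E i = z i *: E i.
Proof.
move=> gm; exists (fun i => ncoef 0 0 i m) => i.
rewrite (graded_value gm) // (sum5 (fun kap => head_deg n kap <= 0)%N
  (fun kap => ncoef kap (0 - head_deg n kap) i m *: wdL kap (0 - head_deg n kap) i)).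
rewrite /head_deg /= (_ : (n <= 0)%N = false); last by lia.
rewrite (_ : (2 * n <= 0)%N = false); last by lia.
by rewrite !addr0 /wd /head_word /= !mul1r.
Qed.

Lemma graded1_value (m : reg) : graded fr 1 m ->
  exists a, forall i, (m : L) * E i = a i *: (X * E i).
Proof.
move=> gm; exists (fun i => ncoef 0 1 i m) => i.
rewrite (graded_value gm) /beil_size; last by lia.
rewrite (sum5 (fun kap => head_deg n kap <= 1)%N
  (fun kap => ncoef kap (1 - head_deg n kap) i m *: wdL kap (1 - head_deg n kap) i)).
rewrite /head_deg /= (_ : (n <= 1)%N = false); last by lia.
rewrite (_ : (n < 1)%N = false); last by lia.
rewrite (_ : (2 * n <= 1)%N = false); last by lia.
rewrite (_ : (2 * n < 1)%N = false); last by lia.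
by rewrite !addr0 /wd /head_word /= !mul1r expr1.
Qed.

Lemma gradedn_value (m : reg) : graded fr n m ->
  exists b c, forall i, (m : L) * E i = b i *: (Y * E i) + c i *: (X ^+ n * E i).
Proof.
move=> gm; exists (fun i => ncoef 1 0 i m); exists (fun i => ncoef 0 n i m) => i.
rewrite (graded_value gm) /beil_size; last by lia.
rewrite (sum5 (fun kap => head_deg n kap <= n)%N
  (fun kap => ncoef kap (n - head_deg n kap) i m *: wdL kap (n - head_deg n kap) i)).
rewrite /head_deg /= leqnn ltnn.
rewrite (_ : (2 * n <= n)%N = false); last by lia.
rewrite (_ : (2 * n < n)%N = false); last by lia.
by rewrite !addr0 subnn subn0 /wd /head_word /= !mul1r mulr1 addrC.
Qed.

End Values.

(** * Cocycles of degree 1 as scalar sequences *)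

Section Cohomology.
Variables (k : fieldType) (n : nat) (alpha beta : k) (L : algType k).
Variable fr : frame n alpha beta L.
Hypothesis n_ge2 : (2 <= n)%N.
Local Notation E := (frE fr).
Local Notation X := (frX fr).
Local Notation Y := (frY fr).
Local Notation l := (beil_size n).
Local Notation reg := (regular_bimodule L).
Local Notation P i := (fb fr (gens n i)).
Local Notation p := (lucas alpha beta 0 1).
Local Notation gx := (gen_x fr).
Local Notation gy := (gen_y fr).

Lemma graded_of_values d (m : reg) :
  (forall i, (m : L) * E i = E (i + d)%N * ((m : L) * E i)) -> graded fr d m.
Proof.
move=> mE i; rewrite /= [in RHS](mulE1r fr m) mulr_sumr.
have [lt_i|le_i] := ltnP i l; last first.
  by rewrite frE_out // mulr0 big1 // => j _; rewrite frE_out ?mul0r //; lia.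
rewrite (bigD1 (Ordinal lt_i)) //= -mE big1 ?addr0 // => j.
rewrite -val_eqE /= => ne; rewrite mE mulrA frE_mul eqn_add2r eq_sym.
by rewrite (negPf ne) mul0r.
Qed.

(** The element acting as z i times w from vertex i *)
Definition welt (w : L) (z : nat -> k) : reg := \sum_(i < l) z i *: (w * E i).

Lemma weltE w z i : (welt w z : L) * E i = z i *: (w * E i).
Proof.
rewrite /welt mulr_suml; have [lt_i|le_i] := ltnP i l; last first.
  by rewrite frE_out // mulr0 scaler0 big1 // => j _; rewrite mulr0.
rewrite (bigD1 (Ordinal lt_i)) //= big1 ?addr0.
  by rewrite -scalerAl -mulrA frE_mul eqxx.
move=> j; rewrite -val_eqE /= => ne.
by rewrite -scalerAl -mulrA frE_mul (negPf ne) mulr0 scaler0.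
Qed.

Lemma welt_graded d w z : rgraded E d w -> graded fr d (welt w z).
Proof.
move=> gw; apply: graded_of_values => i.
by rewrite weltE -scalerAr -gradedE_id.
Qed.

Lemma gradedD (M : bimodule L) d (m m' : M) : graded fr d m -> graded fr d m' ->
  graded fr d (m + m').
Proof. by move=> gm gm' i; rewrite ractDl lactDr gm gm'. Qed.

Lemma gradedXn : rgraded E n (X ^+ n).
Proof. by move=> i; apply: (expX_E (frXE fr)). Qed.

Definition cochain1 (mx my : reg) : P 1 -> reg :=
  fb_lift (s := gens n 1) (fun j => pick2 mx my j).

Lemma cochain1P (mx my : reg) : graded fr 1 mx -> graded fr n my ->
  [/\ bim_hom (cochain1 mx my), cochain1 mx my gx = mx & cochain1 mx my gy = my].
Proof.
move=> gmx gmy; have gr (j : 'I_(size (gens n 1))) : graded fr (nth 0%N (gens n 1) j) (pick2 mx my j).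
  by case: j => -[|[|//]].
by split; [apply: fb_lift_hom | apply: fb_lift_gen gr _ | apply: fb_lift_gen gr _].
Qed.

Lemma hom1_eq (f g : P 1 -> reg) : bim_hom f -> bim_hom g ->
  f gx = g gx -> f gy = g gy -> f = g.
Proof.
move=> hf hg fgx fgy; apply: funext; apply: fb_hom_eq => // -[[|[|//]] lt_j].
  by rewrite (_ : Ordinal _ = @Ordinal 2 0 isT) //; apply: val_inj.
by rewrite (_ : Ordinal _ = @Ordinal 2 1 isT) //; apply: val_inj.
Qed.

(** A bimodule map on P1 sends the image of a generator of P2 to the derived relation
    evaluated at the images of g_x and g_y. *)
Lemma cocycle1_der (f : P 1 -> reg) : bim_hom f ->
  (forall x, f (res_d1 x) = 0) <->
  der_xxy fr (f gx) (f gy) = 0 /\ der_xyy fr (f gx) (f gy) = 0.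
Proof.
move=> hf; have [e1 e2] := der_hom fr gx gy hf.
have d1 (j : 'I_(size (gens n 2))) : res_d1 (@fb_gen _ _ _ _ _ fr (gens n 2) j) =
    pick2 (der_xxy fr gx gy) (der_xyy fr gx gy) j.
  by apply: fb_lift_gen; apply: res_d1_graded.
split=> [f0|[z1 z2] x].
  rewrite -e1 -e2; split.
    by rewrite -[RHS](f0 (@fb_gen _ _ _ _ _ fr (gens n 2) (@Ordinal 2 0 isT))) d1.
  by rewrite -[RHS](f0 (@fb_gen _ _ _ _ _ fr (gens n 2) (@Ordinal 2 1 isT))) d1.
apply: (fb_hom_eq (f := fun x => f (res_d1 x)) (g := fun _ => 0)).
- exact: (bim_hom_comp hf (res_d1_hom fr)).
- exact: bim_hom_zero.
- by move=> j; rewrite d1; case: j => -[|[|//]] ?; rewrite /pick2 /= ?e1 ?e2.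
Qed.

(** The coefficients of the two derived relations, over the vertices from which
    they stay in range: i < n for the first relation and i = 0 for the
    second. *)
Definition seq_cocycle (a b c : nat -> k) : Prop :=
  [/\ forall i, (i < n)%N -> beta * (com_defect n a b i + com_defect n a b i.+1) = 0 /\
        alpha * com_defect n a b i = 0,
      beta * (com_defect n a b n + com_defect n a b 0) = 0 /\ alpha * com_defect n a b n = 0,
      forall i, (i < n)%N -> c i - beta * c i.+2 - alpha * c i.+1 = 0,
      (c n - alpha * c n.+1) * p n.+1 + c 0%N - beta * c n.+1 * p n = 0 &
      (c n - alpha * c n.+1) * (beta * p n) - beta * c n.+1 * (beta * p n.-1)
         - beta * c 1%N - alpha * c 0%N = 0].

Lemma lin4_0 (A B C D : L) : lin4 A B C D 0 0 0 0 = 0.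
Proof. by rewrite /lin4 -lock !scale0r !addr0. Qed.
Lemma lin4_zero q r s t : lin4 (0 : L) 0 0 0 q r s t = 0.
Proof. by rewrite /lin4 -lock !scaler0 !addr0. Qed.

Section Values.
Variables (f : P 1 -> reg) (a b c : nat -> k).
Hypothesis hf : bim_hom f.
Hypothesis fxE : forall i, (f gx : L) * E i = a i *: (X * E i).
Hypothesis fyE : forall i, (f gy : L) * E i = b i *: (Y * E i) + c i *: (X ^+ n * E i).

Lemma lin4_coef (A B C D : L) q r s t kap cc i :
  ncoef fr kap cc i (lin4 A B C D q r s t) = q * ncoef fr kap cc i A + r * ncoef fr kap cc i B +
    s * ncoef fr kap cc i C + t * ncoef fr kap cc i D.
Proof. by rewrite /lin4 -lock !ncoefD !ncoefZ. Qed.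

Lemma cocycle1_seq : (forall x, f (res_d1 x) = 0) <-> seq_cocycle a b c.
Proof.
have v1 := der_xxy_value fxE fyE; have v2 := der_xyy_value n_ge2 fxE fyE.
split=> [/(cocycle1_der hf)[z1 z2]|[ab1 ab2 c1 c2 c3]].
  have u1 i := etrans (esym (v1 i)) (etrans (congr1 (fun t : L => t * E i) z1) (mul0r (E i))).
  have {v2} u2 := etrans (esym v2) (etrans (congr1 (fun t : L => t * E 0) z2) (mul0r (E 0))).
  have lt0 i : (i < n)%N -> (i + (n.+2 + head_deg n 0) < l)%N.
    by rewrite /head_deg /beil_size /=; lia.
  have lt1 i : (i < n)%N -> (i + (2 + head_deg n 1) < l)%N.
    by rewrite /head_deg /beil_size /=; lia.
  have lt2 i : (i < n)%N -> (i + (1 + head_deg n 2) < l)%N.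
    by rewrite /head_deg /beil_size /=; lia.
  have lt3 : (0 + (1 + head_deg n 3) < l)%N by rewrite /head_deg /beil_size /=; lia.
  have lt4 : (0 + (0 + head_deg n 4) < l)%N by rewrite /head_deg /beil_size /=; lia.
  have lt5 : (0 + (n + head_deg n 2) < l)%N by rewrite /head_deg /beil_size /=; lia.
  have lt6 : (0 + (n.+1 + head_deg n 1) < l)%N by rewrite /head_deg /beil_size /=; lia.
  split.
  - move=> i lt_i; split.
      have := congr1 (ncoef fr 1 2 i) (u1 i); rewrite ncoef0 lin4_coef.
      by rewrite !ncoef_wd ?lt1 //= eqxx ncoef0 !mulr0 !addr0 mulr1.
    have := congr1 (ncoef fr 2 1 i) (u1 i); rewrite ncoef0 lin4_coef.
    by rewrite !ncoef_wd ?lt2 //= eqxx ncoef0 !mulr0 !addr0 add0r mulr1.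
  - split.
      have := congr1 (ncoef fr 3 1 0) u2; rewrite ncoef0 lin4_coef.
      by rewrite !ncoef_wd //= !mulr0 !addr0 mulr1.
    have := congr1 (ncoef fr 4 0 0) u2; rewrite ncoef0 lin4_coef.
    by rewrite !ncoef_wd //= !mulr0 !addr0 add0r mulr1.
  - move=> i lt_i; have := congr1 (ncoef fr 0 n.+2 i) (u1 i); rewrite ncoef0 lin4_coef.
    by rewrite !ncoef_wd ?lt0 //= !eqxx ncoef0 !mulr0 addr0 !add0r mulr1.
  - have := congr1 (ncoef fr 2 n 0) u2; rewrite ncoef0 lin4_coef.
    by rewrite !ncoef_wd //= eqxx !mulr0 addr0 !add0r mulr1.
  - have := congr1 (ncoef fr 1 n.+1 0) u2; rewrite ncoef0 lin4_coef.
    by rewrite !ncoef_wd //= eqxx !mulr0 !add0r mulr1.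
apply/(cocycle1_der hf); split; apply: (ext_vertices (fr := fr)) => i lt_i; rewrite mul0r.
  rewrite v1; have [lt|le] := ltnP i n.
    by have [-> ->] := ab1 i lt; rewrite c1 // lin4_0.
  rewrite !wdL_out ?lin4_zero //; rewrite /head_deg /beil_size /=; lia.
case: i lt_i => [|i] lt_i; first by rewrite v2 c2 c3; case: ab2 => -> ->; rewrite lin4_0.
have [_ /(_ i.+1) /= ->] := der_graded (graded_hom hf (graded_x fr)) (graded_hom hf (graded_y fr)).
by rewrite frE_out ?mul0r // /beil_size; lia.
Qed.

End Values.
End Cohomology.

(** * Cohomology in degree 0 and above degree 2 *)

Lemma lucas_linear (k : fieldType) (alpha beta c d0 d1 e0 e1 : k) m :
  lucas alpha beta (c * d0 + e0) (c * d1 + e1) m =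
  c * lucas alpha beta d0 d1 m + lucas alpha beta e0 e1 m.
Proof.
elim/rec2_ind: m => [||m IH IH'] //.
by rewrite !lucasSS IH IH'; ring.
Qed.

Section Cohomology.
Variables (k : fieldType) (n : nat) (alpha beta : k) (L : algType k).
Variable fr : frame n alpha beta L.
Hypothesis n_ge2 : (2 <= n)%N.
Local Notation E := (frE fr).
Local Notation X := (frX fr).
Local Notation Y := (frY fr).
Local Notation l := (beil_size n).
Local Notation wdL := (wd E X Y).
Local Notation reg := (regular_bimodule L).
Local Notation P i := (fb fr (gens n i)).
Local Notation gx := (gen_x fr).
Local Notation gy := (gen_y fr).
Local Notation gg := (gen_g fr).
Local Notation R := (res fr n_ge2).

Section Coboundary.
Variables (g : P 0 -> reg) (z : nat -> k).
Hypothesis hg : bim_hom g.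
Hypothesis gE : forall i, (g gg : L) * E i = z i *: E i.

Lemma hom_inner a : g (inner gg a) = a * (g gg : L) - (g gg : L) * a.
Proof. by rewrite /inner (bim_homB hg); case: hg => _ -> ->. Qed.

Lemma res_d0_gx : res_d0 gx = inner gg X.
Proof. by apply: fb_lift_gen; apply: res_d0_graded. Qed.
Lemma res_d0_gy : res_d0 gy = inner gg Y.
Proof. by apply: fb_lift_gen; apply: res_d0_graded. Qed.

Lemma coboundary_x i : (g (res_d0 gx) : L) * E i = (z i - z i.+1) *: (X * E i).
Proof.
rewrite res_d0_gx hom_inner mulrBl -!mulrA gE frXE (mulrA _ (E _)) gE.
by rewrite -scalerAr -scalerAl frXE -scalerBl.
Qed.

Lemma coboundary_y i : (g (res_d0 gy) : L) * E i = (z i - z (i + n)%N) *: (Y * E i).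
Proof.
rewrite res_d0_gy hom_inner mulrBl -!mulrA gE frYE (mulrA _ (E _)) gE.
by rewrite -scalerAr -scalerAl frYE -scalerBl.
Qed.
End Coboundary.

Definition cochain0 (m : reg) : P 0 -> reg := fb_lift (s := gens n 0) (fun _ => m).

Lemma cochain0P (m : reg) : graded fr 0 m -> bim_hom (cochain0 m) /\ cochain0 m gg = m.
Proof.
move=> gm; split; first exact: fb_lift_hom.
by apply: fb_lift_gen => -[[|//] ?].
Qed.

Lemma coef_scale kap c i (q : k) : (kap < 5)%N -> (i + (c + head_deg n kap) < l)%N ->
  q *: wdL kap c i = 0 -> q = 0.
Proof.
move=> lt_kap lt /(congr1 (ncoef fr kap c i)).
by rewrite ncoef0 ncoefZ ncoef_wd // !eqxx mulr1.
Qed.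

Lemma vertex_coef i (q : k) : (i < l)%N -> q *: E i = 0 -> q = 0.
Proof.
move=> lt; have -> : E i = wdL 0 0 i by rewrite /wd /head_word /= !mul1r.
by apply: coef_scale => //; rewrite /head_deg /= !addn0.
Qed.
Lemma x_coef i (q : k) : (i.+1 < l)%N -> q *: (X * E i) = 0 -> q = 0.
Proof.
move=> lt; have -> : X * E i = wdL 0 1 i by rewrite /wd /head_word /= mul1r expr1.
by apply: coef_scale => //; rewrite /head_deg /= addn0 addn1.
Qed.
Lemma yx_coef i (q r : k) : (i + n < l)%N -> q *: (Y * E i) + r *: (X ^+ n * E i) = 0 ->
  q = 0 /\ r = 0.
Proof.
move=> lt.
have -> : Y * E i = wdL 1 0 i by rewrite /wd /head_word /= mulr1.
have -> : X ^+ n * E i = wdL 0 n i by rewrite /wd /head_word /= mul1r.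
move=> e; split.
  have := congr1 (ncoef fr 1 0 i) e.
  by rewrite ncoef0 ncoefD !ncoefZ !ncoef_wd //= eqxx mulr1 mulr0 addr0.
have := congr1 (ncoef fr 0 n i) e.
rewrite ncoef0 ncoefD !ncoefZ !ncoef_wd //= ?addn0 // !eqxx mulr1 mulr0 add0r //.
Qed.

(** A cocycle multiplies each E_i by a scalar z_i, and commuting with X makes z
    constant. *)
Lemma HH0_res : subquot_dim (@ext_cocycle _ _ reg reg R 0) (@ext_coboundary _ _ reg reg R 0) 1.
Proof.
have ha := res_aug_hom fr.
have aug_g : res_aug gg = 1 :> L by rewrite /gen_g res_aug_elt mulr1.
exists (fun _ => @res_aug _ _ _ _ _ fr); split.
- move=> _; split=> // x; apply/res_exact0; by exists x.
- move=> f [hf fd].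
  have gm : graded fr 0 (f gg) by apply: graded_hom hf (graded_g fr).
  have [z zE] := graded0_value n_ge2 gm.
  have zS i : (i.+1 < l)%N -> z i = z i.+1.
    move=> lt; apply/eqP; rewrite -subr_eq0; apply/eqP; apply: (@x_coef i) => //.
    by rewrite -(coboundary_x hf zE) fd mul0r.
  have z0 i : (i < l)%N -> z i = z 0%N.
    by elim: i => // i IH lt; rewrite -zS // IH // ltnW.
  have fg : f gg = z 0%N *: 1 :> L.
    apply: (ext_vertices (fr := fr)) => i lt; rewrite zE z0 //.
    by rewrite -scalerAl mul1r.
  exists (fun _ => z 0%N); rewrite big_ord1 => x.
  apply/eqP; rewrite subr_eq0; apply/eqP; move: x.
  apply: fb_hom_eq => //.
    have := bim_hom_linD (z 0%N) ha (bim_hom_zero _ _); congr bim_hom.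
    by apply: funext => x; rewrite addr0.
  move=> j; have -> : j = @ord0 0 by apply: val_inj; case: j => -[].
  by rewrite -/(gen_g fr) fg -aug_g.
- move=> c; rewrite big_ord1 => /(_ gg) c0 j; rewrite (ord1 j).
  apply: (@vertex_coef 0) => //; have := congr1 (fun t : L => t * E 0) c0.
  by rewrite mul0r [(_ *: _) gg]/(_ *: res_aug gg) aug_g -scalerAl mul1r.
Qed.

Lemma HH3_res i : (3 <= i)%N ->
  subquot_dim (@ext_cocycle _ _ reg reg R i) (@ext_coboundary _ _ reg reg R i) 0.
Proof.
case: i => [|[|[|i]]] // _; exists (fun j => 0); split=> [[]|f [hf _]|c _ []] //.
exists (fun _ => 0); rewrite big_ord0 subr0.
exists (fun _ => 0); first exact: bim_hom_zero.
by move=> x; rewrite (res_obj_trivial x) (bim_hom0 hf).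
Qed.

End Cohomology.

(** * Cohomology in degree 1 *)

Section Cohomology.
Variables (k : fieldType) (n : nat) (alpha beta : k) (L : algType k).
Variable fr : frame n alpha beta L.
Hypothesis n_ge2 : (2 <= n)%N.
Hypothesis beta_neq0 : beta != 0.
Hypothesis two_neq0 : 2%:R != 0 :> k.
Local Notation E := (frE fr).
Local Notation X := (frX fr).
Local Notation Y := (frY fr).
Local Notation l := (beil_size n).
Local Notation reg := (regular_bimodule L).
Local Notation P i := (fb fr (gens n i)).
Local Notation p := (lucas alpha beta 0 1).
Local Notation gx := (gen_x fr).
Local Notation gy := (gen_y fr).
Local Notation gg := (gen_g fr).
Local Notation R := (res fr n_ge2).

(** A row vector (s, t, d0, d1) encodes the cochain which is 0 at x and
    b_i Y + c_i X^n at y, where b_i = s + t (-1)^i and c is the solution of the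
    recurrence run downwards from c_(n+2) = d0 and c_(n+1) = d1. *)
Local Notation par u i := ((u : 'rV[k]_4) 0 (inord i)).
Definition par_b (u : 'rV[k]_4) (i : nat) : k := par u 0 + par u 1 * (-1) ^+ i.
Definition par_c (u : 'rV[k]_4) (i : nat) : k :=
  lucas alpha beta (par u 2) (par u 3) (n.+2 - i).
Definition par_ok (u : 'rV[k]_4) : Prop :=
  [/\ (alpha != 0) || ~~ odd n -> par u 1 = 0,
      p n.+1 * (2%:R * beta * par u 2 + alpha * par u 3) = 0 &
      p n.+1 * (alpha * beta * par u 2 + (alpha ^+ 2 + 2%:R * beta) * par u 3) = 0].

Lemma p_rec : p n.+2 = alpha * p n.+1 + beta * p n /\ beta * p n.-1 = p n.+1 - alpha * p n.
Proof.
split; first exact: lucasSS.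
have n_gt0 : (0 < n)%N by lia.
have := lucasSS alpha beta 0 1 n.-1; rewrite prednK // => ->; ring.
Qed.

(** Running the recurrence down to c_0 and c_1 expresses the two conditions of the
    second relation by d0 and d1; a factor delta = p (n+1) comes out. *)
Lemma par_c_eqs (d0 d1 : k) (c := fun i => lucas alpha beta d0 d1 (n.+2 - i)) :
  (c n - alpha * c n.+1) * p n.+1 + c 0%N - beta * c n.+1 * p n =
    p n.+1 * (2%:R * beta * d0 + alpha * d1) /\
  (c n - alpha * c n.+1) * (beta * p n) - beta * c n.+1 * (beta * p n.-1)
         - beta * c 1%N - alpha * c 0%N =
    - (p n.+1 * (alpha * beta * d0 + (alpha ^+ 2 + 2%:R * beta) * d1)).
Proof.
rewrite /c; have [-> ->] : (n.+2 - n.+1 = 1 /\ n.+2 - n = 2)%N by lia.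
rewrite subn0 subn1 /= [lucas _ _ d0 d1 n.+2]lucas_lin [lucas _ _ d0 d1 n.+1]lucas_lin.
have [e1 e2] := p_rec; rewrite e1 e2 (lucasSS alpha beta d0 d1 0).
rewrite /(lucas _ _ d0 d1 1) /(lucas _ _ d0 d1 0) /=.
by split; ring.
Qed.

Lemma par_seq_cocycle u : par_ok u <-> seq_cocycle n alpha beta (fun=> 0) (par_b u) (par_c u).
Proof.
have [q1 q2] := par_c_eqs (par u 2) (par u 3).
have comE i : com_defect n (fun=> 0) (par_b u) i = 2%:R * par u 1 * (-1) ^+ i.
  by rewrite /com_defect /par_b exprS; ring.
rewrite /seq_cocycle /par_ok /par_c q1 q2; split=> [[t0 -> ->]|[ab1 [ab2 ab3] _ -> ] /eqP].
  split=> [i lt_i||i lt_i||]; rewrite ?oppr0 //.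
  - rewrite !comE exprS; split; first by ring.
    have [a0|a_neq0] := eqVneq alpha 0; first by rewrite a0 mul0r.
    by rewrite t0 ?a_neq0 // mulr0 mul0r mulr0.
  - rewrite !comE; have [a0|a_neq0] := eqVneq alpha 0; last first.
      by rewrite t0 ?a_neq0 // mulr0 !mul0r addr0 !mulr0.
    rewrite a0 mul0r; split=> //; have [on|en] := boolP (odd n).
      by rewrite -signr_odd on expr1 expr0; ring.
    by rewrite t0 ?en ?orbT // mulr0 !mul0r addr0 mulr0.
  - have -> : (n.+2 - i = (n - i).+2)%N by lia.
    have -> : (n.+2 - i.+2 = n - i)%N by lia.
    have -> : (n.+2 - i.+1 = (n - i).+1)%N by lia.
    by rewrite lucasSS; ring.
rewrite oppr_eq0 => /eqP q20; split=> // /orP[a_neq0|en].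
  have [_ /eqP] := ab1 0%N (ltnW n_ge2); rewrite comE expr0 mulr1.
  by rewrite !mulf_eq0 (negPf a_neq0) (negPf two_neq0) /= => /eqP.
move: ab2 => /eqP; rewrite !comE -signr_odd (negPf en) expr0 !mulr1.
have -> : beta * (2%:R * par u 1 + 2%:R * par u 1) = beta * 2%:R * 2%:R * par u 1.
  by ring.
by rewrite !mulf_eq0 (negPf beta_neq0) (negPf two_neq0) => /eqP.
Qed.

Definition par_my u : reg := welt fr Y (par_b u) + welt fr (X ^+ n) (par_c u).

Lemma par_my_graded u : graded fr n (par_my u).
Proof.
by apply: gradedD; [apply: (welt_graded n_ge2 _ (gradedY fr)) | apply: (welt_graded n_ge2 _ (gradedXn fr))].
Qed.

Lemma par_myE u i : (par_my u : L) * E i = par_b u i *: (Y * E i) + par_c u i *: (X ^+ n * E i).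
Proof. by rewrite /par_my mulrDl !weltE. Qed.

Definition par_cochain (u : 'rV[k]_4) : P 1 -> reg := cochain1 0 (par_my u).

Lemma par_cochainP u :
  [/\ bim_hom (par_cochain u), par_cochain u gx = 0 & par_cochain u gy = par_my u].
Proof. by apply: cochain1P; [apply: graded0 | apply: par_my_graded]. Qed.

Lemma par_cochain_lin : linear par_cochain.
Proof.
move=> c u v; have [hu ux uy] := par_cochainP u; have [hv vx vy] := par_cochainP v.
have [h hx hy] := par_cochainP (c *: u + v).
apply: hom1_eq => //; first exact: bim_hom_linD.
  have -> : (c *: par_cochain u + par_cochain v) gx =
    c *: par_cochain u gx + par_cochain v gx by [].
  by rewrite hx ux vx scaler0 addr0.
have -> : (c *: par_cochain u + par_cochain v) gy =
  c *: par_cochain u gy + par_cochain v gy by [].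
rewrite hy uy vy.
apply: (ext_vertices (fr := fr)) => i _.
have -> : ((c *: par_my u + par_my v : reg) : L) * E i =
    c *: ((par_my u : L) * E i) + (par_my v : L) * E i.
  exact: (@ract_linearl _ _ (regular_bimodule L) (E i) c (par_my u) (par_my v)).
rewrite !par_myE.
have -> : par_b (c *: u + v) i = c * par_b u i + par_b v i.
  by rewrite /par_b !mxE; ring.
have -> : par_c (c *: u + v) i = c * par_c u i + par_c v i.
  by rewrite /par_c !mxE lucas_linear.
move: (par_b u i) (par_b v i) (par_c u i) (par_c v i) => q r s t.
by rewrite !scalerDl scalerDr !scalerA addrACA.
Qed.

Lemma par_ok_closed : lin_closed par_ok.
Proof.
split=> [|c u v [u1 u2 u3] [v1 v2 v3]].
  by split=> [_||]; rewrite !mxE ?mulr0 ?addr0 ?mulr0.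
split=> [h||]; rewrite !mxE.
- by rewrite u1 // v1 // mulr0 addr0.
- move: u2 v2; set q := p _ => u2 v2.
  transitivity (c * (q * (2%:R * beta * par u 2 + alpha * par u 3)) +
    q * (2%:R * beta * par v 2 + alpha * par v 3)); first by ring.
  by rewrite u2 v2 mulr0 addr0.
- move: u3 v3; set q := p _ => u3 v3.
  transitivity (c * (q * (alpha * beta * par u 2 + (alpha ^+ 2 + 2%:R * beta) * par u 3)) +
    q * (alpha * beta * par v 2 + (alpha ^+ 2 + 2%:R * beta) * par v 3)); first by ring.
  by rewrite u3 v3 mulr0 addr0.
Qed.

Lemma par_cocycle u : par_ok u -> forall x, par_cochain u (res_d1 x) = 0.
Proof.
move=> ok; have [hu ux uy] := par_cochainP u.
apply/(cocycle1_seq n_ge2 hu (a := fun=> 0) (b := par_b u) (c := par_c u)).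
- by move=> i; rewrite ux mul0r scale0r.
- by move=> i; rewrite uy par_myE.
exact/par_seq_cocycle.
Qed.

Lemma par_zero u : (forall i, (i < n.+2)%N -> par_b u i = 0 /\ par_c u i = 0) -> u = 0.
Proof.
move=> u0.
have [b0 c0] := u0 0%N isT; have [b1 _] := u0 1%N isT.
have [_ cn] := u0 n (leqnSn _); have [_ cn1] := u0 n.+1 (leqnn _).
move: b0 b1; rewrite /par_b expr0 expr1 mulr1 mulrN1 => b0 b1.
move: cn cn1; rewrite /par_c; have [-> ->] : (n.+2 - n.+1 = 1 /\ n.+2 - n = 2)%N by lia.
rewrite lucasSS [lucas _ _ _ _ 1]/lucas /= [lucas _ _ _ _ 0]/lucas /= => cn cn1.
have u1 : par u 1 = 0.
  have /eqP : 2%:R * par u 1 = 0.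
    transitivity ((par u 0 + par u 1) - (par u 0 - par u 1)); first by ring.
    by rewrite b0 b1 subrr.
  by rewrite mulf_eq0 (negPf two_neq0) => /eqP.
have u0' : par u 0 = 0 by move: b0; rewrite u1 addr0.
have u2 : par u 2 = 0.
  by move/eqP: cn; rewrite cn1 mulr0 add0r mulf_eq0 (negPf beta_neq0) => /eqP.
apply/rowP => j; rewrite mxE -[j]inord_val.
by case: j => -[|[|[|[|//]]]] ? /=.
Qed.

(** A primitive of a, whose coboundary cancels the x part of a cochain *)
Fixpoint potential (a : nat -> k) (i : nat) : k :=
  if i is j.+1 then potential a j - a j else 0.

(** The two parities of b are constant, and c is determined by c_n and c_(n+1);
    d0 = (c_n - alpha c_(n+1)) / beta extends c by one step. *)
Lemma seq_cocycle_par b c : seq_cocycle n alpha beta (fun=> 0) b c ->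
  exists u, par_ok u /\ forall i, (i < n.+2)%N -> par_b u i = b i /\ par_c u i = c i.
Proof.
move=> bc; have [ab1 ab2 c1 c2 c3] := bc.
pose u : 'rV[k]_4 := \row_j [:: (b 0%N + b 1%N) / 2%:R; (b 0%N - b 1%N) / 2%:R;
   (c n - alpha * c n.+1) / beta; c n.+1]`_j.
have uE j : (j < 4)%N -> par u j = [:: (b 0%N + b 1%N) / 2%:R; (b 0%N - b 1%N) / 2%:R;
   (c n - alpha * c n.+1) / beta; c n.+1]`_j by move=> lt; rewrite mxE inordK.
have two_b i : (i < n)%N -> b i.+2 = b i.
  move=> lt; have [/eqP + _] := ab1 i lt.
  rewrite mulf_eq0 (negPf beta_neq0) /= /com_defect => /eqP e.
  by apply/eqP; rewrite -subr_eq0 -oppr_eq0 -e; apply/eqP; ring.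
have ub : forall i, (i < n.+2)%N -> par_b u i = b i.
  elim/rec2_ind => [_|_|i IH _ lt]; rewrite /par_b !uE //=.
  - by rewrite expr0 mulr1 -mulrDl; field.
  - by rewrite expr1; field.
  by rewrite two_b // -IH ?(ltn_trans _ lt) // /par_b !uE //= !exprS; ring.
have uc : forall i, (i <= n.+1)%N -> par_c u i = c i.
  have : forall i, (i <= n.+1)%N -> lucas alpha beta (par u 2) (par u 3) i.+1 = c (n.+1 - i)%N.
    elim/rec2_ind => [_|_|i IH IH' lt]; first by rewrite /lucas /= uE.
      rewrite lucasSS /lucas /= !uE //= subn1 /=; by field.
    rewrite lucasSS IH ?IH' //; try lia.
    have lt' : (n.+1 - i.+2 < n)%N by lia.
    have := c1 _ lt'; rewrite (_ : (n.+1 - i.+2).+2 = n.+1 - i)%N; last by lia.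
    rewrite (_ : (n.+1 - i.+2).+1 = n.+1 - i.+1)%N; last by lia.
    move/eqP; rewrite -addrA -opprD subr_eq0 => /eqP ->; ring.
  move=> H i le; rewrite /par_c; have := H (n.+1 - i)%N (leq_subr _ _).
  by rewrite (_ : (n.+1 - i).+1 = n.+2 - i)%N ?subKn //; lia.
exists u; split; last by move=> i lt; rewrite ub ?uc.
apply/par_seq_cocycle.
have comE i : (i <= n)%N -> com_defect n (fun=> 0) (par_b u) i = com_defect n (fun=> 0) b i.
  by move=> le; rewrite /com_defect !ub //; lia.
split; rewrite ?comE //; try lia.
- by move=> i lt; have := ab1 i lt; rewrite -(comE i) ?(ltnW lt) // -(comE i.+1).
- by move=> i lt; rewrite !uc ?c1 //; lia.
- by rewrite !uc ?c2 //; lia.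
- by rewrite !uc ?c3 //; lia.
Qed.

Lemma seq_cocycle_ext a a' b b' c :
  (forall i, com_defect n a b i = com_defect n a' b' i) ->
  seq_cocycle n alpha beta a b c -> seq_cocycle n alpha beta a' b' c.
Proof.
move=> e [ab1 ab2 c1 c2 c3]; split=> //; last by rewrite -!e.
by move=> i lt; rewrite -!e; apply: ab1.
Qed.

(** Every cocycle becomes normalised after subtracting the coboundary of a
    primitive of its x part. A normalised cocycle that is a coboundary comes from a
    constant z, hence is 0. *)
Lemma HH1_res d : subquot_dim par_ok (fun u => u = 0) d ->
  subquot_dim (@ext_cocycle _ _ reg reg R 1) (@ext_coboundary _ _ reg reg R 1) d.
Proof.
have par0 := lin0 par_cochain_lin.
apply: (subquot_dim_map par_cochain_lin); last 2 first.
- exact: par_ok_closed.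
- move=> u ok [g hg ug]; have [hu ux uy] := par_cochainP u.
  have [z zE] := graded0_value n_ge2 (graded_hom hg (graded_g fr)).
  have zS i : (i.+1 < l)%N -> z i.+1 = z i.
    move=> lt; apply/eqP; rewrite eq_sym -subr_eq0; apply/eqP; apply: (x_coef (fr := fr) n_ge2 lt).
    by rewrite -(coboundary_x hg zE) -[g _]ug ux mul0r.
  have z0 i : (i < l)%N -> z i = z 0%N.
    by elim: i => // i IH lt; rewrite zS // IH // ltnW.
  apply: par_zero => i lt_i.
  have lt_l : (i + n < l)%N by rewrite /beil_size; lia.
  apply: (yx_coef (fr := fr) n_ge2 lt_l); rewrite -par_myE -uy ug (coboundary_y hg zE).
  by rewrite !z0 ?subrr ?scale0r //; lia.
- by split; [apply: coboundary0 | move=> c u v; apply: coboundary_lin].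
- by move=> u ok; split; [case: (par_cochainP u) | apply: par_cocycle].
- move=> f [hf fd].
  have [a aE] := graded1_value n_ge2 (graded_hom hf (graded_x fr)).
  have [b [c bcE]] := gradedn_value n_ge2 (graded_hom hf (graded_y fr)).
  have abc : seq_cocycle n alpha beta a b c by apply/(cocycle1_seq n_ge2 hf aE bcE).
  pose z := potential a; pose b' i := b i - (z i - z (i + n)%N).
  have bc' : seq_cocycle n alpha beta (fun=> 0) b' c.
    by apply: seq_cocycle_ext abc => i; rewrite /com_defect /b' /z /=; ring.
  have [u [ok ubc]] := seq_cocycle_par bc'.
  have [hu ux uy] := par_cochainP u.
  have gm : graded fr 0 (welt fr 1 z) by apply: (welt_graded n_ge2 _ (rgraded1 fr)).
  have [hg gE] := cochain0P gm; set g := cochain0 _ in hg gE.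
  have gzE i : (g gg : L) * E i = z i *: E i by rewrite gE weltE mul1r.
  exists u => //; exists g => // x; move: x.
  have h1 : bim_hom (fun x => f x - par_cochain u x) by apply: bim_hom_sub.
  have h2 := bim_hom_comp hg (res_d0_hom fr).
  suff e : (fun x => f x - par_cochain u x) = (fun x => g (res_d0 x)).
    by move=> x; apply: (congr1 (fun h => h x) e).
  apply: hom1_eq h1 h2 _ _; apply: (ext_vertices (fr := fr)) => i _.
    by rewrite ux subr0 aE (coboundary_x hg gzE) /z /= opprB addrC subrK.
  rewrite (coboundary_y hg gzE) uy.
  have -> : ((f gy - par_my u : reg) : L) * E i = (f gy : L) * E i - (par_my u : L) * E i.
    exact: mulrBl.
  rewrite bcE par_myE; have [lt|le] := ltnP i n.+2.
    have [-> ->] := ubc i lt; rewrite opprD addrACA subrr addr0 -scalerBl.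
    by rewrite /b' opprB addrC subrK.
  have -> : Y * E i = 0 by rewrite frYE frE_out ?mul0r // /beil_size; lia.
  have -> : X ^+ n * E i = 0 by rewrite (gradedXn fr) frE_out ?mul0r // /beil_size; lia.
  by rewrite !scaler0 addr0 subrr.
- by move=> u ->; rewrite par0; apply: coboundary0.
Qed.

End Cohomology.

(** * Cohomology in degree 2 *)

Section Degree2.
Variables (k : fieldType) (n : nat) (alpha beta : k) (L : algType k).
Variable fr : frame n alpha beta L.
Hypothesis n_ge2 : (2 <= n)%N.
Local Notation reg := (regular_bimodule L).
Local Notation P i := (fb fr (gens n i)).
Local Notation R := (res fr n_ge2).
Local Notation Z i := (@ext_cocycle _ _ reg reg R i).
Local Notation B i := (@ext_coboundary _ _ reg reg R i).

Definition precomp i (f : P i -> reg) : P i.+1 -> reg := fun x => f (res_diff x).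

Lemma precomp_lin i : linear (@precomp i).
Proof. by []. Qed.

Lemma bim_hom_closed (M N : bimodule L) : lin_closed (fun f : M -> N => bim_hom f).
Proof. by split=> [|c f g hf hg]; [apply: bim_hom_zero | apply: bim_hom_linD]. Qed.

Lemma precomp_hom i (f : P i -> reg) : bim_hom f -> bim_hom (precomp f).
Proof. by move=> hf; apply: bim_hom_comp hf (res_diff_hom fr i). Qed.

Lemma precomp0 i (f : P i -> reg) : precomp f = 0 <-> forall x, f (res_diff x) = 0.
Proof. by split=> [e x|e]; [rewrite -[LHS]/(precomp f x) e | apply: funext => x; apply: e]. Qed.

Lemma jump_countE d : jump_count n d =
  (((0 <= d) + ((n <= d) + ((n.+1 <= d) + ((2 * n <= d) + ((2 * n).+1 <= d))))) * (beil_size n - d))%N.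
Proof. by rewrite /jump_count !big_ord_recl big_ord0 /= addn0 !mulnDl. Qed.

(** The Euler characteristic of Hom(P, L) gives
    h2 = c2 - c1 + c0 + h1 - h0. *)
Lemma HH2_res h1 : subquot_dim (Z 1) (B 1) h1 ->
  subquot_dim (Z 2) (B 2) ((if n == 2 then 5 else n.+1) + h1)%N.
Proof.
move=> H1; have H0 := HH0_res fr n_ge2.
have dim0 := fb_hom_dim fr (gens n 0); have dim1 := fb_hom_dim fr (gens n 1).
have dim2 := fb_hom_dim fr (gens n 2).
rewrite !hom_idx_card /= ?andbT in dim0 dim1 dim2; try by rewrite /beil_size; lia.
rewrite !(big_cons, big_nil) ?addn0 in dim0 dim1 dim2.
have precompP i (f : P i -> reg) : bim_hom f /\ precomp f = 0 <-> Z i f.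
  by split=> -[hf fd]; split=> //; apply/precomp0.
have Z0 : (fun v => bim_hom v /\ @precomp 0 v = 0) = Z 0.
  by apply: funext => f; apply: propext.
have Z1 : (fun v => bim_hom v /\ @precomp 1 v = 0) = Z 1.
  by apply: funext => f; apply: propext.
have B0 : (fun v : P 0 -> reg => v = 0) = B 0.
  by apply: funext => f; apply: propext; split=> [-> x|f0]; last exact: funext.
have B1 : (fun v => exists2 w, bim_hom w & v = @precomp 0 w) = B 1.
  apply: funext => f; apply: propext; split=> -[g hg e]; exists g => //.
    by rewrite e.
  exact: funext.
have Z2 : (fun f : P 2 -> reg => bim_hom f) = Z 2.
  apply: funext => f; apply: propext; split=> [hf|[]] //; split=> // x.
  by rewrite (bim_hom0 hf).
have B2 : (fun v => exists2 w, bim_hom w & v = @precomp 1 w) = B 2.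
  apply: funext => f; apply: propext; split=> -[g hg e]; exists g => //.
    by rewrite e.
  exact: funext.
rewrite -Z0 -B0 in H0; rewrite -Z1 -B1 in H1; rewrite -Z2 -B2.
have d10 (v : P 0 -> reg) : bim_hom v -> @precomp 1 (@precomp 0 v) = 0.
  by move=> hv; apply: funext => x; rewrite -[RHS](bim_hom0 hv) -(res_d01 x).
have := subquot_dim_euler (@bim_hom_closed _ _) (@bim_hom_closed _ _) (@bim_hom_closed _ _)
  (@precomp_lin 0) (@precomp_lin 1) (@precomp_hom 0) (@precomp_hom 1) d10 dim0 dim1 dim2 H0 H1.
congr subquot_dim; rewrite !jump_countE /beil_size; clear - n_ge2.
rewrite !leq0n.
have [-> ->] : (n <= 0)%N = false /\ (n < 0)%N = false by split; lia.
have [-> ->] : (2 * n <= 0)%N = false /\ (2 * n < 0)%N = false by split; lia.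
have [-> ->] : (n <= 1)%N = false /\ (n < 1)%N = false by split; lia.
have [-> ->] : (2 * n <= 1)%N = false /\ (2 * n < 1)%N = false by split; lia.
have [-> ->] : (n <= n)%N = true /\ (n < n)%N = false by split; lia.
have [-> ->] : (2 * n <= n)%N = false /\ (2 * n < n)%N = false by split; lia.
have [-> ->] : (n <= n.+2)%N = true /\ (n < n.+2)%N = true by split; lia.
(* Y^2 has degree at most n+2 exactly when n = 2. *)
have [-> ->] : (2 * n <= n.+2)%N = (n == 2) /\ (2 * n < n.+2)%N = false by split; lia.
have [-> ->] : (n <= (2 * n).+1)%N = true /\ (n < (2 * n).+1)%N = true by split; lia.
have [-> ->] : (2 * n <= (2 * n).+1)%N = true /\ (2 * n < (2 * n).+1)%N = true by split; lia.
by case: eqP => [->|_] /=; lia.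
Qed.

End Degree2.

(** * The solutions of the normalised system *)

Section Solutions.
Variables (k : fieldType) (n : nat) (alpha beta : k).
Hypothesis beta_neq0 : beta != 0.
Hypothesis two_neq0 : 2%:R != 0 :> k.
Local Notation p := (lucas alpha beta 0 1).
Local Notation ok := (@par_ok k n alpha beta).
Local Notation disc := (alpha ^+ 2 + 4%:R * beta).

Lemma coord_dim (S : pred 'I_4) (C : 'rV[k]_4 -> Prop) d : #|S| = d ->
  (forall u, C u <-> forall i, ~~ S i -> u 0 i = 0) ->
  subquot_dim C (fun u => u = 0) d.
Proof.
move=> <- CP; apply: (@subquot_dim_fin _ _ _ _ _ S (fun i => delta_mx 0 i)) => [i Si|u /CP Cu|c c0 i Si].
- by apply/CP => j nSj; rewrite mxE eqxx; case: eqP => // ij; rewrite ij Si in nSj.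
- exists (fun i => u 0 i); apply/eqP; rewrite subr_eq0; apply/eqP.
  rewrite {1}(row_sum_delta u) (bigID S) /= [X in _ + X]big1 ?addr0 //.
  by move=> i nSi; rewrite Cu // scale0r.
- have := congr1 (fun u : 'rV_4 => u 0 i) c0; rewrite summxE !mxE (bigD1 i) //= big1 ?addr0.
    by rewrite !mxE !eqxx mulr1.
  by move=> j /andP[_ ne]; rewrite !mxE eqxx eq_sym (negPf ne) mulr0.
Qed.

Lemma ord4P (Q : 'I_4 -> Prop) :
  (forall i, Q i) <-> [/\ Q (inord 0), Q (inord 1), Q (inord 2) & Q (inord 3)].
Proof.
split=> [Qi|[q0 q1 q2 q3] i]; first by split.
by rewrite -[i]inord_val; case: i => -[|[|[|[|//]]]].
Qed.

Lemma par_ok_dim4 : alpha = 0 -> odd n -> p n.+1 = 0 -> subquot_dim ok (fun u => u = 0) 4.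
Proof.
move=> a0 on p0.
apply: (@coord_dim xpredT) => [|u]; first by rewrite -[RHS](card_ord 4); apply: eq_card.
by split=> // _; split; rewrite ?p0 ?mul0r // a0 on eqxx.
Qed.

Lemma par_ok_dim3 : (alpha != 0) || ~~ odd n -> p n.+1 = 0 -> subquot_dim ok (fun u => u = 0) 3.
Proof.
move=> t0 p0.
apply: (@coord_dim (predC1 (inord 1))) => [|u]; first by rewrite cardC1 card_ord.
split=> [[/(_ t0) u1 _ _] i|u0].
  by rewrite negbK => /eqP ->.
by split; rewrite ?p0 ?mul0r // => _; apply: u0; rewrite /= eqxx.
Qed.

(** Eliminating d0 leaves (alpha^2 + 4 beta) d1 = 0. *)
Lemma par_ok_dim1 : (alpha != 0) || ~~ odd n -> p n.+1 != 0 -> disc != 0 ->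
  subquot_dim ok (fun u => u = 0) 1.
Proof.
move=> t0 p0 d0.
apply: (@coord_dim (pred1 (inord 0))) => [|u]; first by rewrite card1.
split=> [[/(_ t0) u1 /eqP + /eqP +]|u0]; last first.
  have [u1 u2 u3] : [/\ u 0 (inord 1) = 0, u 0 (inord 2) = 0 & u 0 (inord 3) = 0].
    by split; apply: u0; rewrite /= -val_eqE /= !inordK.
  by split; rewrite ?u1 ?u2 ?u3 ?mulr0 ?addr0 ?mulr0.
rewrite !mulf_eq0 (negPf p0) /= => /eqP e1 /eqP e2.
have u3 : u 0 (inord 3) = 0.
  have /eqP : disc * u 0 (inord 3) = 0.
    transitivity (2%:R * (alpha * beta * u 0 (inord 2) + (alpha ^+ 2 + 2%:R * beta) * u 0 (inord 3))
      - alpha * (2%:R * beta * u 0 (inord 2) + alpha * u 0 (inord 3))); first by ring.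
    by rewrite e1 e2 !mulr0 subrr.
  by rewrite mulf_eq0 (negPf d0) => /eqP.
have u2 : u 0 (inord 2) = 0.
  move/eqP: e1; rewrite u3 mulr0 addr0 !mulf_eq0 (negPf two_neq0) (negPf beta_neq0).
  by move/eqP.
apply/ord4P; split=> //; by rewrite /= eqxx.
Qed.

(** Here alpha^2 + 2 beta = alpha^2 / 2, so the second equation is alpha / 2 times
    the first and d0 = - alpha d1 / (2 beta) is the only condition. *)
Lemma par_ok_dim2 : alpha != 0 -> p n.+1 != 0 -> disc = 0 ->
  subquot_dim ok (fun u => u = 0) 2.
Proof.
move=> a0 p0 d0.
have a2 : alpha ^+ 2 = - (4%:R * beta) by apply/eqP; rewrite -addr_eq0 d0.
pose v : 'rV[k]_4 := \row_j [:: 0; 0; - alpha / (2%:R * beta); 1]`_j.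
pose w : 'rV[k]_4 := delta_mx 0 (inord 0).
have vE j : (j < 4)%N -> v 0 (inord j) = [:: 0; 0; - alpha / (2%:R * beta); 1]`_j.
  by move=> lt; rewrite mxE inordK.
have wE j : (j < 4)%N -> w 0 (inord j) = (j == 0%N)%:R.
  by move=> lt; rewrite mxE eqxx -val_eqE /= !inordK.
pose e (j : 'I_2) := if j == ord0 then w else v.
exists e; split.
- move=> j; rewrite /e; case: eqP => _.
    by split; rewrite !wE //= ?mulr0 ?addr0 ?mulr0.
  split; rewrite !vE //=.
    by rewrite [X in _ * X](_ : _ = 0) ?mulr0 //; field; rewrite ?beta_neq0 two_neq0.
  rewrite [X in _ * X](_ : _ = 0) ?mulr0 // a2.
  have -> : alpha * beta * (- alpha / (2%:R * beta)) = - (alpha ^+ 2) / 2%:R.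
    by field; rewrite beta_neq0 two_neq0.
  by rewrite a2; field.
- move=> u [u1 /eqP + _]; rewrite mulf_eq0 (negPf p0) /= => /eqP e1.
  exists (fun j => if j == ord0 then u 0 (inord 0) else u 0 (inord 3)).
  rewrite !big_ord_recl !big_ord0 /e /=; apply/eqP; rewrite subr_eq0 addr0; apply/eqP.
  have u2 : u 0 (inord 2) = u 0 (inord 3) * (- alpha / (2%:R * beta)).
    apply: (mulfI (mulf_neq0 two_neq0 beta_neq0)).
    by rewrite -[LHS]opprK (addr0_eq e1); field; rewrite ?beta_neq0 two_neq0.
  apply/rowP => i; move: i; apply/ord4P.
  split; rewrite mxE [X in _ = X + _]mxE [X in _ = _ + X]mxE !wE ?vE //=;
    rewrite ?mulr0 ?mulr1 ?addr0 ?add0r //.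
  by apply: u1; rewrite a0.
- move=> c; rewrite !big_ord_recl !big_ord0 /e /= addr0 => c0.
  have at_j j : (j < 4)%N -> c ord0 * (j == 0%N)%:R + c (lift ord0 ord0) *
    [:: 0; 0; - alpha / (2%:R * beta); 1]`_j = 0.
    move=> lt; have := congr1 (fun u : 'rV_4 => u 0 (inord j)) c0.
    by rewrite /= mxE [X in X + _]mxE [X in _ + X]mxE wE // vE // mxE.
  have := at_j 0%N isT; have := at_j 3 isT; rewrite /= mulr0 add0r !mulr1 mulr0 addr0 => c1 c2 i.
  by case: (unliftP ord0 i) => [j|] -> //; rewrite (ord1 j).
Qed.

(** With alpha = 0 the recurrence preserves the parity of the index and starts
    at 0. *)
Lemma lucas_even m : alpha = 0 -> p m.*2 = 0.
Proof. by move=> a0; elim: m => // m IH; rewrite doubleS lucasSS IH a0 mul0r mulr0 addr0. Qed.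

(** The characteristic polynomial is (t - alpha/2)^2. *)
Lemma lucas_double_root m : disc = 0 -> p m.+1 = m.+1%:R * (alpha / 2%:R) ^+ m.
Proof.
move=> d0; set a := alpha / 2%:R; have aE : alpha = 2%:R * a by rewrite mulrC divfK.
have bE : beta = - a ^+ 2.
  have four_neq0 : 2%:R * 2%:R != 0 :> k by rewrite mulf_neq0.
  apply: (mulfI four_neq0); apply/eqP; rewrite mulrN -addr_eq0; apply/eqP.
  by rewrite -d0 aE; ring.
elim/rec2_ind: m => [||m IH IH'].
- by rewrite /lucas /= mulr1.
- by rewrite lucasSS /lucas /= mulr1 mulr0 addr0 expr1.
- rewrite lucasSS IH IH' bE {1}aE !exprS -!natr1; ring.
Qed.

End Solutions.

(** * Hochschild cohomology of the Beilinson algebra *)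

Theorem theorem1p4 (k : closedFieldType) (n : nat) (alpha beta : k)
    (char0 : [pchar k] =i pred0) (n_ge2 : (2 <= n)%N) (beta_neq0 : beta <> 0) :
  let delta := du_delta alpha beta n in
  let disc := alpha ^+ 2 + 4%:R * beta in
  let HH i d := HH_dim (nabla n alpha beta) i d in
  [/\ (* (i) *)
      HH 0%N 1%N,
      (* (ii) *)
      [/\ odd n -> alpha = 0 -> delta = 0 /\ HH 1%N 4%N,
          ((odd n /\ alpha <> 0 /\ delta = 0) \/ (~~ odd n /\ delta = 0)) ->
            HH 1%N 3%N,
          disc = 0 -> delta <> 0 /\ HH 1%N 2%N &
          delta <> 0 -> disc <> 0 -> HH 1%N 1%N],
      (* (iii) *)
      [/\ n = 2%N -> delta = 0 -> HH 2%N 8%N,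
          n = 2%N -> disc = 0 -> delta <> 0 /\ HH 2%N 7%N &
          n = 2%N -> delta <> 0 -> disc <> 0 -> HH 2%N 6%N] /\
      [/\ odd n -> alpha = 0 -> delta = 0 /\ HH 2%N (n + 5)%N,
          ((odd n /\ alpha <> 0 /\ delta = 0) \/
           ((4 <= n)%N /\ ~~ odd n /\ delta = 0)) -> HH 2%N (n + 4)%N,
          (3 <= n)%N -> disc = 0 -> delta <> 0 /\ HH 2%N (n + 3)%N &
          (3 <= n)%N -> delta <> 0 -> disc <> 0 -> HH 2%N (n + 2)%N] &
      (* (iv) *)
      forall i, (3 <= i)%N -> HH i 0%N].
Proof.
move=> delta disc HH.
have nat_neq0 m : m.+1%:R != 0 :> k by rewrite (proj1 (pcharf0P k)).
have two_neq0 := nat_neq0 1%N.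
move/eqP: beta_neq0 => beta_neq0.
pose fr := nabla_frame alpha beta n_ge2.
pose Par d := subquot_dim (par_ok n alpha beta) (fun u => u = 0) d.
have HH1 d : Par d -> HH 1%N d.
  by move=> /(HH1_res fr n_ge2 beta_neq0 two_neq0); apply: ext_dimP.
have HH2 d : Par d -> HH 2%N ((if n == 2%N then 5 else n.+1) + d)%N.
  by move=> /(HH1_res fr n_ge2 beta_neq0 two_neq0) /HH2_res; apply: ext_dimP.
have dE : delta = lucas alpha beta 0 1 n.+1 by apply: du_deltaE.
have case4 : odd n -> alpha = 0 -> delta = 0 /\ Par 4%N.
  move=> n_odd a0; have d0 : delta = 0.
    have -> : delta = lucas alpha beta 0 1 n.+1./2.*2.
      by rewrite dE; congr lucas; lia.
    exact: lucas_even.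
  by split=> //; apply: par_ok_dim4; rewrite -?dE.
have case3 : (alpha != 0) || ~~ odd n -> delta = 0 -> Par 3%N.
  by move=> t0 d0; apply: par_ok_dim3; rewrite -?dE.
have case2 : disc = 0 -> delta <> 0 /\ Par 2%N.
  move=> disc0; have a0 : alpha != 0.
    apply/eqP => az; move/eqP: disc0.
    by rewrite /disc az expr0n add0r mulf_eq0 (negPf (nat_neq0 3%N)) (negPf beta_neq0).
  have d0 : delta != 0.
    by rewrite dE lucas_double_root // mulf_neq0 // expf_neq0 // mulf_neq0 // invr_eq0.
  by split; [apply/eqP | apply: par_ok_dim2 => //; rewrite -dE].
have case1 : delta <> 0 -> disc <> 0 -> Par 1%N.
  move=> /eqP d0 /eqP disc0; apply: par_ok_dim1 => //; rewrite -?dE //.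
  apply: contraR d0; rewrite negb_or !negbK => /andP[/eqP a0 n_odd].
  by apply/eqP; case: (case4 n_odd a0).
split.
- exact: ext_dimP (HH0_res fr n_ge2).
- split=> [n_odd /(case4 n_odd) [d0 /HH1] // | h | /case2 [d0 /HH1] // | d0 disc0].
    apply/HH1/case3; last by case: h => [[_ []]|[]].
    by case: h => [[_ [/eqP -> _]]|[-> _]] //; rewrite orbT.
  exact: HH1 (case1 d0 disc0).
- split; split.
  + move=> n2 d0; have := HH2 3%N; rewrite n2; apply; apply: case3 => //.
    by rewrite n2 orbT.
  + by move=> n2 /case2 [d0 /HH2]; rewrite {1}n2.
  + by move=> n2 d0 /(case1 d0) /HH2; rewrite {1}n2.
  + move=> n_odd /(case4 n_odd) [d0 /HH2]; rewrite ifN; last by lia.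
    by rewrite addSnnS.
  + move=> h; have /HH2 : Par 3%N.
      apply: case3; last by case: h => [[_ []]|[_ []]].
      by case: h => [[_ [/eqP -> _]]|[_ [-> _]]] //; rewrite orbT.
    rewrite ifN ?addSnnS //.
    by case: h => [[n_odd _]|[n4 _]]; lia.
  + move=> n3 /case2 [d0 /HH2]; rewrite ifN ?addSnnS //; lia.
  + move=> n3 d0 /(case1 d0) /HH2; rewrite ifN ?addSnnS //; lia.
- by move=> i i3; apply: ext_dimP (HH3_res fr n_ge2 i3).
Qed.
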